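(* Let $a,b,d,\alpha>0$ with $\frac{a^2}{4}\ge b$, $n=2$, and $\phi(x,y)=\frac{\alpha^2}{4}e^{-\alpha|x|}e^{-\alpha|y|}$, $x,y\in\mathbb{R}$. (i) If $\frac{a^2}{4}>b$: the problem $\mathcal{L}_1\psi=\lambda\psi$ is spectrally stable if $d\ge\frac{x^*}{\alpha^2}$ and spectrally unstable if $0<d<\frac{x^*}{\alpha^2}$, where $x^*$ is the unique zero in $(0,b)$ of $f(x)=27c_1^2x^2-(b+2x)^3$; the problem $\mathcal{L}_2\psi=\lambda\psi$ is spectrally unstable. (ii) If $\frac{a^2}{4}=b$: for $k=1,2$ the problem $\mathcal{L}_k\psi=\lambda\psi$ is spectrally stable if $d\ge\frac{a^2}{4\alpha^2}$ and spectrally unstable if $0<d<\frac{a^2}{4\alpha^2}$.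
   Context: $c_1=\frac{a}{2}+\sqrt{\frac{a^2}{4}-b}$, $c_2=\frac{a}{2}-\sqrt{\frac{a^2}{4}-b}$ are the constant solutions of $\partial_t u=d\Delta u+u^2\bigl(a-\int_{\mathbb{R}^n}\phi(x-y)u(y,t)dy\bigr)-bu$. Linearizing about $c_k$ via $u=c_k+\psi(x)e^{-\lambda t}$ gives $\mathcal{L}_k\psi=-d\Delta\psi+c_k^2\int_{\mathbb{R}^n}\phi(x-y)\psi(y)dy-b\psi$, $k=1,2$, self-adjoint on $L^2(\mathbb{R}^n)$ with domain $H^2(\mathbb{R}^n)$. The problem $\mathcal{L}_k\psi=\lambda\psi$ is spectrally stable if $\sigma(\mathcal{L}_k)\subseteq[0,\infty)$ and spectrally unstable if $\sigma(\mathcal{L}_k)$ contains some $\lambda<0$. When $\frac{a^2}{4}>b$, $f(x)=27c_1^2x^2-(b+2x)^3$ has exactly one zero $x^*$ in $(0,b)$. *)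

(* Defs.v *)
From HB Require Import structures.
From mathcomp Require Import all_boot all_order all_algebra.
From mathcomp Require Import all_classical all_reals all_analysis.
Set Implicit Arguments. Unset Strict Implicit. Unset Printing Implicit Defensive.
Import Order.TTheory GRing.Theory Num.Theory.
Import numFieldNormedType.Exports.
Local Open Scope classical_set_scope.
Local Open Scope ring_scope.

Section Defs.
Variable R : realType.

Definition leb2 := ((@lebesgue_measure R) \x (@lebesgue_measure R))%E.

Definition e1 : R * R := (1, 0).
Definition e2 : R * R := (0, 1).

(* square-integrable (representatives of elements of L^2(R^2)) *)
Definition L2 (f : R * R -> R) : Prop :=
  measurable_fun setT f /\ leb2.-integrable setT (fun x => ((f x) ^+ 2)%:E).

Definition L2norm (f : R * R -> R) : R :=
  Num.sqrt (Rintegral leb2 setT (fun x => (f x) ^+ 2)).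

Definition ae_eq (f g : R * R -> R) : Prop :=
  {ae leb2, forall x, f x = g x}.

Definition lap (f : R * R -> R) : R * R -> R :=
  fun x => 'D_e1 ('D_e1 f) x + 'D_e2 ('D_e2 f) x.

Definition test_fun (chi : R * R -> R) : Prop :=
  (forall x v, derivable chi x v) /\
  (forall v x w, derivable ('D_v chi) x w) /\
  (forall v w, continuous ('D_w ('D_v chi))) /\
  (exists r : R, forall x : R * R, r < `|x.1| \/ r < `|x.2| -> chi x = 0).

Definition weak_lap (psi g : R * R -> R) : Prop :=
  forall chi, test_fun chi ->
    Rintegral leb2 setT (fun x => psi x * lap chi x) =
    Rintegral leb2 setT (fun x => g x * chi x).

Definition H2 (psi : R * R -> R) : Prop :=
  L2 psi /\ exists g, L2 g /\ weak_lap psi g.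

Definition conv (phi psi : R * R -> R) : R * R -> R :=
  fun x => Rintegral leb2 setT (fun y => phi (x - y) * psi y).

Definition phi_ker (alpha : R) (x : R * R) : R :=
  alpha ^+ 2 / 4 * expR (- alpha * `|x.1|) * expR (- alpha * `|x.2|).

(* constant solutions c_1, c_2 *)
Definition c1 (a b : R) : R := a / 2 + Num.sqrt (a ^+ 2 / 4 - b).
Definition c2 (a b : R) : R := a / 2 - Num.sqrt (a ^+ 2 / 4 - b).

(* L psi = h (a.e.), for L psi = -d Delta psi + c^2 phi*psi - b psi, psi in H^2 *)
Definition Lop_eq (d c b : R) (phi psi h : R * R -> R) : Prop :=
  H2 psi /\ exists g, L2 g /\ weak_lap psi g /\
    ae_eq h (fun x => - d * g x + c ^+ 2 * conv phi psi x - b * psi x).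

(* real lambda is in the resolvent set of L (domain H^2, on L^2):
   L - lambda : H^2 -> L^2 is bijective with bounded inverse *)
Definition in_resolvent (d c b : R) (phi : R * R -> R) (lam : R) : Prop :=
  (forall h, L2 h -> exists psi, Lop_eq d c b phi psi (fun x => h x + lam * psi x)) /\
  (forall psi1 psi2 h, L2 h -> Lop_eq d c b phi psi1 (fun x => h x + lam * psi1 x) ->
                     Lop_eq d c b phi psi2 (fun x => h x + lam * psi2 x) ->
                     ae_eq psi1 psi2) /\
  (exists C : R, 0 < C /\ forall psi h, L2 h -> Lop_eq d c b phi psi (fun x => h x + lam * psi x) ->
                     L2norm psi <= C * L2norm h).

Definition in_spectrum d c b phi (lam : R) : Prop := ~ in_resolvent d c b phi lam.

Definition spectrally_stable d c b phi : Prop :=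
  forall lam, in_spectrum d c b phi lam -> 0 <= lam.

Definition spectrally_unstable d c b phi : Prop :=
  exists lam, lam < 0 /\ in_spectrum d c b phi lam.

Definition fstar (a b x : R) : R := 27 * (c1 a b) ^+ 2 * x ^+ 2 - (b + 2 * x) ^+ 3.

End Defs.

(* Main.v *)
Require Import Defs.
From HB Require Import structures.
From mathcomp Require Import all_boot all_order all_algebra.
From mathcomp Require Import all_classical all_reals all_analysis.
From mathcomp Require Import measurable_realfun.
From mathcomp Require Import ring lra.
Import Defs.
Set Implicit Arguments. Unset Strict Implicit. Unset Printing Implicit Defensive.
Import Order.TTheory GRing.Theory Num.Theory.
Import numFieldNormedType.Exports.
Local Open Scope classical_set_scope.
Local Open Scope ring_scope.

(* Let U, V be the averages in the first and second variable against the kernel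
   alpha/2 exp(-alpha|s|), the resolvents of -d^2/dx^2 and -d^2/dy^2: they are
   commuting positive contractions with symbols u = alpha^2/(alpha^2+p^2) and
   v = alpha^2/(alpha^2+q^2), and the convolution with phi is UV.

   Stability. Testing the weak Laplacian against the C^2 kernel of U^2 V^2 gives
   U^2 V^2 (L psi) = U V N psi, where, writing c^2 = x t^3, b = 3 x t - 2 x and
   X = d alpha^2, N = X (u + v - 2 u v) + c^2 u^2 v^2 - b u v. Tangency of the
   symbol at u = v = 1/t means that N is a Motzkin-type polynomial; multiplied by
   u v + u + v it is a sum of squares with coefficients that are products of the
   positive contractions, hence L >= 0 because UV is injective. For lam < 0 the
   closed relation L - lam is then bounded below and its range has trivial
   orthogonal complement, so it is onto. For c_1 the tangency parameters are
   x = xs, t = (b + 2 xs)/(3 xs); for a^2/4 = b they are x = b, t = 1.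

   Instability. A negative value lam of the symbol
   d (p^2+q^2) + c^2 u v - b is an approximate eigenvalue: the four products of
   cos(p x), sin(p x) with cos(q y), sin(q y), slowly modulated by
   (1 + eps|x|) exp(-eps|x|), satisfy (L - lam) psi = O(eps) and their squares
   add up to the square of the modulation. *)

(** On the diagonal [u = v = 1/s] the symbol is [2 X (s - 1) + c^2/s^2 - b]. Its value and its
    derivative vanish at [s = t] exactly when [c^2 = X t^3] and [b = 3 X t - 2 X]; eliminating [t]
    gives the equation [fstar = 0], hence the threshold. The exponents in [U^2 V^2] are dictated by
    smoothness: the kernel of [U V] has kinks on the axes, that of [U^2 V^2] is C^2 and becomes an
    admissible test function once it is cut off. Positivity of [N] on the square of values of
    [(u, v)] is transferred to operators through the moments [<x, U^i V^j x>] alone, so it must be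
    certified by an algebraic identity; this is why the multiplier [u v + u + v] enters. It is
    removed again, together with the powers of [U] and [V], by partial Neumann sums [Q_n] with
    [S Q_n] tending to the identity. Elements of L^2 are functions rather than classes, and the
    averages are linear only almost everywhere. Operators are therefore known through their
    pairings: identities between them are equalities of semi-inner products, and linearity is read
    off self-adjointness. *)

Lemma quadratic_ge0_discr (R : realType) (a b c : R) : 0 <= c ->
  (forall s, 0 <= a + 2 * s * b + s ^+ 2 * c) -> b ^+ 2 <= a * c.
Proof.
rewrite le_eqVlt => /predU1P[<-|c0] h.
  rewrite mulr0; have [->|b0] := eqVneq b 0; first by rewrite expr0n.
  have := h (- (a + 1) / (2 * b)).
  have -> : a + 2 * (- (a + 1) / (2 * b)) * b + (- (a + 1) / (2 * b)) ^+ 2 * 0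
    = - 1 by field.
  by lra.
have : 0 <= (a + 2 * (- b / c) * b + (- b / c) ^+ 2 * c) * c.
  by rewrite mulr_ge0// ltW.
have -> : (a + 2 * (- b / c) * b + (- b / c) ^+ 2 * c) * c = a * c - b ^+ 2.
  by field; lra.
by lra.
Qed.

(** * Complete semi-inner product spaces, positive contractions, closed relations *)

Section semi_inner_product.
Variables (R : realType) (V : lmodType R) (ip : V -> V -> R).
Hypothesis ipC : forall x y, ip x y = ip y x.
Hypothesis ipDl : forall x y z, ip (x + y) z = ip x z + ip y z.
Hypothesis ipZl : forall a x y, ip (a *: x) y = a * ip x y.
Hypothesis ip_ge0 : forall x, 0 <= ip x x.

Let ipDr x y z : ip z (x + y) = ip z x + ip z y.
Proof. by rewrite ipC ipDl !(ipC _ z). Qed.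

Let ipZr a x y : ip y (a *: x) = a * ip y x.
Proof. by rewrite ipC ipZl ipC. Qed.

Let ipNl x y : ip (- x) y = - ip x y.
Proof. by rewrite -scaleN1r ipZl mulN1r. Qed.

Let ipNr x y : ip y (- x) = - ip y x.
Proof. by rewrite ipC ipNl ipC. Qed.

Let ip0l y : ip 0 y = 0.
Proof. by rewrite -(scale0r 0) ipZl mul0r. Qed.

Let ipE := (ipDl, ipDr, ipNl, ipNr, ipZl, ipZr).

Lemma ip_CS x y : ip x y ^+ 2 <= ip x x * ip y y.
Proof.
apply: quadratic_ge0_discr => // s.
have := ip_ge0 (x + s *: y); rewrite !ipE (ipC y x) => h.
by apply: (le_trans h); rewrite le_eqVlt; apply/orP; left; apply/eqP; ring.
Qed.

Lemma ip_sub_sqr x y : ip (x - y) (x - y) = ip x x - 2 * ip y x + ip y y.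
Proof. by rewrite !ipE (ipC x y); ring. Qed.

Lemma ip_null x y : ip x x = 0 -> ip x y = 0.
Proof.
move=> x0; apply/eqP; rewrite -sqrf_eq0; apply/eqP/le_anti.
by rewrite sqr_ge0 andbT (le_trans (ip_CS _ _))// x0 mul0r.
Qed.

(** Linearity is not part of the notion: after pairing with any vector it follows from moving [S] to
    the other side, and [S] is used in no other way. *)
Definition selfadj (S : V -> V) := forall x y, ip (S x) y = ip x (S y).

Section positive_contraction.
Variable S : V -> V.
Hypotheses (Sadj : selfadj S) (S_ge0 : forall x, 0 <= ip (S x) x).

Lemma positive_CS x y : ip (S x) y ^+ 2 <= ip (S x) x * ip (S y) y.
Proof.
apply: quadratic_ge0_discr => // s.
have := S_ge0 (x + s *: y); rewrite Sadj !ipE -!Sadj !ipE (ipC (S y) x) -Sadj.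
move=> h; apply: (le_trans h); rewrite le_eqVlt; apply/orP; left; apply/eqP.
by ring.
Qed.

(** Cauchy-Schwarz for the form of [S], at [x] and [S x], bounds [|S x|^4] by [<S x, x> |S x|^2].
    This is [S^2 <= S], obtained without a square root of [S]. *)
Lemma positive_contraction_sqr_le x :
  (forall y, ip (S y) y <= ip y y) -> ip (S x) (S x) <= ip (S x) x.
Proof.
move=> S1; have [->//|Sx0] := eqVneq (ip (S x) (S x)) 0.
have Sx_gt0 : 0 < ip (S x) (S x) by rewrite lt_def Sx0 ip_ge0.
rewrite -(ler_pM2r Sx_gt0) -expr2; apply: (le_trans (positive_CS x (S x))).
by rewrite ler_wpM2l.
Qed.

End positive_contraction.

Definition ip_cvg (u : nat -> V) (x : V) :=
  forall e, 0 < e -> exists N, forall n, (N <= n)%N -> ip (u n - x) (u n - x) < e.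

Definition ip_cauchy (u : nat -> V) :=
  forall e, 0 < e -> exists N, forall m n, (N <= m)%N -> (N <= n)%N ->
    ip (u m - u n) (u m - u n) < e.

Hypothesis ip_complete : forall u, ip_cauchy u -> exists x, ip_cvg u x.

Lemma ip_cvg_weak u x y e : ip_cvg u x -> 0 < e ->
  exists N, forall n, (N <= n)%N -> `|ip (u n) y - ip x y| < e.
Proof.
move=> ux e0; have y1 : 0 < ip y y + 1 by have := ip_ge0 y; lra.
have [N hN] := ux (e ^+ 2 / (ip y y + 1)) (divr_gt0 (exprn_gt0 _ e0) y1).
exists N => n /hN; rewrite ltr_pdivlMr// => h.
rewrite -(@ltr_pXn2r _ 2)// ?nnegrE ?(ltW e0)// real_normK ?num_real//.
have -> : ip (u n) y - ip x y = ip (u n - x) y by rewrite !ipE.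
apply: le_lt_trans h; apply: (le_trans (ip_CS _ _)).
by rewrite ler_wpM2l// lerDl.
Qed.

Lemma nonincreasing_nneg_cauchy (s : nat -> R) : (forall n, 0 <= s n) ->
  (forall n, s n.+1 <= s n) -> forall e, 0 < e ->
  exists N, forall m n, (N <= m)%N -> (N <= n)%N -> `|s m - s n| < e.
Proof.
move=> s0 s1 e e0.
have sdec m n : (m <= n)%N -> s n <= s m.
  elim: n => [|n IH]; first by rewrite leqn0 => /eqP->.
  by rewrite leq_eqVlt => /predU1P[->//|/IH]; exact: le_trans.
have hi : has_inf (range s).
  by split; [exists (s 0%N), 0%N|exists 0 => _ [n _ <-]].
have [_ [N _ <-] hN] := inf_adherent e0 hi.
exists N => m n Nm Nn.
have hm := sdec _ _ Nm; have hn := sdec _ _ Nn.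
have := ge_inf hi.2 (imageT s m); have := ge_inf hi.2 (imageT s n).
by rewrite ltr_norml; lra.
Qed.

Section approximate_identity.
Variable S : V -> V.
Hypotheses (Sadj : selfadj S) (S_sqr : forall x, ip (S x) (S x) <= ip (S x) x).
Hypothesis S_inj : forall x, ip (S x) (S x) = 0 -> ip x x = 0.

Let B x := x - S x.
Let a x n := iter n B x.

Let Badj x y : ip (B x) y = ip x (B y).
Proof. by rewrite !ipE Sadj. Qed.

Let iter_adj n x y : ip (a x n) y = ip x (a y n).
Proof. by elim: n x y => //= n IH x y; rewrite /a /= Badj -/(a x n) IH /a -iterSr. Qed.

Let ip_iter m n x : ip (a x m) (a x n) = ip (a x (m + n)) x.
Proof. by rewrite (ipC _ (a x n)) iter_adj /a -iterD addnC ipC. Qed.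

(** The moments [s n = <B^n x, x>] of [B = 1 - S] are nonnegative and nonincreasing, and [|B^m x -
    B^n x|^2 = s (2m) - 2 s (m+n) + s (2n)], so the iterates form a Cauchy sequence. The limit is
    fixed by [B], that is, killed by [S], hence null by injectivity. *)
Lemma resolvent_iter_null x e : 0 < e ->
  exists N, forall n, (N <= n)%N -> ip (a x n) (a x n) < e.
Proof.
pose s n := ip (a x n) x.
have sE m n : ip (a x m) (a x n) = s (m + n)%N by exact: ip_iter.
have s0 n : 0 <= s n.
  (* Even moments are squared norms. An odd one is [<y, B y>], which is nonnegative because
     [|y - S y|^2 >= 0] and [|S y|^2 <= <S y, y>]. *)
  rewrite -(odd_double_half n) -addnn addnCA -sE.
  case: odd; rewrite ?(add1n, add0n)//.
  rewrite [a x _.+1]/a iterS -/(a x _) /B !ipE; set y := a x _.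
  have h1 := S_sqr y; have h2 := ip_ge0 (y - S y); move: h2.
  by rewrite !ipE (ipC y (S y)); lra.
have s1 n : s n.+1 <= s n.
  have [k [->|->]] : exists k, n = (k + k)%N \/ n = (k + k.+1)%N.
  - exists n./2; have := odd_double_half n; rewrite -addnn.
    by case: odd => /= nE; [right|left]; rewrite -{1}nE ?addnS ?add1n ?add0n.
  - rewrite -addnS -!sE [a x k.+1]/a iterS -/(a x k); set y := a x k.
    have h1 := S_sqr y; have h0 := ip_ge0 (S y).
    by rewrite /B !ipE (ipC y (S y)); lra.
  rewrite -addSn -!sE [a x k.+1]/a iterS -/(a x k); set y := a x k.
  have h1 := S_sqr y; have h0 := ip_ge0 (S y).
  by rewrite /B !ipE (ipC y (S y)); lra.
have sC := nonincreasing_nneg_cauchy s0 s1.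
have [y ay] : exists y, ip_cvg (a x) y.
  apply: ip_complete => e' e'0.
  have [N hN] := sC (e' / 2) ltac:(lra).
  exists N => m n Nm Nn; rewrite !ipE !sE.
  have h1 := hN (m + m)%N (m + n)%N (leq_trans Nm (leq_addr _ _)) (leq_trans Nm (leq_addr _ _)).
  have h2 := hN (n + n)%N (m + n)%N (leq_trans Nn (leq_addr _ _)) (leq_trans Nm (leq_addr _ _)).
  by rewrite (addnC n m); move: h1 h2; rewrite !ltr_norml; lra.
have y0 : ip y y = 0.
  apply: S_inj; have [z zE] : exists z, z = S y by exists (S y).
  rewrite -zE; apply/eqP; rewrite -normr_eq0; apply/eqP/le_anti.
  rewrite normr_ge0 andbT; apply/ler_addgt0Pr => d d0; rewrite add0r.
  (* [<z, z> = <S y, z>] is the limit of [<S (a x n), z> = <a x n - a x n.+1, z>], and both iterates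
     have the same weak limit. *)
  have [N1 h1] := ip_cvg_weak (S z) ay (e := d / 4) ltac:(lra).
  have [N2 h2] := ip_cvg_weak z ay (e := d / 4) ltac:(lra).
  pose n := maxn N1 N2.
  have := h1 n (leq_maxl _ _); have := h2 n (leq_maxr _ _).
  have := h2 n.+1 (leq_trans (leq_maxr _ _) (leqnSn _)).
  rewrite -!Sadj -zE /= /B !ipE !ltr_norml ler_norml; lra.
move=> e0; have [N hN] := ay e e0.
exists N => n /hN; rewrite !ipE (ip_null _ y0) (ipC _ y) (ip_null _ y0).
by rewrite y0; lra.
Qed.

(* With [Q_n = \sum_(k < n) (1 - S)^k], the operators [S Q_n] tend strongly to
   the identity, and [<S Q_n f, S Q_n x> = <M (Q_n x), Q_n x>]. *)
Lemma ip_ge0_of_commuting_multiple (M : V -> V) f x : selfadj M ->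
  (forall y z, ip (M (S y)) z = ip (S (M y)) z) ->
  (forall y, 0 <= ip (M y) y) ->
  (forall y, ip (S (S f)) y = ip (M x) y) -> 0 <= ip f x.
Proof.
move=> Madj MS M0 SSf.
pose q y n := iteri n (fun k z => z + a y k) 0.
have Sq y n z : ip (S (q y n)) z = ip (y - a y n) z.
  elim: n z => [|n IH] z /=; first by rewrite Sadj ip0l subrr ip0l.
  by rewrite Sadj !ipE -!Sadj IH /B !ipE; ring.
have SSa n y : ip (S (S (a f n))) y = ip (M (a x n)) y.
  elim: n y => [|n IH] y /=; first exact: SSf.
  rewrite /B !Sadj !ipE -!Sadj Madj !ipE -!Madj IH.
  by rewrite Sadj IH -Sadj MS.
have SSq n y : ip (S (S (q f n))) y = ip (M (q x n)) y.
  elim: n y => [|n IH] y /=; first by rewrite !Sadj Madj !ip0l.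
  by rewrite !Sadj !ipE -!Sadj Madj !ipE -!Madj IH SSa.
have pos n : 0 <= ip (f - a f n) (x - a x n).
  by rewrite -Sq ipC -Sq ipC -Sadj SSq.
rewrite leNgt; apply/negP => neg; set e := - ip f x.
have e0 : 0 < e by rewrite /e; lra.
have x1 : 0 < ip x x + 1 by have := ip_ge0 x; lra.
have f1 : 0 < ip f f + 1 by have := ip_ge0 f; lra.
(* Expanding [pos n] leaves [<f, x>] and three terms containing an iterate of norm below [d]. Each
   is at most [d] times a squared norm plus one, so this [d] keeps their sum below
   [e = - <f, x>]. *)
pose d := Num.min 1 (e / (8 * (ip x x + ip f f + 1))).
have xf1 : 0 < 8 * (ip x x + ip f f + 1) by have := ip_ge0 f; lra.
have d0 : 0 < d by rewrite lt_min ltr01/= divr_gt0.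
have [N1 h1] := resolvent_iter_null f (e := d ^+ 2) (exprn_gt0 _ d0).
have [N2 h2] := resolvent_iter_null x (e := d ^+ 2) (exprn_gt0 _ d0).
pose n := maxn N1 N2.
have {h1} := h1 n (leq_maxl _ _); have {h2} := h2 n (leq_maxr _ _).
have := pos n; rewrite !ipE; set af := a f n; set ax := a x n => p.
move=> hax haf.
have bnd u v : ip u u < d ^+ 2 -> - ip u v <= d * (ip v v + 1).
  move=> hu; have := ip_CS u v; have := ip_ge0 v; have := ip_ge0 u => u0 v0 cs.
  have [|] := leP (- ip u v) 0; first by nra.
  move=> iuv; rewrite -(@ler_pXn2r _ 2)// ?nnegrE; last 2 first.
  - exact: ltW.
  - by rewrite mulr_ge0 ?ltW//; lra.
  by rewrite sqrrN; nra.
have b1 := bnd _ x haf; have b2 := bnd _ f hax; have b3 := bnd _ (- ax) haf.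
have d1 : d <= 1 by rewrite ge_min lexx.
have d2 : d * (8 * (ip x x + ip f f + 1)) <= e.
  by rewrite -ler_pdivlMr// ge_min lexx orbT.
move: b1 b2 b3; rewrite !ipE (ipC ax f) => b1 b2 b3.
have hq : ip ax ax <= 1 by nra.
have dq : d * ip ax ax <= d by nra.
have dx : 0 <= d * ip x x by rewrite mulr_ge0// ltW.
have df : 0 <= d * ip f f by rewrite mulr_ge0// ltW.
rewrite /e in d2; nra.
Qed.

End approximate_identity.

Section bounded_below_relation.
Variables (G : V -> V -> Prop) (D : R).
Hypotheses (D0 : 0 < D)
  (G0 : G 0 0)
  (G_lin : forall a x y x' y', G x y -> G x' y' -> G (a *: x + x') (a *: y + y'))
  (G_closed : forall u v x y, (forall n, G (u n) (v n)) ->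
    ip_cvg u x -> ip_cvg v y -> G x y)
  (G_below : forall x y, G x y -> D * ip x x <= ip y x)
  (G_adj : forall r, (forall x y, G x y -> ip r y = 0) ->
    exists z, G r z /\ ip z z = 0).

Let G_normle x y : G x y -> D ^+ 2 * ip x x <= ip y y.
Proof.
move=> /G_below h; have cs := ip_CS y x; have y0 := ip_ge0 y.
have := ip_ge0 x; rewrite le_eqVlt => /predU1P[<-|x0]; first by rewrite mulr0.
rewrite -(ler_pM2r x0); apply: le_trans cs.
by have := mulr_gt0 D0 x0; nra.
Qed.

(** The projection theorem applied to the range of [G]. Midpoints and the parallelogram identity
    make a minimising sequence of images Cauchy, [G_below] transfers this to the preimages, and
    closedness gives a minimiser. Its residual is orthogonal to the range, hence in the kernel by
    [G_adj], hence null by [G_below]. *)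
Lemma closed_relation_surjective h : exists x y, G x y /\ ip (y - h) (y - h) = 0.
Proof.
pose E := [set t | exists x y, G x y /\ t = ip (y - h) (y - h)].
have hE : has_inf E.
  split; first by exists (ip (0 - h) (0 - h)), 0, 0.
  by exists 0 => _ [x [y [_ ->]]].
pose I := inf E.
have IE x y : G x y -> I <= ip (y - h) (y - h).
  by move=> Gxy; apply: (ge_inf hE.2); exists x, y.
have /choice[uv uvP] (n : nat) : exists p : V * V,
    G p.1 p.2 /\ ip (p.2 - h) (p.2 - h) < I + n.+1%:R^-1.
  have n0 : 0 < n.+1%:R^-1 :> R by rewrite invr_gt0.
  have [_ [x [y [Gxy ->]]] lt] := inf_adherent n0 hE.
  by exists (x, y).
have GB m n : G ((uv m).1 - (uv n).1) ((uv m).2 - (uv n).2).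
  have := G_lin (-1) (uvP n).1 (uvP m).1; rewrite !scaleN1r.
  by rewrite (addrC (- _)) (addrC (- (uv n).2)).
have arch (e : R) : 0 < e -> exists N, forall n, (N <= n)%N -> n.+1%:R^-1 < e.
  move=> e0; exists (Num.truncn e^-1) => n Nn.
  rewrite -[e]invrK ltf_pV2 ?posrE ?invr_gt0//.
  apply: (lt_le_trans (truncnS_gt _)).
  by rewrite ler_nat ltnS.
have par m n : ip ((uv m).2 - (uv n).2) ((uv m).2 - (uv n).2) <=
    2 * (m.+1%:R^-1 + n.+1%:R^-1).
  have := G_lin (1/2) (uvP m).1 (G_lin (1/2) (uvP n).1 G0).
  rewrite !addr0 => /IE; have := (uvP m).2; have := (uvP n).2.
  move: m.+1%:R^-1 n.+1%:R^-1 => cm cn.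
  move: (uv m) (uv n) => [u1 v1] [u2 v2] /=; rewrite !ipE.
  by rewrite (ipC v2 v1) (ipC h v1) (ipC h v2); lra.
have v_cauchy : ip_cauchy (fun n => (uv n).2).
  move=> e e0; have [N hN] := arch (e / 4) ltac:(lra).
  exists N => m n /hN hm /hN hn; have := par m n.
  by move: m.+1%:R^-1 n.+1%:R^-1 hm hn => cm cn; lra.
have u_cauchy : ip_cauchy (fun n => (uv n).1).
  move=> e e0; have [N hN] := v_cauchy (D ^+ 2 * e) (mulr_gt0 (exprn_gt0 _ D0) e0).
  exists N => m n Nm Nn; have := hN m n Nm Nn; have := G_normle (GB m n).
  by move=> h1 h2; rewrite -(ltr_pM2l (exprn_gt0 2 D0)); lra.
have [x ux] := ip_complete u_cauchy; have [y vy] := ip_complete v_cauchy.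
have Gxy : G x y := G_closed (fun n => (uvP n).1) ux vy.
exists x, y; split=> //.
have yI : ip (y - h) (y - h) = I.
  apply/le_anti; rewrite (IE _ _ Gxy) andbT; apply/ler_addgt0Pr => e e0.
  pose K := 2 * (I + 2).
  have I0 : 0 <= I by apply: lb_le_inf hE.1 _ => _ [x' [y' [_ ->]]].
  pose d := Num.min 1 (e / (4 * (I + 3))).
  have d0 : 0 < d by rewrite lt_min ltr01/= divr_gt0//; lra.
  have d1 : d <= 1 by rewrite ge_min lexx.
  have d2 : d * (4 * (I + 3)) <= e by rewrite -ler_pdivlMr ?ge_min ?lexx ?orbT//; lra.
  have [N1 h1] := vy (d ^+ 2) (exprn_gt0 _ d0); have [N2 h2] := arch d d0.
  pose n := maxn N1 N2.
  have {}h1 := h1 n (leq_maxl _ _); have {}h2 := h2 n (leq_maxr _ _).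
  have := (uvP n).2; set v := (uv n).2 in h1 *; move=> h3.
  pose p := y - v; pose q := v - h.
  have pp : ip p p < d ^+ 2.
    by rewrite /p -opprB ipNl ipNr opprK.
  have -> : y - h = p + q by rewrite /p /q addrA subrK.
  have qq : ip q q < I + d by apply: (lt_trans h3); rewrite ltrD2l.
  have cs := ip_CS p q.
  have pq : ip p q <= d * (ip q q + 1).
    have [|pq0] := leP (ip p q) 0; first by have := ip_ge0 q; nra.
    rewrite -(@ler_pXn2r _ 2)// ?nnegrE; last 2 first.
    - exact: ltW.
    - by rewrite mulr_ge0 ?ltW//; have := ip_ge0 q; lra.
    by have := ip_ge0 q; have := ip_ge0 p; nra.
  clearbody p q; rewrite !ipE (ipC q p); have := ip_ge0 q; nra.
have [r rE] : exists r, r = y - h by exists (y - h).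
have r_orth x' y' : G x' y' -> ip r y' = 0.
  (* Minimality says that [|r + s y'|^2 - |r|^2] is nonnegative for every [s]: a quadratic in [s]
     without constant term, so its linear coefficient vanishes. *)
  move=> G'; have : ip r y' ^+ 2 <= 0 * ip y' y'.
    apply: quadratic_ge0_discr => // s.
    have := IE _ _ (G_lin s G' Gxy); rewrite -yI.
    have -> : s *: y' + y - h = r + s *: y' by rewrite rE -addrA addrC.
    by rewrite -rE !ipE (ipC y' r); lra.
  by rewrite mul0r => r0; apply/eqP; rewrite -sqrf_eq0; apply/eqP/le_anti; rewrite r0 sqr_ge0.
have [z [Grz z0]] := G_adj r_orth.
have := G_below Grz; rewrite (ip_null _ z0) -rE => h0.
by apply/le_anti; rewrite ip_ge0 andbT -(pmulr_rle0 _ D0).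
Qed.

End bounded_below_relation.

End semi_inner_product.

(** * Motzkin-type polynomials in two commuting positive contractions *)

Section commuting_pair.
Variables (R : realType) (E : lmodType R) (ip : E -> E -> R).
Hypothesis ipC : forall x y, ip x y = ip y x.
Hypothesis ipDl : forall x y z, ip (x + y) z = ip x z + ip y z.
Hypothesis ipZl : forall a x y, ip (a *: x) y = a * ip x y.
Hypothesis ip_ge0 : forall x, 0 <= ip x x.
Hypothesis ip_complete : forall u, ip_cauchy ip u -> exists x, ip_cvg ip u x.

Let ipDr x y z : ip z (x + y) = ip z x + ip z y.
Proof. by rewrite ipC ipDl !(ipC _ z). Qed.

Let ipZr a x y : ip y (a *: x) = a * ip y x.
Proof. by rewrite ipC ipZl ipC. Qed.

Let ipNl x y : ip (- x) y = - ip x y.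
Proof. by rewrite -scaleN1r ipZl mulN1r. Qed.

Let ipNr x y : ip y (- x) = - ip y x.
Proof. by rewrite ipC ipNl ipC. Qed.

Let ipE := (ipDl, ipDr, ipNl, ipNr, ipZl, ipZr).

Variables U V P Q : E -> E.
Hypotheses (Uadj : selfadj ip U) (Vadj : selfadj ip V).
Hypothesis UV : forall x y, ip (U (V x)) y = ip (V (U x)) y.
Hypothesis UP : forall x y, ip (U x) y = ip (P x) (P y).
Hypothesis VQ : forall x y, ip (V x) y = ip (Q x) (Q y).
Hypothesis PU : forall x y, ip (P (U x)) y = ip (U (P x)) y.
Hypothesis PV : forall x y, ip (P (V x)) y = ip (V (P x)) y.
Hypothesis QU : forall x y, ip (Q (U x)) y = ip (U (Q x)) y.
Hypothesis QV : forall x y, ip (Q (V x)) y = ip (V (Q x)) y.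
Hypotheses (U1 : forall x, ip (U x) x <= ip x x) (V1 : forall x, ip (V x) x <= ip x x).

Definition mon i j x := iter i U (iter j V x).
Arguments mon : simpl never.

Let iterU_adj i x y : ip (iter i U x) y = ip x (iter i U y).
Proof. by elim: i x y => //= i IH x y; rewrite Uadj IH -iterSr. Qed.

Let iterV_adj i x y : ip (iter i V x) y = ip x (iter i V y).
Proof. by elim: i x y => //= i IH x y; rewrite Vadj IH -iterSr. Qed.

Let U_iterV j x y : ip (U (iter j V x)) y = ip (iter j V (U x)) y.
Proof. by elim: j x y => //= j IH x y; rewrite UV Vadj IH -Vadj. Qed.

Let iterU_iterV i j x y : ip (iter i U (iter j V x)) y = ip (iter j V (iter i U x)) y.
Proof.
elim: i x y => //= i IH x y.
by rewrite Uadj IH -U_iterV Uadj.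
Qed.

Lemma mon_adj i j x y : ip (mon i j x) y = ip x (mon i j y).
Proof. by rewrite /mon iterU_iterV iterV_adj iterU_adj. Qed.

Lemma mon_mon i j k l x y : ip x (mon i j (mon k l y)) = ip x (mon (i + k) (j + l) y).
Proof.
rewrite ipC /mon iterU_adj -iterU_iterV -(iterU_adj i) -!iterD.
by rewrite ipC.
Qed.

Let P_iterU i x y : ip (P (iter i U x)) y = ip (iter i U (P x)) y.
Proof. by elim: i x y => //= i IH x y; rewrite PU Uadj IH -Uadj. Qed.

Let P_iterV i x y : ip (P (iter i V x)) y = ip (iter i V (P x)) y.
Proof. by elim: i x y => //= i IH x y; rewrite PV Vadj IH -Vadj. Qed.

Let Q_iterU i x y : ip (Q (iter i U x)) y = ip (iter i U (Q x)) y.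
Proof. by elim: i x y => //= i IH x y; rewrite QU Uadj IH -Uadj. Qed.

Let Q_iterV i x y : ip (Q (iter i V x)) y = ip (iter i V (Q x)) y.
Proof. by elim: i x y => //= i IH x y; rewrite QV Vadj IH -Vadj. Qed.

(** The moments of the joint spectral measure of [U] and [V] at [x]; a polynomial inequality in
    [(u, v)] becomes a linear inequality between them. *)
Let L x i j := ip x (mon i j x).

Let LS1 x i j : L x i.+1 j = L (P x) i j.
Proof.
rewrite /L -!mon_adj /mon /= UP P_iterU iterU_adj P_iterV -iterU_adj.
by [].
Qed.

Let LS2 x i j : L x i j.+1 = L (Q x) i j.
Proof.
rewrite /L -!mon_adj /mon iterU_iterV /= VQ Q_iterV iterV_adj Q_iterU -iterV_adj.
by rewrite -iterU_iterV.
Qed.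

(** [P] and [Q] act as roots, [U = P^* P] and [V = Q^* Q], and commute with [U] and [V]. Hence a
    weight [u^i v^j] is absorbed into the vector, and positivity and monotonicity of moments only
    have to be checked at exponent zero. *)
Let L_root i j x : exists y, forall k l, L x (k + i) (l + j) = L y k l.
Proof.
elim: i j x => [|i IH] j x.
  elim: j x => [|j IHj] x; first by exists x => k l; rewrite !addn0.
  have [y hy] := IHj (Q x); exists y => k l.
  by rewrite addnS LS2 hy.
have [y hy] := IH j (P x); exists y => k l.
by rewrite addnS LS1 hy.
Qed.

Let L_ge0 x i j : 0 <= L x i j.
Proof. by have [y hy] := L_root i j x; rewrite -[i]add0n -[j]add0n hy; exact: ip_ge0. Qed.

Let L_le1 x i j : L x i.+1 j <= L x i j.
Proof.
have [y hy] := L_root i j x.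
by rewrite -[i]add0n -[j]add0n -addSn !hy /L -mon_adj /mon /= (le_trans (U1 _)).
Qed.

Let L_le2 x i j : L x i j.+1 <= L x i j.
Proof.
have [y hy] := L_root i j x.
by rewrite -[i]add0n -[j]add0n -addSn !hy /L -mon_adj /mon /= (le_trans (V1 _)).
Qed.

Let L_le x i j : L x i j <= ip x x.
Proof.
elim: i => [|i IH]; last exact: le_trans (L_le1 _ _ _) IH.
elim: j => [|j IH]; last exact: le_trans (L_le2 _ _ _) IH.
by [].
Qed.

Let monD i j x y z : ip z (mon i j (x + y)) = ip z (mon i j x) + ip z (mon i j y).
Proof. by rewrite -mon_adj ipDr !mon_adj. Qed.

Let monZ i j a x z : ip z (mon i j (a *: x)) = a * ip z (mon i j x).
Proof. by rewrite -mon_adj ipZr mon_adj. Qed.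

Let monE := (monD, monZ).

Let L_lin1 a k l x i j : L (a *: mon k l x + x) i j =
  a ^+ 2 * L x (k + k + i) (l + l + j) + 2 * a * L x (k + i) (l + j) + L x i j.
Proof.
rewrite /L !monE !ipE !mon_adj !mon_mon (addnAC k i k) (addnAC l j l).
by rewrite (addnC i k) (addnC j l); ring.
Qed.

(* A triple [((a, i), j)] stands for the operator [a U^i V^j]. *)
Definition polyop (c : seq (R * nat * nat)) (x : E) : E :=
  foldr (fun p y => p.1.1 *: mon p.1.2 p.2 x + y) 0 c.

Definition polyev (c : seq (R * nat * nat)) (F : nat -> nat -> R) : R :=
  foldr (fun p r => p.1.1 * F p.1.2 p.2 + r) 0 c.

(** Exponents are added with [Nat.add], so that simplification evaluates them in products of
    concrete polynomials. *)
Definition polymul (c c' : seq (R * nat * nat)) : seq (R * nat * nat) :=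
  foldr (fun p r => [seq (p.1.1 * q.1.1, (p.1.2 + q.1.2)%coq_nat, (p.2 + q.2)%coq_nat)
    | q <- c'] ++ r) [::] c.

Lemma ip_polyop c z y : ip z (polyop c y) = polyev c (fun i j => ip z (mon i j y)).
Proof.
elim: c => [|p c IH] /=; first by rewrite ipC -(scale0r 0) ipZl mul0r.
by rewrite ipDr ipZr IH.
Qed.

Lemma polyop_adj c : selfadj ip (polyop c).
Proof.
move=> y z; rewrite ipC !ip_polyop; elim: c => //= p c ->.
by rewrite ipC mon_adj.
Qed.

Lemma polyev_cat c c' F : polyev (c ++ c') F = polyev c F + polyev c' F.
Proof. by elim: c => [|p c IH] /=; rewrite ?add0r// IH addrA. Qed.

Lemma polyop_mul c c' z y :
  ip z (polyop c (polyop c' y)) = ip z (polyop (polymul c c') y).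
Proof.
rewrite !ip_polyop; elim: c => //= p c ->; rewrite polyev_cat; congr (_ + _).
rewrite -mon_adj ip_polyop; elim: c' => [|q c' IH] /=; first by rewrite mulr0.
by rewrite mulrDr IH mon_adj mon_mon mulrA.
Qed.

Lemma polyop_comm c c' z y :
  ip z (polyop c (polyop c' y)) = ip z (polyop c' (polyop c y)).
Proof.
have monop p c0 : ip z (mon p.1 p.2 (polyop c0 y)) = ip (polyop c0 z) (mon p.1 p.2 y).
  rewrite -mon_adj ip_polyop ipC ip_polyop; elim: c0 => //= q c0 ->.
  by congr (_ * _ + _); rewrite !(mon_adj, mon_mon) -mon_adj ipC.
rewrite -[RHS]polyop_adj !ip_polyop; elim: c => //= p c ->.
by rewrite (monop (p.1.2, p.2)).
Qed.

Section motzkin.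
Variable t : R.
Hypothesis t0 : 0 < t.

(* [W N] with [W = uv + u + v] and [N = u + v + u^2 v^2 - 3 u v] at [(t u, t v)].
   [N] is the Motzkin polynomial up to homogenization: it is not a sum of
   squares, but [W N] is a combination of squares with monomial weights. *)
Let WN (c : nat -> nat -> R) (i j : nat) : R :=
  t ^+ 2 * (c i.+2 j + c i j.+2 + 2 * c i.+1 j.+1)
  - 2 * t ^+ 3 * (c i.+2 j.+1 + c i.+1 j.+2) - 3 * t ^+ 4 * c i.+2 j.+2
  + t ^+ 5 * (c i.+3 j.+2 + c i.+2 j.+3) + t ^+ 6 * c i.+3 j.+3.

(** With [a = t u] and [b = t v], the polynomial [W N] equals [a b^2 (1 - a)^2 + a^2 b (1 - b)^2 + a
    b (1 - a b)^2 + (a - b)^2 / 4 + 3 (a + b - 2 a b)^2 / 4]. The facts [h1] to [h5] are the five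
    terms, up to the last two constants. *)
Lemma motzkin_multiple_ge0 x i j : 0 <= WN (L x) i j.
Proof.
have t3 : 0 <= t ^+ 3 by rewrite exprn_ge0 ?ltW.
have t2 : 0 <= t ^+ 2 by rewrite exprn_ge0 ?ltW.
have h1 := mulr_ge0 t3 (L_ge0 ((- t) *: mon 1 0 x + x) i.+1 j.+2).
have h2 := mulr_ge0 t3 (L_ge0 ((- t) *: mon 0 1 x + x) i.+2 j.+1).
have h3 := mulr_ge0 t2 (L_ge0 ((- t ^+ 2) *: mon 1 1 x + x) i.+1 j.+1).
have h4 : 0 <= t ^+ 2 * (L x i.+2 j - 2 * L x i.+1 j.+1 + L x i j.+2).
  have -> : L x i.+2 j - 2 * L x i.+1 j.+1 + L x i j.+2 =
      L ((-1) *: mon 0 1 x + mon 1 0 x) i j.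
    by rewrite /L !monE !ipE !mon_adj !mon_mon !(addn0, addn1, add0n, add1n); ring.
  exact: mulr_ge0 t2 (L_ge0 _ _ _).
have h5 : 0 <= t ^+ 2 * (L x i.+2 j + L x i j.+2 + 2 * L x i.+1 j.+1) + 4 * t ^+ 4 * L x i.+2 j.+2
   - 4 * t ^+ 3 * (L x i.+2 j.+1 + L x i.+1 j.+2).
  have -> : t ^+ 2 * (L x i.+2 j + L x i j.+2 + 2 * L x i.+1 j.+1) + 4 * t ^+ 4 * L x i.+2 j.+2
      - 4 * t ^+ 3 * (L x i.+2 j.+1 + L x i.+1 j.+2) =
      L (t *: mon 0 1 x + (t *: mon 1 0 x + (- 2 * t ^+ 2) *: mon 1 1 x)) i j.
    by rewrite /L !(ipE, mon_adj, monE, mon_mon, addn0, addn1, add0n, add1n); ring.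
  exact: L_ge0.
move: h1 h2 h3 h4 h5; rewrite !(L_lin1, addSn, add0n) /WN => h1 h2 h3 h4 h5.
nra.
Qed.

Variables (x X : R).
Hypotheses (x0 : 0 < x) (xX : x <= X).

(** [cT] is [W] at [(t u, t v)] divided by its value at [u = v = 1], which makes [S = U V T] a
    contraction. [cN] is [u v N], and [M] is [T^2 U V N]. *)
Let k0 : R := (t ^+ 2 + t + t)^-1.
Let cT : seq (R * nat * nat) :=
  [:: (k0 * t ^+ 2, 1%N, 1%N); (k0 * t, 1%N, 0%N); (k0 * t, 0%N, 1%N)].
Let cS := polymul [:: (1, 1%N, 1%N)] cT.
Let cN : seq (R * nat * nat) := [:: (X, 2%N, 1%N); (X, 1%N, 2%N); (- 2 * X, 2%N, 2%N);
  (x * t ^+ 3, 3%N, 3%N); (- (3 * x * t - 2 * x), 2%N, 2%N)].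
Let S := polyop cS.
Let M := polyop (polymul (polymul cT cT) cN).

Let k0_gt0 : 0 < k0.
Proof. by rewrite invr_gt0 !addr_gt0// exprn_gt0. Qed.

Let ipS y : ip (S y) y = k0 * (t ^+ 2 * L y 2 2 + (t * L y 2 1 + t * L y 1 2)).
Proof. by rewrite /S polyop_adj ip_polyop /= /L; ring. Qed.

Let S_ge0 y : 0 <= ip (S y) y.
Proof.
by rewrite ipS !(mulr_ge0, addr_ge0) ?L_ge0 ?exprn_ge0 ?(ltW k0_gt0) ?(ltW t0).
Qed.

Let S_le y : ip (S y) y <= ip y y.
Proof.
rewrite ipS mulrC ler_pdivrMr ?addr_gt0 ?exprn_gt0//.
have t2 : 0 <= t ^+ 2 by rewrite exprn_ge0 ?ltW.
have h1 := ler_wpM2l t2 (L_le y 2 2); have h2 := ler_wpM2l (ltW t0) (L_le y 2 1).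
by have h3 := ler_wpM2l (ltW t0) (L_le y 1 2); lra.
Qed.

Hypothesis UV_inj : forall y, ip (U (V y)) y = 0 -> ip y y = 0.

Let S_inj y : ip (S y) (S y) = 0 -> ip y y = 0.
Proof.
move=> Sy0; have := ip_null ipC ipDl ipZl ip_ge0 y Sy0; rewrite ipS => /eqP.
rewrite mulf_eq0 gt_eqF//= => /eqP h.
have t2 := exprn_gt0 2 t0.
have h1 := mulr_ge0 (ltW t2) (L_ge0 y 2 2).
have h2 := mulr_ge0 (ltW t0) (L_ge0 y 2 1); have h3 := mulr_ge0 (ltW t0) (L_ge0 y 1 2).
have L22 : L y 2 2 = 0.
  have /eqP : t ^+ 2 * L y 2 2 = 0 by lra.
  by rewrite mulf_eq0 gt_eqF//= => /eqP.
apply: UV_inj.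
have z0 : ip (mon 1 1 y) (mon 1 1 y) = 0 by rewrite mon_adj mon_mon.
exact: (ip_null ipC ipDl ipZl ip_ge0 y z0).
Qed.

Let M_ge0 y : 0 <= ip (M y) y.
Proof.
pose D i j := (L y i.+1 j - L y i.+1 j.+1) + (L y i j.+1 - L y i.+1 j.+1).
have D0 i j : 0 <= D i j.
  by have := L_le2 y i.+1 j; have := L_le1 y i j.+1; rewrite /D; lra.
(* For [X = x], [N] is [x / t] times the Motzkin polynomial at [(t u, t v)]; one of the two factors
   [T] makes it a sum of squares, the other only adds positive weights. The excess
   [(X - x) (u + v - 2 u v)] is [u (1 - v) + v (1 - u)] up to the factor [X - x], which is the role
   of [D]. *)
have -> : ip (M y) y = k0 ^+ 2 * (
    (x / t) * (t ^+ 2 * WN (L y) 2 2 + t * (WN (L y) 2 1 + WN (L y) 1 2)) +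
    (X - x) * (t ^+ 4 * D 3 3 + 2 * t ^+ 3 * (D 3 2 + D 2 3) +
      t ^+ 2 * (D 3 1 + 2 * D 2 2 + D 1 3))).
  rewrite /M polyop_adj ip_polyop /= /WN /D /L.
  by field; rewrite gt_eqF.
have t2 := exprn_ge0 2 (ltW t0); have t3 := exprn_ge0 3 (ltW t0).
have t4 := exprn_ge0 4 (ltW t0); have Xx : 0 <= X - x by rewrite subr_ge0.
have := motzkin_multiple_ge0 y 1 2; have := motzkin_multiple_ge0 y 2 1.
have := motzkin_multiple_ge0 y 2 2.
move: (WN (L y) 2 2) (WN (L y) 2 1) (WN (L y) 1 2) => w1 w2 w3 h1 h2 h3.
clearbody D; have xt : 0 <= x / t by rewrite divr_ge0 ?ltW.
apply: mulr_ge0; first exact: sqr_ge0.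
apply: addr_ge0; apply: mulr_ge0 => //.
  by rewrite addr_ge0// mulr_ge0 ?addr_ge0// ltW.
have g0 c u : 0 <= c -> 0 <= u -> 0 <= c * u :> R by exact: mulr_ge0.
by rewrite !addr_ge0// g0// ?addr_ge0// g0.
Qed.

(** The hypothesis is the weak form of [U^2 V^2 f = U V N psi]. Multiplied by [T^2] it reads
    [S^2 f = M psi], the situation of [ip_ge0_of_commuting_multiple]. *)
Lemma spectral_form_ge0 f psi :
  (forall y, ip f (mon 2 2 y) = X * (ip psi (mon 2 1 y) + ip psi (mon 1 2 y)
     - 2 * ip psi (mon 2 2 y)) + x * t ^+ 3 * ip psi (mon 3 3 y)
     - (3 * x * t - 2 * x) * ip psi (mon 2 2 y)) ->
  0 <= ip f psi.
Proof.
move=> hf.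
have S_sqr y : ip (S y) (S y) <= ip (S y) y.
  apply: (positive_contraction_sqr_le ipC ipDl ipZl ip_ge0 (@polyop_adj cS) S_ge0).
  exact: S_le.
apply: (ip_ge0_of_commuting_multiple ipC ipDl ipZl ip_ge0 ip_complete
  (@polyop_adj cS) S_sqr S_inj (@polyop_adj _)) M_ge0 _ => [y z|y].
  by rewrite !(ipC _ z); exact: polyop_comm.
rewrite !polyop_adj polyop_mul.
have hfN z : ip f (mon 2 2 z) = ip psi (polyop cN z).
  by rewrite hf ip_polyop /=; ring.
have -> : ip f (polyop (polymul cS cS) y) = ip f (mon 2 2 (polyop (polymul cT cT) y)).
  rewrite -[RHS]mon_adj !ip_polyop /= !mon_adj !mon_mon /=.
  by rewrite !mul1r.
by rewrite hfN polyop_comm polyop_mul.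
Qed.

End motzkin.

End commuting_pair.

(** * The space L^2 of a measure and its completeness *)

Section square_integrable.
Context (d : measure_display) (T : measurableType d) (R : realType).
Variable mu : {measure set T -> \bar R}.

Definition sqint (f : T -> R) : Prop :=
  measurable_fun setT f /\ mu.-integrable setT (fun x => ((f x) ^+ 2)%:E).

Lemma sqint_mul_integrable f g : sqint f -> sqint g ->
  mu.-integrable setT (fun x => (f x * g x)%:E).
Proof.
move=> [mf f2] [mg g2].
apply: (le_integrable measurableT _ _ (integrableD measurableT f2 g2)) => //.
  by apply/measurable_EFinP; exact: measurable_funM.
move=> x _ /=; rewrite lee_fin [leRHS]ger0_norm ?addr_ge0 ?sqr_ge0//.
by rewrite ler_norml; nra.
Qed.

Lemma sqintZ a f : sqint f -> sqint (fun x => a * f x).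
Proof.
move=> [mf f2]; split; first exact: measurable_funM.
have -> : (fun x => ((a * f x) ^+ 2)%:E) = (fun x => (a ^+ 2)%:E * ((f x) ^+ 2)%:E)%E.
  by apply/funext => x; rewrite -EFinM exprMn.
exact: integrableZl.
Qed.

Lemma sqintD f g : sqint f -> sqint g -> sqint (fun x => f x + g x).
Proof.
move=> lf lg; have [mf f2] := lf; have [mg g2] := lg.
split; first exact: measurable_funD.
have h := integrableD measurableT (integrableZl measurableT 2 f2) (integrableZl measurableT 2 g2).
apply: (le_integrable measurableT _ _ h) => //.
  by apply/measurable_EFinP/measurable_funX/measurable_funD.
move=> x _ /=; have := sqr_ge0 (f x); have := sqr_ge0 (g x) => g0 f0.
rewrite lee_fin [leRHS]ger0_norm; last by lra.
by rewrite ger0_norm ?sqr_ge0//; have := sqr_ge0 (f x - g x); nra.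
Qed.

Definition sqint_pred : {pred T -> R} := mem [set f | sqint f].

Lemma sqint_submod_closed : submod_closed sqint_pred.
Proof.
split=> [|a f g]; rewrite !inE/=.
  split; first exact: measurable_cst.
  by under eq_fun do rewrite /= expr0n; exact: integrable0.
by move=> lf lg; exact: sqintD (sqintZ a lf) lg.
Qed.
HB.instance Definition _ := GRing.isSubmodClosed.Build _ _ sqint_pred
  sqint_submod_closed.

(** Functions, not classes modulo null sets: this matches the predicate [L2] of the statement, and
    makes [ip] only a semi-inner product. *)
Record L2fun := mkL2fun { L2val :> T -> R ; _ : L2val \in sqint_pred }.
HB.instance Definition _ := [isSub for L2val].
HB.instance Definition _ := [Choice of L2fun by <:].
HB.instance Definition _ := [SubChoice_isSubLmodule of L2fun by <:].

Lemma L2funP (f : L2fun) : sqint f.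
Proof. by case: f => f /=; rewrite inE. Qed.

Definition toL2 f (lf : sqint f) : L2fun := mkL2fun (mem_set lf).

Definition ip (f g : L2fun) : R := Rintegral mu setT (fun x => f x * g x).

Lemma ip_integrable (f g : L2fun) : mu.-integrable setT (fun x => (f x * g x)%:E).
Proof. exact: sqint_mul_integrable (L2funP f) (L2funP g). Qed.

Lemma ipC f g : ip f g = ip g f.
Proof. by apply: eq_Rintegral => x _; rewrite mulrC. Qed.

Lemma ipDl f g h : ip (f + g) h = ip f h + ip g h.
Proof.
rewrite -RintegralD//; [|exact: ip_integrable|exact: ip_integrable].
by apply: eq_Rintegral => x _; rewrite /= mulrDl.
Qed.

Lemma ipZl a f g : ip (a *: f) g = a * ip f g.
Proof.
rewrite -RintegralZl//; last exact: ip_integrable.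
by apply: eq_Rintegral => x _; rewrite /= -mulrA.
Qed.

Lemma ip_ge0 f : 0 <= ip f f.
Proof. by apply: Rintegral_ge0 => x _; rewrite -expr2 sqr_ge0. Qed.

Lemma EFin_ip f g : (ip f g)%:E = (\int[mu]_x (f x * g x)%:E)%E.
Proof. by rewrite fineK//; apply: integrable_fin_num => //; exact: ip_integrable. Qed.

Lemma ip_sqrE f : (ip f f)%:E = (\int[mu]_x ((f x) ^+ 2)%:E)%E.
Proof. by rewrite EFin_ip; apply: eq_integral => x _; rewrite expr2. Qed.

Lemma ip_eq0 f : ip f f = 0 -> {ae mu, forall x, f x = 0}.
Proof.
move=> f0; have : (ip f f)%:E = 0%E by rewrite f0.
rewrite ip_sqrE.
have -> : (\int[mu]_x ((f x) ^+ 2)%:E = \int[mu]_x `|((f x) ^+ 2)%:E|)%E.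
  by apply: eq_integral => x _; rewrite gee0_abs// lee_fin sqr_ge0.
have mf2 : measurable_fun setT (fun x => ((f x) ^+ 2)%:E).
  by apply/measurable_EFinP/measurable_funX; have [] := L2funP f.
move/(ae_eq_integral_abs mu measurableT mf2); apply: filterS => x /= /(_ I)[].
by move/eqP; rewrite sqrf_eq0 => /eqP.
Qed.

Lemma Rintegral_ae_eq (f g : T -> R) : measurable_fun setT f -> measurable_fun setT g ->
  {ae mu, forall x, f x = g x} -> Rintegral mu setT f = Rintegral mu setT g.
Proof.
move=> mf mg fg; congr fine; apply: ae_eq_integral => //.
- exact/measurable_EFinP.
- exact/measurable_EFinP.
- by apply: filterS fg => x -> _.
Qed.

Lemma ip_ae_eq (f g h : L2fun) : {ae mu, forall x, f x = g x} -> ip f h = ip g h.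
Proof.
have [mf _] := L2funP f; have [mg _] := L2funP g; have [mh _] := L2funP h.
move=> fg; apply: Rintegral_ae_eq; [exact: measurable_funM..|].
by apply: filterS fg => x ->.
Qed.

(** The weights [4^k] force increments of size at most [Num.sqrt C * 2^-k], so control of squares
    alone gives absolute convergence. *)
Lemma cvgn_of_weighted_sum_sqr (w : R^nat) (C : R) :
  (forall n, \sum_(0 <= k < n) 4 ^+ k * (w k.+1 - w k) ^+ 2 <= C) -> cvgn w.
Proof.
move=> h.
have C0 : 0 <= C by have := h 0%N; rewrite big_nil.
have bnd k : `|w k.+1 - w k| <= Num.sqrt C * 2^-1 ^+ k.
  have b0 : 0 <= Num.sqrt C * 2^-1 ^+ k by rewrite mulr_ge0 ?sqrtr_ge0 ?exprn_ge0.
  rewrite -(@ler_pXn2r _ 2) ?nnegrE//.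
  rewrite real_normK ?num_real// exprMn sqr_sqrtr// -exprM mulnC exprM.
  rewrite -(@ler_pM2l _ (4 ^+ k)) ?exprn_gt0// [leRHS]mulrCA -exprMn.
  have -> : 4 * 2^-1 ^+ 2 = 1 :> R by field.
  rewrite expr1n mulr1; apply: le_trans (h k.+1).
  rewrite big_nat_recr//= lerDr; apply: sumr_ge0 => i _.
  by rewrite mulr_ge0 ?sqr_ge0 ?exprn_ge0.
have cs : cvgn (series (telescope w)).
  apply: normed_cvg.
  apply: (@series_le_cvg _ _ (geometric (Num.sqrt C) 2^-1) _ _ bnd).
  - by move=> n; exact: normr_ge0.
  - by move=> n; rewrite /geometric/= mulr_ge0 ?sqrtr_ge0 ?exprn_ge0.
  - apply: is_cvg_geometric_series; rewrite ger0_norm// invf_lt1//.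
    by rewrite ltr1n.
have -> : w = (fun n => w 0%N + series (telescope w) n).
  by apply/funext => n; exact: eq_sum_telescope.
by apply: is_cvgD => //; exact: is_cvg_cst.
Qed.

Lemma limn_einf_bounded (s : (\bar R)^nat) (c : \bar R) :
  (forall n, (s n <= c)%E) -> (limn_einf s <= c)%E.
Proof.
move=> sc; rewrite limn_einf_lim; apply: lime_le; first exact: is_cvg_einfs.
apply: nearW => n; apply: le_trans (sc n).
by apply: ereal_inf_lbound; exists n => /=.
Qed.

(** Riesz-Fischer. Along a subsequence the squared increments are below [8^-k]; multiplied by [4^k]
    they still have a finite sum of integrals, so the subsequence converges almost everywhere. Fatou
    then bounds the distance of the limit to the original sequence. *)
Lemma L2_complete (u : nat -> L2fun) : ip_cauchy ip u -> exists x, ip_cvg ip u x.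
Proof.
move=> cu.
have e8 k : 0 < 8^-1 ^+ k :> R by rewrite exprn_gt0.
have /choice[N hN] : forall k, exists N, forall m n, (N <= m)%N -> (N <= n)%N ->
    ip (u m - u n) (u m - u n) < 8^-1 ^+ k by move=> k; exact: cu.
(* Cumulative sums make the indices monotone while keeping [nk k] above both [N k] and [k]. *)
pose nk k := (\sum_(0 <= j < k.+1) (N j).+1)%N.
have nkN k : (N k <= nk k)%N by rewrite /nk big_nat_recr//= addnS ltnW// ltnS leq_addl.
have nk_ge k : (k <= nk k)%N.
  elim: k => // k IH; rewrite /nk big_nat_recr//= addnS ltnS (leq_trans IH)//.
  exact: leq_addr.
have nkS k : (nk k <= nk k.+1)%N by rewrite [leqRHS]/nk big_nat_recr//= leq_addr.
pose v k := u (nk k).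
have vd k : ip (v k.+1 - v k) (v k.+1 - v k) < 8^-1 ^+ k.
  by apply: hN => //; exact: leq_trans (nkN k) (nkS k).
have mv k : measurable_fun setT (v k) by have [] := L2funP (v k).
pose D k x := (4 ^+ k * (v k.+1 x - v k x) ^+ 2)%:E.
have D0 k x : (0 <= D k x)%E by rewrite /D lee_fin mulr_ge0 ?sqr_ge0 ?exprn_ge0.
have mD k : measurable_fun setT (D k).
  by apply/measurable_EFinP/measurable_funM => //; apply/measurable_funX/measurable_funB.
have ID k : (\int[mu]_x D k x <= (2^-1 ^+ k)%:E)%E.
  rewrite /D; under eq_integral do rewrite EFinM.
  have mD2 : measurable_fun setT (fun x => ((v k.+1 x - v k x) ^+ 2)%:E).
    by apply/measurable_EFinP/measurable_funX/measurable_funB.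
  rewrite ge0_integralZl_EFin ?exprn_ge0//; last first.
    by move=> x _; rewrite lee_fin sqr_ge0.
  have := ip_sqrE (v k.+1 - v k) => /= <-.
  rewrite -EFinM lee_fin.
  have -> : 2^-1 ^+ k = 4 ^+ k * 8^-1 ^+ k :> R by rewrite -exprMn; congr (_ ^+ _); field.
  by rewrite ler_wpM2l ?exprn_ge0// ltW.
have fin : (\int[mu]_x (\sum_(k <oo) D k x) < +oo)%E.
  rewrite integral_nneseries//.
  apply: (@le_lt_trans _ _ (\sum_(k <oo) (2^-1 ^+ k)%:E)%E).
    by apply: lee_nneseries => *; [exact: integral_ge0|exact: ID].
  rewrite (_ : (fun n => _) = EFin \o series (geometric (1 : R) 2^-1)); last first.
    apply/funext => n; rewrite /= /series/= sumEFin; congr EFin.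
    by apply: eq_bigr => i _; rewrite mul1r.
  have /cvg_geometric_series h : `|2^-1| < 1 :> R.
    by rewrite ger0_norm// invf_lt1// ltr1n.
  rewrite EFin_lim; first exact: ltry.
  by apply/cvg_ex; eexists; exact: h.
have mS : measurable_fun setT (fun x => \sum_(k <oo) D k x)%E.
  by apply: ge0_emeasurable_sum.
have S0 x : (0 <= \sum_(k <oo) D k x)%E by exact: nneseries_ge0.
have intS : mu.-integrable setT (fun x => \sum_(k <oo) D k x)%E.
  apply/integrableP; split => //; under eq_integral do rewrite gee0_abs//.
  exact: fin.
have conv : {ae mu, forall x, cvgn (fun k => v k x)}.
  have := integrable_ae measurableT intS; apply: filterS => x /(_ I).
  move=> /fineK Sx; apply: (@cvgn_of_weighted_sum_sqr _ (fine (\sum_(k <oo) D k x)%E)) => n.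
  rewrite -lee_fin Sx -sumEFin.
  by apply: (@nneseries_lim_ge _ (D^~ x) xpredT 0%N n) => k _ _; exact: D0.
(* The upper limit exists everywhere and is measurable; on the null set of divergence its value is
   irrelevant. *)
pose f x := fine (limn_esup (fun k => (v k x)%:E)).
have mf : measurable_fun setT f.
  apply: measurableT_comp => //; apply: measurable_fun_limn_esup => k.
  exact/measurable_EFinP.
have fE : {ae mu, forall x, (fun k => v k x) @ \oo --> f x}.
  apply: filterS conv => x cx; rewrite /f is_cvg_limn_esupE.
    by rewrite EFin_lim.
  by apply/cvg_ex; exists (limn (fun k => v k x))%:E; apply: cvg_EFin => //; exact: nearW.
have fatou_bnd n K e : (forall k, (K <= k)%N -> ip (v k - u n) (v k - u n) <= e) ->
    (\int[mu]_x ((f x - u n x) ^+ 2)%:E <= e%:E)%E.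
  move=> hk; have [mun _] := L2funP (u n).
  have mk k : measurable_fun setT (fun x => ((v (k + K)%N x - u n x) ^+ 2)%:E).
    by apply/measurable_EFinP/measurable_funX/measurable_funB.
  have -> : (\int[mu]_x ((f x - u n x) ^+ 2)%:E =
      \int[mu]_x limn_einf (fun k => ((v (k + K)%N x - u n x) ^+ 2)%:E))%E.
    apply: ge0_ae_eq_integral => //.
    - by apply/measurable_EFinP/measurable_funX/measurable_funB.
    - rewrite (_ : (fun x => limn_einf _) = (fun x =>
          - limn_esup (fun k => - ((v (k + K)%N x - u n x) ^+ 2)%:E))%E); last first.
        by apply/funext => x; rewrite -limn_einfN; congr limn_einf;
          apply/funext => k; rewrite /comp oppeK.
      apply: measurableT_comp => //; apply: measurable_fun_limn_esup => k.
      exact: measurableT_comp.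
    - by move=> x _; rewrite lee_fin sqr_ge0.
    - move=> x _; rewrite limn_einf_lim; apply: lime_ge; first exact: is_cvg_einfs.
      by apply: nearW => k; apply: le_ereal_inf_tmp => _ [m /= _ <-]; rewrite lee_fin sqr_ge0.
    - apply: filterS fE => x vx _; apply/esym.
      have h : (fun k => ((v (k + K)%N x - u n x) ^+ 2)%:E) @ \oo --> ((f x - u n x) ^+ 2)%:E.
        apply: cvg_EFin; first exact: nearW.
        have h1 : (fun k => v (k + K)%N x - u n x) @ \oo --> f x - u n x.
          apply: cvgB; last exact: cvg_cst.
          by move: vx; rewrite -(cvg_shiftn K).
        exact: (cvg_comp _ (fun y : R => y ^+ 2) h1 (@exprn_continuous _ 2 _)).
      by have [-> _] := cvg_limn_einf_sup h.
  apply: le_trans (fatou mu measurableT mk _) _.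
    by move=> k x _; rewrite lee_fin sqr_ge0.
  apply: limn_einf_bounded => k.
  by have := ip_sqrE (v (k + K)%N - u n) => /= <-; rewrite lee_fin hk// leq_addl.
have fu e : 0 < e -> exists N, forall n, (N <= n)%N ->
    (\int[mu]_x ((f x - u n x) ^+ 2)%:E <= e%:E)%E.
  move=> e0; have [M hM] := cu e e0; exists M => n Mn.
  apply: (fatou_bnd n M) => k Mk; apply/ltW/hM => //.
  exact: leq_trans Mk (nk_ge k).
have sf : sqint f.
  have [M /(_ M (leqnn _)) hM] := fu 1 ltr01.
  have [mM _] := L2funP (u M).
  have h1 : sqint (fun x => f x - u M x).
    split; first exact: measurable_funB.
    apply/integrableP; split.
      by apply/measurable_EFinP/measurable_funX/measurable_funB.
    under eq_integral do rewrite gee0_abs ?lee_fin ?sqr_ge0//.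
    by apply: le_lt_trans hM _; rewrite ltry.
  have := sqintD h1 (L2funP (u M)).
  by congr sqint; apply/funext => x; rewrite subrK.
exists (toL2 sf) => e e0; have [M hM] := fu (e / 2) ltac:(lra).
exists M => n /hM h; rewrite -lte_fin ip_sqrE.
apply: (@le_lt_trans _ _ (e / 2)%:E); last by rewrite lte_fin; lra.
apply: le_trans h; rewrite le_eqVlt; apply/orP; left; apply/eqP.
apply: eq_integral => x _; congr EFin.
have -> : (u n - toL2 sf) x = u n x - f x by [].
by ring.
Qed.

End square_integrable.

(** * Fubini for real-valued integrals and invariance of Lebesgue measure *)

Section Rintegral_product.
Context (d1 d2 : measure_display) (T1 : measurableType d1) (T2 : measurableType d2).
Context (R : realType).
Variables (m1 : {sigma_finite_measure set T1 -> \bar R}).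
Variables (m2 : {sigma_finite_measure set T2 -> \bar R}).

Lemma measurable_Rintegral_section (F : T1 * T2 -> R) : measurable_fun setT F ->
  measurable_fun setT (fun x => Rintegral m2 setT (fun y => F (x, y))).
Proof.
move=> mF; apply: measurableT_comp => //.
have mE : measurable_fun setT (EFin \o F) by exact/measurable_EFinP.
rewrite (_ : (fun x => _) = (fun x =>
   \int[m2]_y (EFin \o F)^\+ (x, y) - \int[m2]_y (EFin \o F)^\- (x, y))%E); last first.
  apply/funext => x; rewrite integralE; congr (_ - _)%E.
  - by apply: eq_integral => y _; rewrite !funeposE.
  - by apply: eq_integral => y _; rewrite !funenegE.
apply: emeasurable_funB.
- apply: (@measurable_fun_fubini_tonelli_F _ _ _ _ _ m2 ((EFin \o F)^\+)%E) => //.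
  exact: measurable_funepos.
- apply: (@measurable_fun_fubini_tonelli_F _ _ _ _ _ m2 ((EFin \o F)^\-)%E) => //.
  exact: measurable_funeneg.
Qed.

(** Only almost every section is integrable. On the others [fine] may return a default value, so the
    iterated integrals are compared almost everywhere. *)
Lemma Rintegral12_prod (F : T1 * T2 -> R) :
  (m1 \x m2)%E.-integrable setT (EFin \o F) ->
  Rintegral m1 setT (fun x => Rintegral m2 setT (fun y => F (x, y))) =
  Rintegral (m1 \x m2)%E setT F.
Proof.
move=> iF; rewrite /Rintegral -(integral12_prod_meas1 iF); congr fine.
have mF : measurable_fun setT F by apply/measurable_EFinP; exact: measurable_int iF.
apply: ae_eq_integral => //.
- exact/measurable_EFinP/measurable_Rintegral_section.
- by have /integrableP[] := integrable_fubini_F iF.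
- have := ae_integrable1 iF; apply: filterS => x ix _.
  by rewrite /Rintegral fineK//; apply: integrable_fin_num.
Qed.

Lemma Rintegral21_prod (F : T1 * T2 -> R) :
  (m1 \x m2)%E.-integrable setT (EFin \o F) ->
  Rintegral m2 setT (fun y => Rintegral m1 setT (fun x => F (x, y))) =
  Rintegral (m1 \x m2)%E setT F.
Proof.
move=> iF; rewrite /Rintegral -(integral21_prod_meas1 iF); congr fine.
have mF : measurable_fun setT F by apply/measurable_EFinP; exact: measurable_int iF.
have ae2 := ae_integrable2 iF.
have mG := measurable_fubini_G iF.
have mfG : measurable_fun setT (fun y => (Rintegral m1 setT (fun x => F (x, y)))%:E).
  by apply/measurable_EFinP; exact: measurableT_comp mG.
apply: ae_eq_integral => //.
apply: filterS ae2 => x ix _.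
by rewrite /Rintegral fineK//; apply: integrable_fin_num.
Qed.

End Rintegral_product.

Section measure_preserving.
Context (d : measure_display) (T : measurableType d) (R : realType).
Variables (mu : {measure set T -> \bar R}) (phi : T -> T).
Hypothesis mphi : measurable_fun setT phi.
Hypothesis phi_inv : forall A, measurable A -> mu (phi @^-1` A) = mu A.

Lemma ge0_integral_preserved (f : T -> \bar R) :
  measurable_fun setT f -> (forall z, 0 <= f z)%E ->
  (\int[mu]_z f (phi z) = \int[mu]_z f z)%E.
Proof.
move=> mf f0.
pose m' := measure_function_pushforward__canonical__measure_function_Measure mu mphi.
transitivity (\int[m']_z f z)%E; last first.
  by apply: eq_measure_integral => A mA _; rewrite /= /pushforward phi_inv.
by rewrite (ge0_integral_pushforward mphi).
Qed.

Lemma Rintegral_preserved (f : T -> R) : measurable_fun setT f ->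
  Rintegral mu setT (fun z => f (phi z)) = Rintegral mu setT f.
Proof.
move=> mf; have mE : measurable_fun setT (EFin \o f) by exact/measurable_EFinP.
rewrite /Rintegral; congr fine; rewrite integralE [RHS]integralE; congr (_ - _)%E.
- rewrite -(ge0_integral_preserved (f := (EFin \o f)^\+)%E) //.
    by apply: eq_integral => z _; rewrite !funeposE.
  exact: measurable_funepos.
- rewrite -(ge0_integral_preserved (f := (EFin \o f)^\-)%E) //.
    by apply: eq_integral => z _; rewrite !funenegE.
  exact: measurable_funeneg.
Qed.

Lemma integrable_preserved (f : T -> R) : mu.-integrable setT (EFin \o f) ->
  mu.-integrable setT (EFin \o (fun z => f (phi z))).
Proof.
move=> /integrableP[mf fi].
have mf' : measurable_fun setT f by exact/measurable_EFinP.
apply/integrableP; split.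
  by apply/measurable_EFinP; exact: measurableT_comp mf' mphi.
rewrite (ge0_integral_preserved (f := fun z => `|(f z)%:E|)%E)//.
exact: measurableT_comp.
Qed.

End measure_preserving.

Section lebesgue_invariance.
Variable R : realType.
Local Notation lam := (@lebesgue_measure R).

Lemma lebesgue_measure_shift (c : R) (A : set R) : measurable A ->
  lam ((fun x => x + c) @^-1` A) = lam A.
Proof.
have mshift : measurable_fun (T := measurableTypeR R) (U := measurableTypeR R)
  setT (fun x : R => x + c).
  have h : measurable_fun [set: R] (fun x : R => x + c) by exact: measurable_funD.
  exact: h.
pose m' := measure_function_pushforward__canonical__measure_function_Measure lam mshift.
move=> mA; rewrite [RHS](@lebesgue_measure_unique R m')//.
move=> X [[a b] _ <-] /=; rewrite /pushforward.
have -> : (fun x => x + c) @^-1` `]a, b]%classic = `]a - c, b - c]%classic.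
  by apply/seteqP; split => x /=; rewrite !in_itv/= lerBrDr ltrBlDr.
by rewrite !lebesgue_measure_itv/= !lte_fin ltrD2r -!EFinB opprB addrA subrK.
Qed.

Lemma lebesgue_measure_opp (A : set R) : measurable A -> lam (-%R @^-1` A) = lam A.
Proof.
have mopp : measurable_fun (T := measurableTypeR R) (U := measurableTypeR R)
  setT (-%R : R -> R).
  have h : measurable_fun [set: R] (-%R : R -> R) by exact: oppr_measurable.
  exact: h.
pose m' := measure_function_pushforward__canonical__measure_function_Measure lam mopp.
move=> mA; rewrite [RHS](@lebesgue_measure_unique R m')//.
move=> X [[a b] _ <-] /=; rewrite /pushforward.
have -> : -%R @^-1` `]a, b]%classic = `[- b, - a[%classic.
  by apply/seteqP; split => x /=; rewrite !in_itv/= lerNl ltrNr andbC.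
by rewrite !lebesgue_measure_itv/= !lte_fin ltrN2 -!EFinB opprK addrC.
Qed.

End lebesgue_invariance.

Section plane_translation.
Variable R : realType.
Local Notation lam := (@lebesgue_measure R).
Local Notation plane := (measurableTypeR R * measurableTypeR R)%type.
Local Notation mu2 := (product_measure1 lam lam).

Lemma measurable_plane_add (d : measure_display) (T : measurableType d) (f g : T -> R * R) :
  measurable_fun setT f -> measurable_fun setT g ->
  measurable_fun setT (fun x => f x + g x).
Proof.
move=> mf mg; apply: measurable_fun_pair => /=.
- apply: (measurable_funD (f := fst \o f) (g := fst \o g)).
  + exact: measurableT_comp measurable_fst mf.
  + exact: measurableT_comp measurable_fst mg.
- apply: (measurable_funD (f := snd \o f) (g := snd \o g)).
  + exact: measurableT_comp measurable_snd mf.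
  + exact: measurableT_comp measurable_snd mg.
Qed.

Lemma measurable_plane_shift (w : R * R) :
  measurable_fun (T := plane) (U := plane) setT (fun z : R * R => z + w).
Proof.
have h : measurable_fun [set: R * R] (fun z : R * R => z + w).
  by apply: measurable_plane_add; [exact: measurable_id|exact: measurable_cst].
exact: h.
Qed.

Lemma leb2_shift (w : R * R) (A : set plane) : measurable A ->
  mu2 ((fun z : R * R => z + w) @^-1` A) = mu2 A.
Proof.
pose m' := measure_function_pushforward__canonical__measure_function_Measure
  mu2 (measurable_plane_shift w).
move=> mA; rewrite [RHS](product_measure_unique (m' := m'))//.
move=> X Y mX mY; rewrite /= /pushforward.
have -> : (fun z : R * R => z + w) @^-1` (X `*` Y) =
    ((fun x => x + w.1) @^-1` X) `*` ((fun x => x + w.2) @^-1` Y).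
  by apply/seteqP; split => z.
have mshift1 c : measurable_fun (T := measurableTypeR R) (U := measurableTypeR R)
    setT (fun x : R => x + c).
  have h : measurable_fun [set: R] (fun x : R => x + c) by exact: measurable_funD.
  exact: h.
have mpre c (B : set (measurableTypeR R)) : measurable B ->
    measurable ((fun x : R => x + c) @^-1` B : set (measurableTypeR R)).
  by move=> mB; rewrite -[X in measurable X]setTI; exact: mshift1.
rewrite product_measure1E; [|exact: mpre|exact: mpre].
by congr (_ * _)%E; exact: lebesgue_measure_shift.
Qed.

End plane_translation.

(** * Averages of translates on a space with invariant measure *)

Section averaging_operators.
Context (R : realType) (dG : measure_display) (G : measurableType dG).
Variables (padd : G -> G -> G) (popp : G -> G).
Variable mu : {sigma_finite_measure set G -> \bar R}.
Local Infix "⊞" := padd (at level 50, left associativity).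
Hypothesis paddA : forall x y z, x ⊞ (y ⊞ z) = (x ⊞ y) ⊞ z.
Hypothesis paddAC : forall x y z, (x ⊞ y) ⊞ z = (x ⊞ z) ⊞ y.
Hypothesis paddK : forall x y, (x ⊞ y) ⊞ popp y = x.
Hypothesis measurable_padd : forall (d : measure_display) (T : measurableType d)
  (f g : T -> G), measurable_fun setT f -> measurable_fun setT g ->
  measurable_fun setT (fun x => f x ⊞ g x).
Hypothesis mu_invariant : forall (w : G) (A : set G), measurable A ->
  mu ((fun z => z ⊞ w) @^-1` A) = mu A.
Local Notation H := (L2fun mu).

Let measurable_shift (w : G) : measurable_fun setT (fun z => z ⊞ w).
Proof. by apply: measurable_padd. Qed.

Let integral_invariant w (f : G -> \bar R) :=
  @ge0_integral_preserved _ _ _ _ _ (measurable_shift w) (@mu_invariant w) f.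

Let Rintegral_shift w := Rintegral_preserved (measurable_shift w) (@mu_invariant w).

Lemma integrable_mul_bounded (d : measure_display) (T : measurableType d)
    (m : {measure set T -> \bar R}) (k r : T -> R) (C : R) :
  m.-integrable setT (EFin \o k) -> measurable_fun setT r ->
  (forall x, `|r x| <= C) -> m.-integrable setT (EFin \o (fun x => k x * r x)).
Proof.
move=> ik mr rC.
have mk : measurable_fun setT k by apply/measurable_EFinP; exact: measurable_int ik.
have C0 : 0 <= C by exact: le_trans (rC point).
apply: (le_integrable measurableT _ _ (integrableZl measurableT C ik)) => //.
  by apply/measurable_EFinP; exact: measurable_funM.
move=> x _ /=; rewrite lee_fin !normrM (ger0_norm C0) mulrC.
by rewrite ler_wpM2r.
Qed.

Lemma sqint_shift (w : G) (f : H) : sqint mu (fun z : G => f (z ⊞ w)).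
Proof.
have [mf f2] := L2funP f.
have mw : measurable_fun setT (fun z : G => f (z ⊞ w)).
  exact: measurableT_comp mf (measurable_shift w).
split=> //; apply/integrableP; split.
  by apply/measurable_EFinP; exact: measurable_funX.
under eq_integral do rewrite gee0_abs ?lee_fin ?sqr_ge0//.
rewrite (integral_invariant w (f := fun z => ((f z) ^+ 2)%:E)).
- by rewrite -ip_sqrE ltry.
- by apply/measurable_EFinP; exact: measurable_funX.
- by move=> z; rewrite lee_fin sqr_ge0.
Qed.

Definition shiftL2 (w : G) (f : H) : H := toL2 (sqint_shift w f).

Lemma ip_shift2 w f : ip (shiftL2 w f) (shiftL2 w f) = ip f f.
Proof.
have [mf _] := L2funP f.
rewrite /ip; apply: (Rintegral_shift w (f := fun z => f z * f z)).
exact: measurable_funM.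
Qed.

(** The cross-correlation of [f] and [g]. Pairings of averages are integrals of the kernel against
    this bounded function ([ip_avg]), so operator identities reduce to scalar integrals. *)
Definition corr (f g : H) (w : G) : R := ip (shiftL2 w f) g.

Lemma corr_le f g w : `|corr f g w| <= ip f f + ip g g.
Proof.
have := ip_CS (@ipC _ _ _ mu) (@ipDl _ _ _ mu) (@ipZl _ _ _ mu) (@ip_ge0 _ _ _ mu)
  (shiftL2 w f) g.
rewrite ip_shift2 -/(corr f g w) => h.
have := ip_ge0 f; have := ip_ge0 g => g0 f0.
rewrite -(@ler_pXn2r _ 2) ?nnegrE// ?addr_ge0// real_normK ?num_real//.
by apply: (le_trans h); nra.
Qed.

Lemma measurable_corr f g : measurable_fun setT (corr f g).
Proof.
have [mf _] := L2funP f; have [mg _] := L2funP g.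
apply: (measurable_Rintegral_section mu (F := fun p : G * G =>
  f (p.2 ⊞ p.1) * g p.2)).
apply: measurable_funM; last exact: measurableT_comp mg measurable_snd.
apply: measurableT_comp mf _.
have h : measurable_fun [set: G * G] (fun p => p.2 ⊞ p.1).
  by apply: measurable_padd; [exact: measurable_snd|exact: measurable_fst].
exact: h.
Qed.

Lemma corrN f g w : corr f g (popp w) = corr g f w.
Proof.
have [mf _] := L2funP f; have [mg _] := L2funP g.
rewrite /corr /ip -(Rintegral_shift w); last first.
  apply: measurable_funM => //.
  exact: measurableT_comp mf (measurable_shift (popp w)).
by apply: eq_Rintegral => z _ /=; rewrite paddK mulrC.
Qed.

Lemma corr_shift f g w v : corr (shiftL2 w f) g v = corr f g (v ⊞ w).
Proof. by apply: eq_Rintegral => z _ /=; rewrite paddA. Qed.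

(** The weight lives on a parameter space [Om] mapped into [G] by [dir], so that averages along a
    line of the plane and averages over the whole plane are instances of one construction. *)
Record avg_kernel (d : measure_display) (Om : measurableType d)
    (m : {measure set Om -> \bar R}) := AvgKernel {
  wt : Om -> R ;
  dir : Om -> G ;
  measurable_wt : measurable_fun setT wt ;
  wt_ge0 : forall s, 0 <= wt s ;
  wt_integrable : m.-integrable setT (EFin \o wt) ;
  measurable_dir : measurable_fun setT dir }.

Section averaging.
Context (d : measure_display) (Om : measurableType d).
Variables (m : {sigma_finite_measure set Om -> \bar R}) (K : avg_kernel m).
Let k := wt K.
Let th := dir K.
Let M := Rintegral m setT k.
Let mk := measurable_wt K.
Let k0 := wt_ge0 K.
Let ik := wt_integrable K.

Definition avg_fun (f : G -> R) (z : G) : R :=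
  Rintegral m setT (fun s => k s * f (z ⊞ th s)).

Let M0 : 0 <= M. Proof. by apply: Rintegral_ge0 => s _; exact: k0. Qed.

Let ME : (M%:E = \int[m]_s (k s)%:E)%E.
Proof. by rewrite fineK//; exact: integrable_fin_num. Qed.

Let measurable_shifted (f : G -> R) : measurable_fun setT f ->
  measurable_fun setT (fun p : G * Om => f (p.1 ⊞ th p.2)).
Proof.
move=> mf; apply: measurableT_comp mf _.
have h : measurable_fun [set: G * Om] (fun p => p.1 ⊞ th p.2).
  apply: measurable_padd; first exact: measurable_fst.
  exact: measurableT_comp (measurable_dir K) measurable_snd.
exact: h.
Qed.

Let measurable_shifted1 (f : G -> R) (z : G) : measurable_fun setT f ->
  measurable_fun setT (fun s => f (z ⊞ th s)).
Proof.
move=> mf.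
exact: (measurableT_comp (measurable_shifted mf) (measurable_pair1 z)).
Qed.

(** Cauchy-Schwarz for the factors [sqrt k] and [sqrt k * f]. The constant is [1 + M] rather than
    [M] so that it stays positive, which settles the case of an infinite right-hand integral. *)
Lemma avg_sqr_le (f : H) z : (((avg_fun f z) ^+ 2)%:E <=
  (1 + M)%:E * \int[m]_s (k s * f (z ⊞ th s) ^+ 2)%:E)%E.
Proof.
have [mf _] := L2funP f.
have I0 : (0 <= \int[m]_s (k s * f (z ⊞ th s) ^+ 2)%:E)%E.
  by apply: integral_ge0 => s _; rewrite lee_fin mulr_ge0 ?sqr_ge0 ?k0.
have [Ioo|] := ltP (\int[m]_s (k s * f (z ⊞ th s) ^+ 2)%:E)%E +oo%E; last first.
  rewrite leye_eq => /eqP ->; rewrite gt0_muley ?leey// lte_fin.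
  by have := M0; lra.
have ms : measurable_fun setT (fun s => Num.sqrt (k s)).
  have msq : measurable_fun setT (@Num.sqrt R).
    by apply: continuous_measurable_fun => x; exact: sqrt_continuous.
  exact: measurableT_comp msq mk.
have sk : sqint m (fun s => Num.sqrt (k s)).
  by split=> //; under eq_fun do rewrite sqr_sqrtr//.
have sf : sqint m (fun s => Num.sqrt (k s) * f (z ⊞ th s)).
  split; first by apply: measurable_funM => //; exact: measurable_shifted1.
  under eq_fun do rewrite exprMn sqr_sqrtr//.
  apply/integrableP; split.
    apply/measurable_EFinP/measurable_funM => //; apply: measurable_funX.
    exact: measurable_shifted1.
  rewrite (eq_integral (fun s => (k s * f (z ⊞ th s) ^+ 2)%:E)) => [|s _].
    exact: Ioo.
  by rewrite gee0_abs// lee_fin mulr_ge0 ?sqr_ge0 ?k0.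
have := ip_CS (@ipC _ _ _ m) (@ipDl _ _ _ m) (@ipZl _ _ _ m) (@ip_ge0 _ _ _ m)
  (toL2 sk) (toL2 sf).
have -> : ip (toL2 sk) (toL2 sf) = avg_fun f z.
  by apply: eq_Rintegral => s _ /=; rewrite mulrA -expr2 sqr_sqrtr.
have -> : ip (toL2 sk) (toL2 sk) = M.
  by apply: eq_Rintegral => s _ /=; rewrite -expr2 sqr_sqrtr.
have ff : ((ip (toL2 sf) (toL2 sf))%:E = \int[m]_s (k s * f (z ⊞ th s) ^+ 2)%:E)%E.
  by rewrite ip_sqrE; apply: eq_integral => s _ /=; rewrite exprMn sqr_sqrtr.
rewrite -ff -EFinM lee_fin => h; apply: (le_trans h).
by rewrite ler_wpM2r ?ip_ge0//; have := M0; lra.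
Qed.

Lemma avg_tonelli (f : H) :
  (\int[mu]_z \int[m]_s (k s * f (z ⊞ th s) ^+ 2)%:E = (M * ip f f)%:E)%E.
Proof.
have [mf _] := L2funP f.
have mF : measurable_fun setT (fun p : G * Om =>
    (k p.2 * f (p.1 ⊞ th p.2) ^+ 2)%:E).
  apply/measurable_EFinP/measurable_funM.
    exact: measurableT_comp mk measurable_snd.
  by apply: measurable_funX; exact: measurable_shifted.
have F0 p : (0 <= (k p.2 * f (p.1 ⊞ th p.2) ^+ 2)%:E)%E.
  by rewrite lee_fin mulr_ge0 ?sqr_ge0 ?k0.
rewrite (fubini_tonelli _ mF F0) /=.
have h s : (\int[mu]_z (k s * f (z ⊞ th s) ^+ 2)%:E = (k s)%:E * (ip f f)%:E)%E.
  under eq_integral do rewrite EFinM.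
  have mz : measurable_fun setT (fun z : G => (f (z ⊞ th s) ^+ 2)%:E).
    apply/measurable_EFinP/measurable_funX.
    exact: measurableT_comp mf (measurable_shift (th s)).
  rewrite ge0_integralZl_EFin//; last first.
    by move=> z _; rewrite lee_fin sqr_ge0.
  rewrite (integral_invariant (th s) (f := fun z => ((f z) ^+ 2)%:E)) ?ip_sqrE//.
  - by apply/measurable_EFinP; exact: measurable_funX.
  - by move=> z; rewrite lee_fin sqr_ge0.
under eq_integral do rewrite h.
rewrite ge0_integralZr ?lee_fin ?ip_ge0//.
- by rewrite -ME EFinM.
- exact/measurable_EFinP.
- by move=> s _; rewrite lee_fin.
Qed.

Let measurable_avg (f : H) : measurable_fun setT (avg_fun f).
Proof.
have [mf _] := L2funP f.
apply: (measurable_Rintegral_section m (F := fun p : G * Om =>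
  k p.2 * f (p.1 ⊞ th p.2))).
apply: measurable_funM; last exact: measurable_shifted.
exact: measurableT_comp mk measurable_snd.
Qed.

Let avg_norm_le (f : H) :
  (\int[mu]_z ((avg_fun f z) ^+ 2)%:E <= ((1 + M) ^+ 2 * ip f f)%:E)%E.
Proof.
have [mf _] := L2funP f.
have M1 : 0 <= 1 + M by rewrite addr_ge0.
have mG : measurable_fun setT
    (fun z : G => \int[m]_s (k s * f (z ⊞ th s) ^+ 2)%:E)%E.
  apply: (@measurable_fun_fubini_tonelli_F _ _ _ _ _ m (fun p : G * Om =>
    (k p.2 * f (p.1 ⊞ th p.2) ^+ 2)%:E)).
  - apply/measurable_EFinP/measurable_funM.
      exact: measurableT_comp mk measurable_snd.
    by apply: measurable_funX; exact: measurable_shifted.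
  - by move=> p; rewrite lee_fin mulr_ge0 ?sqr_ge0 ?k0.
apply: (@le_trans _ _ ((1 + M)%:E * (M * ip f f)%:E)%E).
  rewrite -avg_tonelli -ge0_integralZl_EFin//; last first.
    by move=> z _; apply: integral_ge0 => s _; rewrite lee_fin mulr_ge0 ?sqr_ge0 ?k0.
  apply: ge0_le_integral => //.
  - by move=> z _; rewrite lee_fin sqr_ge0.
  - by apply/measurable_EFinP; exact: measurable_funX.
  - exact: measurable_funeM.
  - by move=> z _; exact: avg_sqr_le.
by rewrite -EFinM lee_fin; have := ip_ge0 f; nra.
Qed.

Lemma avg_sqint (f : H) : sqint mu (avg_fun f).
Proof.
split=> //; apply/integrableP; split.
  by apply/measurable_EFinP; exact: measurable_funX.
under eq_integral do rewrite gee0_abs ?lee_fin ?sqr_ge0//.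
by apply: le_lt_trans (avg_norm_le f) _; rewrite ltry.
Qed.

Definition avg (f : H) : H := toL2 (avg_sqint f).

Lemma ip_avg f g : ip (avg f) g = Rintegral m setT (fun s => k s * corr f g (th s)).
Proof.
have [mf _] := L2funP f; have [mg _] := L2funP g.
pose F (p : G * Om) := k p.2 * f (p.1 ⊞ th p.2) * g p.1.
have mF : measurable_fun setT F.
  apply: measurable_funM; last exact: measurableT_comp mg measurable_fst.
  apply: measurable_funM; last exact: measurable_shifted.
  exact: measurableT_comp mk measurable_snd.
have iF : (mu \x m)%E.-integrable setT (EFin \o F).
  apply/integrable21ltyP; first exact/measurable_EFinP.
  apply: (@le_lt_trans _ _ (\int[m]_s ((k s)%:E * (ip f f + ip g g)%:E))%E); last first.
    rewrite ge0_integralZr ?lee_fin ?addr_ge0 ?ip_ge0//.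
    - by rewrite -ME -EFinM ltry.
    - exact/measurable_EFinP.
    - by move=> s _; rewrite lee_fin.
  apply: ge0_le_integral => //.
  - by move=> s _; exact: integral_ge0.
  - apply: (@measurable_fun_fubini_tonelli_G _ _ _ _ _ mu (fun p : G * Om => `|(F p)%:E|)%E) => //.
    by apply: measurableT_comp => //; exact/measurable_EFinP.
  - apply/measurable_EFinP; exact: measurable_funM.
  - move=> s _.
    have mz : measurable_fun setT (fun z : G => f (z ⊞ th s)).
      exact: measurableT_comp mf (measurable_shift (th s)).
    have [_ f2] := sqint_shift (th s) f; have [_ g2] := L2funP g.
    have -> : (ip f f + ip g g)%:E =
        (\int[mu]_z ((f (z ⊞ th s) ^+ 2)%:E + (g z ^+ 2)%:E))%E.
      rewrite integralD//= EFinD; congr (_ + _)%E; last by rewrite ip_sqrE.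
      by have := ip_sqrE (shiftL2 (th s) f); rewrite ip_shift2.
    rewrite -ge0_integralZl_EFin//.
    + apply: ge0_le_integral => //.
      * apply: measurableT_comp => //; apply/measurable_EFinP; rewrite /F /=.
        apply: measurable_funM => //; apply: measurable_funM => //.
      * apply: measurable_funeM; apply: emeasurable_funD; apply/measurable_EFinP; exact: measurable_funX.
      * move=> z _; rewrite /F /= -EFinD -EFinM lee_fin -mulrA normrM ger0_norm//.
        rewrite ler_wpM2l//; have := sqr_ge0 (f (z ⊞ th s)); have := sqr_ge0 (g z).
        by rewrite ler_norml; nra.
    + by move=> z _; rewrite -EFinD lee_fin addr_ge0 ?sqr_ge0.
    + apply: emeasurable_funD; apply/measurable_EFinP; exact: measurable_funX.
transitivity (Rintegral mu setT (fun z => Rintegral m setT (fun s => F (z, s)))).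
  have := ae_integrable1 iF => aeF.
  apply: Rintegral_ae_eq.
  - by apply: measurable_funM => //; exact: measurable_avg.
  - exact: measurable_Rintegral_section.
  - apply: filterS aeF => z iz.
    (* Integrability of the section of [F] gives that of [k * f] only after division by [g z]; when
       [g z = 0] both sides vanish. *)
    have [gz0|gz0] := eqVneq (g z) 0.
      rewrite gz0 mulr0 /F (_ : (fun s => _) = cst 0); last first.
        by apply/funext => s /=; rewrite gz0 mulr0.
      by rewrite /Rintegral integral0.
    have ikf : m.-integrable setT (EFin \o (fun s => k s * f (z ⊞ th s))).
      have := integrableZr measurableT (g z)^-1 iz.
      congr (_.-integrable _ _); apply/funext => s /=.
      by rewrite /F -EFinM mulfK.
    by rewrite /= /avg_fun -RintegralZr.
rewrite Rintegral12_prod// -Rintegral21_prod//.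
apply: eq_Rintegral => s _; rewrite /F /=.
rewrite -RintegralZl//; last exact: ip_integrable (shiftL2 (th s) f) g.
by apply: eq_Rintegral => z _ /=; rewrite mulrA.
Qed.

Lemma corr_avg f g w : corr (avg f) g w =
  Rintegral m setT (fun s => k s * corr f g (th s ⊞ w)).
Proof.
transitivity (ip (avg (shiftL2 w f)) g).
  apply: eq_Rintegral => z _; congr (_ * _); apply: eq_Rintegral => s _ /=.
  by rewrite paddAC.
by rewrite ip_avg; apply: eq_Rintegral => s _; rewrite corr_shift.
Qed.

End averaging.
End averaging_operators.

(** * Weights on the line, their convolutions, and exponential kernels *)

Section one_dimensional_kernels.
Variable R : realType.
Local Notation lam := (@lebesgue_measure R).
Local Notation line := (measurableTypeR R).

Lemma measurable_line_shift (c : R) :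
  measurable_fun (T := line) (U := line) setT (fun x : R => x + c).
Proof.
have h : measurable_fun [set: R] (fun x : R => x + c) by exact: measurable_funD.
exact: h.
Qed.

Lemma measurable_line_opp : measurable_fun (T := line) (U := line) setT (-%R : R -> R).
Proof.
have h : measurable_fun [set: R] (-%R : R -> R) by exact: oppr_measurable.
exact: h.
Qed.

Lemma Rintegral_line_shift (c : R) (f : R -> R) : measurable_fun setT f ->
  Rintegral lam setT (fun x => f (x + c)) = Rintegral lam setT f.
Proof.
exact: (Rintegral_preserved (measurable_line_shift c) (@lebesgue_measure_shift _ c)).
Qed.

Lemma Rintegral_line_opp (f : R -> R) : measurable_fun setT f ->
  Rintegral lam setT (fun x => f (- x)) = Rintegral lam setT f.
Proof.
exact: (Rintegral_preserved measurable_line_opp (@lebesgue_measure_opp _)).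
Qed.

Lemma integrable_line_shift (c : R) (f : R -> R) :
  lam.-integrable setT (EFin \o f) -> lam.-integrable setT (EFin \o (fun x => f (x + c))).
Proof.
exact: (integrable_preserved (measurable_line_shift c) (@lebesgue_measure_shift _ c)).
Qed.

Lemma integrable_line_opp (f : R -> R) :
  lam.-integrable setT (EFin \o f) -> lam.-integrable setT (EFin \o (fun x => f (- x))).
Proof.
exact: (integrable_preserved measurable_line_opp (@lebesgue_measure_opp _)).
Qed.

Definition wker (k : R -> R) := [/\ measurable_fun setT k, forall s, 0 <= k s &
  lam.-integrable setT (EFin \o k)].

Lemma wker_opp k : wker k -> wker (fun s => k (- s)).
Proof.
move=> [mk k0 ik]; split=> //; last exact: integrable_line_opp.
exact: measurableT_comp mk measurable_line_opp.
Qed.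

Lemma wker_shift c k : wker k -> wker (fun s => k (s + c)).
Proof.
move=> [mk k0 ik]; split=> //; last exact: integrable_line_shift.
exact: measurableT_comp mk (measurable_line_shift c).
Qed.

Lemma wkerZ c k : 0 <= c -> wker k -> wker (fun s => c * k s).
Proof.
move=> c0 [mk k0 ik]; split.
- exact: measurable_funM.
- by move=> s; rewrite mulr_ge0.
- have := integrableZl measurableT c ik.
  by congr (_.-integrable _ _).
Qed.

Lemma wkerD k k' : wker k -> wker k' -> wker (fun s => k s + k' s).
Proof.
move=> [mk k0 ik] [mk' k0' ik']; split.
- exact: measurable_funD.
- by move=> s; rewrite addr_ge0.
- by have := integrableD measurableT ik ik'; congr (_.-integrable _ _).
Qed.

Lemma wker_le (k k' : R -> R) : measurable_fun setT k -> (forall s, 0 <= k s <= k' s) ->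
  wker k' -> wker k.
Proof.
move=> mk kk' [mk' k0' ik']; split=> //; first by move=> s; have /andP[] := kk' s.
apply: (le_integrable measurableT _ _ ik') => //; first exact/measurable_EFinP.
by move=> s _ /=; have /andP[h1 h2] := kk' s; rewrite lee_fin !ger0_norm.
Qed.

Lemma wker_pdf a : 0 < a -> wker (exponential_pdf a).
Proof.
move=> a0; split; first exact: measurable_exponential_pdf.
- by move=> s; rewrite exponential_pdf_ge0// ltW.
- exact: integrable_exponential_pdf.
Qed.

Lemma pdfE (a s : R) : exponential_pdf a s = if 0 <= s then a * expR (- a * s) else 0.
Proof.
case: ifPn => [s0|]; last by rewrite -ltNge => /lt0_exponential_pdf ->.
by rewrite exponential_pdfE.
Qed.

Lemma Rintegral_pdf (a : R) : 0 < a -> Rintegral lam setT (exponential_pdf a) = 1.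
Proof. by move=> a0; rewrite /Rintegral integral_exponential_pdf. Qed.

Lemma measurable_exp_abs (a : R) : measurable_fun setT (fun s : R => expR (- a * `|s|)).
Proof.
apply: measurableT_comp => //; apply: measurable_funM => //.
Qed.

Lemma wker_exp_abs a : 0 < a -> wker (fun s => expR (- a * `|s|)).
Proof.
move=> a0; have h := wker_pdf a0.
have a1 : 0 <= a^-1 by rewrite invr_ge0 ltW.
apply: (wker_le (measurable_exp_abs a) _ (wkerZ a1 (wkerD h (wker_opp h)))) => s.
rewrite expR_ge0/= !pdfE oppr_ge0.
case: (ltgtP 0 s) => s0.
- by rewrite (gtr0_norm s0) addr0 mulKf ?gt_eqF.
- by rewrite (ltr0_norm s0) add0r mulKf ?gt_eqF.
- by rewrite -s0 normr0 oppr0 !mulr0 expR0 mulr1 mulrDr mulVf ?gt_eqF// lerDl.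
Qed.

Lemma ae_neq0 : {ae lam, forall x : R, x != 0}.
Proof.
exists [set 0]; split=> //; first exact: lebesgue_measure_set1.
by move=> x /=; apply: contra_notP => x0; apply/eqP.
Qed.

Lemma integrable_tensor (k k' : R -> R) : wker k -> wker k' ->
  (product_measure1 lam lam).-integrable setT (EFin \o (fun p => k p.1 * k' p.2)).
Proof.
move=> [mk k0 ik] [mk' k0' ik'].
have mkk : measurable_fun [set: line * line] (fun p => k p.1 * k' p.2).
  by apply: measurable_funM; [exact: measurableT_comp mk measurable_fst|
    exact: measurableT_comp mk' measurable_snd].
apply/integrable12ltyP; first exact/measurable_EFinP.
under eq_integral => x _.
  under eq_integral do rewrite gee0_abs ?lee_fin ?mulr_ge0//= EFinM.
  rewrite ge0_integralZl_EFin//; [over|by move=> y _; rewrite lee_fin|exact/measurable_EFinP].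
rewrite /= ge0_integralZr//; [|exact/measurable_EFinP|by move=> x _; rewrite lee_fin|].
- apply: lte_mul_pinfty.
  + by apply: integral_ge0 => x _; rewrite lee_fin.
  + exact: integrable_fin_num ik.
  + by have /integrableP[_] := ik'; under eq_integral do rewrite gee0_abs ?lee_fin//.
- by apply: integral_ge0 => x _; rewrite lee_fin.
Qed.

(** Composition of two averages along a line is the average against the convolution; [r] will be a
    correlation restricted to that line. The value of the convolution at the single point 0 is left
    free, which later avoids an interval of length zero. *)
Lemma Rintegral_convolution (k k' kk r : R -> R) (C : R) :
  wker k -> wker k' -> wker kk -> measurable_fun setT r -> (forall x, `|r x| <= C) ->
  (forall w, w != 0 -> Rintegral lam setT (fun s => k (w - s) * k' s) = kk w) ->
  Rintegral lam setT (fun s => k s * Rintegral lam setT (fun t => k' t * r (t + s))) =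
  Rintegral lam setT (fun w => kk w * r w).
Proof.
move=> wk wk' wkk mr rC kkE.
have [mk k0 ik] := wk; have [mk' k0' ik'] := wk'; have [mkk _ ikk] := wkk.
have mr1 : measurable_fun [set: line * line] (fun p => r (p.2 + p.1)).
  apply: measurableT_comp mr _; apply: measurable_funD.
    exact: measurable_snd.
  exact: measurable_fst.
have i1 : (product_measure1 lam lam).-integrable setT
    (EFin \o (fun p : line * line => k p.1 * k' p.2 * r (p.2 + p.1))).
  exact: (integrable_mul_bounded (integrable_tensor wk wk') mr1).
have kr c : lam.-integrable setT (EFin \o (fun t => k' t * r (t + c))).
  apply: (@integrable_mul_bounded _ _ _ lam k' (fun t => r (t + c)) C) => //.
  exact: measurableT_comp mr (measurable_line_shift c).
transitivity (Rintegral lam setT (fun s => Rintegral lam setT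
    (fun t => k s * k' t * r (t + s)))).
  apply: eq_Rintegral => s _; rewrite -RintegralZl//.
  by apply: eq_Rintegral => t _; rewrite mulrA.
rewrite (Rintegral12_prod i1) -(Rintegral21_prod i1) /=.
transitivity (Rintegral lam setT (fun t => Rintegral lam setT
    (fun w => k (w - t) * k' t * r w))).
  apply: eq_Rintegral => t _.
  rewrite -(Rintegral_line_shift (- t) (f := fun w => k w * k' t * r (t + w))).
    by apply: eq_Rintegral => w _; rewrite [t + _]addrC subrK.
  apply: measurable_funM; first exact: measurable_funM.
  apply: measurableT_comp mr _; exact: measurable_funD.
have mk2 : measurable_fun [set: line * line] (fun p => k (p.2 - p.1)).
  apply: measurableT_comp mk _; apply: measurable_funB.
    exact: measurable_snd.
  exact: measurable_fst.
have i2 : (product_measure1 lam lam).-integrable setT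
    (EFin \o (fun p : line * line => k (p.2 - p.1) * k' p.1 * r p.2)).
  have mkk2 : measurable_fun [set: line * line] (fun p => k (p.2 - p.1) * k' p.1).
    apply: measurable_funM => //; exact: measurableT_comp mk' measurable_fst.
  apply: (integrable_mul_bounded (C := C)) => //; last first.
    exact: measurableT_comp mr measurable_snd.
  apply/integrable12ltyP; first exact/measurable_EFinP.
  under eq_integral => t _.
    under eq_integral do rewrite gee0_abs ?lee_fin ?mulr_ge0//= mulrC EFinM.
    rewrite ge0_integralZl_EFin//; last 2 first.
    - by move=> y _; rewrite lee_fin.
    - apply/measurable_EFinP; exact: measurableT_comp mk (measurable_line_shift (- t)).
    rewrite (ge0_integral_preserved (measurable_line_shift (- t))
      (@lebesgue_measure_shift _ (- t)) (f := fun w => (k w)%:E)); first over.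
    - exact/measurable_EFinP.
    - by move=> y; rewrite lee_fin.
  rewrite /= ge0_integralZr//; [|exact/measurable_EFinP|by move=> x _; rewrite lee_fin|].
  - apply: lte_mul_pinfty.
    + by apply: integral_ge0 => x _; rewrite lee_fin.
    + exact: integrable_fin_num ik'.
    + by have /integrableP[_] := ik; under eq_integral do rewrite gee0_abs ?lee_fin//.
  - by apply: integral_ge0 => x _; rewrite lee_fin.
rewrite (Rintegral12_prod i2) -(Rintegral21_prod i2) /=.
apply: Rintegral_ae_eq.
- have := measurable_fubini_G i2 => mG.
  exact: measurableT_comp mG.
- exact: measurable_funM.
have := ae_integrable2 i2; have := ae_neq0; apply: (@filterS2 _ _ (ae_filter_ringOfSetsType lam)) => w w0 iw.
have [rw0|rw0] := eqVneq (r w) 0.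
  rewrite rw0 mulr0 (_ : (fun t => _) = cst 0) ?/Rintegral ?integral0//.
  by apply/funext => t /=; rewrite mulr0.
rewrite -kkE// -RintegralZr//.
have := integrableZr measurableT (r w)^-1 iw.
by congr (_.-integrable _ _); apply/funext => t; rewrite /= -EFinM mulfK.
Qed.

End one_dimensional_kernels.

Section exponential_kernels.
Variables (R : realType) (alpha : R).
Hypothesis alpha0 : 0 < alpha.
Local Notation lam := (@lebesgue_measure R).
Local Notation p := (exponential_pdf alpha).

Definition lker (s : R) : R := alpha / 2 * expR (- alpha * `|s|).

(** The convolution square of [lker], hence the kernel of the squared average. Unlike [lker] it is
    C^2 at the origin. At a small rate it reappears as the slow modulation of plane waves. *)
Definition kappa (s : R) : R := alpha / 4 * (1 + alpha * `|s|) * expR (- alpha * `|s|).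

Lemma wker_lker : wker lker.
Proof. by apply: wkerZ; [rewrite divr_ge0// ltW|exact: wker_exp_abs]. Qed.

(** Half of the decay rate pays for the linear factor: [1 + a|s| <= 2 (1 + a|s|/2)] and
    [1 + y <= exp y]. *)
Lemma exp_abs_lin_le (a s : R) : 0 < a ->
  (1 + a * `|s|) * expR (- a * `|s|) <= 2 * expR (- (a / 2) * `|s|).
Proof.
move=> a0; have -> : - a * `|s| = - (a / 2) * `|s| + - (a / 2) * `|s| by field.
rewrite expRD mulrA ler_wpM2r ?expR_ge0//.
have h := expR_ge1Dx (a / 2 * `|s|).
rewrite mulNr expRN -ler_pdivlMr ?invr_gt0 ?expR_gt0// invrK.
apply: le_trans (_ : 2 * (1 + a / 2 * `|s|) <= _); last by rewrite ler_wpM2l.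
by have := normr_ge0 s; lra.
Qed.

Lemma wker_kappa : wker kappa.
Proof.
have a2 : 0 < alpha / 2 by rewrite divr_gt0.
apply: (wker_le _ _ (wkerZ _ (wker_exp_abs a2)) (k' := fun s => alpha / 2 * expR (- (alpha / 2) * `|s|))).
- apply: measurable_funM; last exact: measurable_exp_abs.
  apply: measurable_funM => //; apply: measurable_funD => //.
  exact: measurable_funM.
- move=> s; rewrite /kappa; have := exp_abs_lin_le s alpha0; have := normr_ge0 s.
  have := expR_ge0 (- alpha * `|s|); move: (expR (- alpha * `|s|)) (expR _) => e1 e2 h0 h1 h2.
  apply/andP; split.
    by rewrite !mulr_ge0 ?addr_ge0 ?mulr_ge0 ?invr_ge0 ?(ltW alpha0).
  by rewrite -mulrA; nra.
- exact: ltW.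
Qed.

(** The factorization [U = P^* P]: the average against the one-sided density is the inverse of
    [1 - alpha^-1 d/dx], and its adjoint that of [1 + alpha^-1 d/dx]. The integrand lives on
    [s >= c = max 0 w], where it is [lker w] times a shifted density of rate [2 alpha]. *)
Lemma convolution_pdf (w : R) :
  Rintegral lam setT (fun s => p (- (w - s)) * p s) = lker w.
Proof.
have a2 : 0 < 2 * alpha by rewrite mulr_gt0.
have [mq _ iq] := wker_pdf a2.
pose c := if 0 <= w then w else 0.
transitivity (Rintegral lam setT (fun s => lker w * exponential_pdf (2 * alpha) (s - c))).
  apply: eq_Rintegral => s _; rewrite opprB !pdfE /lker /c !subr_ge0.
  have [w0|w0] := leP 0 w.
    rewrite (ger0_norm w0); have [sw|sw] := leP w s; last by rewrite mul0r mulr0.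
    rewrite (le_trans w0 sw).
    have -> : - alpha * w = - alpha * (s - w) + - alpha * s - (- (2 * alpha) * (s - w)) by ring.
    rewrite 2!expRD expRN; have := expR_gt0 (- (2 * alpha) * (s - w)) => e0.
    by field; rewrite gt_eqF.
  rewrite (ltr0_norm w0) subr0.
  have [s0|s0] := leP 0 s; last by rewrite !mulr0.
  rewrite (le_trans (ltW w0) s0).
  have -> : - (2 * alpha) * s = - alpha * s + - alpha * s by ring.
  have -> : - alpha * (s - w) = - alpha * s + - alpha * - w by ring.
  by rewrite !expRD; field.
have [_ _ iqc] := wker_shift (- c) (wker_pdf a2).
by rewrite RintegralZl// Rintegral_line_shift// Rintegral_pdf// mulr1.
Qed.

Lemma convolution_lker (w : R) : w != 0 ->
  Rintegral lam setT (fun s => lker (w - s) * lker s) = kappa w.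
Proof.
have pos v : 0 < v -> Rintegral lam setT (fun s => lker (v - s) * lker s) = kappa v.
  move=> v0.
  have a2 : 0 < 2 * alpha by rewrite mulr_gt0.
  pose q := exponential_pdf (2 * alpha).
  have wq : wker q := wker_pdf a2.
  have [mq _ iq] := wq.
  pose E := expR (- alpha * v).
  pose J := `]0, v[%classic : set R.
  have iJ : lam.-integrable setT (EFin \o (\1_J : R -> R)).
    by apply: integrable_indic_itv.
  have [_ _ i1] := wker_opp wq; have [_ _ i2] := wker_shift (- v) wq.
  (* Outside []0, v[] the product is a multiple of a density of rate [2 alpha] on each side, of mass
     one; between 0 and [v] it is constant, which produces the linear factor of [kappa]. *)
  transitivity (Rintegral lam setT (fun s =>
      alpha / 8 * E * (q (- s) + q (s - v)) + alpha ^+ 2 / 4 * E * \1_J s)).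
    apply: eq_Rintegral => s _; rewrite /q !pdfE /lker oppr_ge0 subr_ge0 indicE.
    have a0 : alpha != 0 by rewrite gt_eqF.
    have [s0|s0] := leP s 0.
      rewrite memNset ?mulr0 ?addr0; last by rewrite /J/= in_itv/= ltNge s0.
      rewrite leNgt (le_lt_trans s0 v0)/= addr0.
      rewrite (ler0_norm s0) ger0_norm; last by lra.
      rewrite /E.
      have -> : - (2 * alpha) * - s = - alpha * (v - s) + - alpha * - s - (- alpha * v) by ring.
      rewrite 2!expRD expRN; have := expR_gt0 (- alpha * v) => e0.
      by field; rewrite gt_eqF.
    have [vs|sv] := leP v s.
      rewrite memNset ?mulr0 ?addr0; last by rewrite /J/= in_itv/= s0 ltNge vs.
      rewrite add0r ler0_norm; last by lra.
      rewrite (gtr0_norm s0) /E.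
      have -> : - (2 * alpha) * (s - v) = - alpha * - (v - s) + - alpha * s - (- alpha * v) by ring.
      rewrite 2!expRD expRN; have := expR_gt0 (- alpha * v) => e0.
      by field; rewrite gt_eqF.
    rewrite mem_set; last by rewrite /J/= in_itv/= s0 sv.
    rewrite ger0_norm; last by lra.
    rewrite (gtr0_norm s0) /E.
    have -> : - alpha * v = - alpha * (v - s) + - alpha * s by ring.
    by rewrite expRD /=; field.
  have i12 : lam.-integrable setT (EFin \o (fun s => q (- s) + q (s - v))).
    by have := integrableD measurableT i1 i2; congr (_.-integrable _ _).
  rewrite RintegralD//; last 2 first.
  - by have := integrableZl measurableT (alpha / 8 * E) i12; congr (_.-integrable _ _).
  - by have := integrableZl measurableT (alpha ^+ 2 / 4 * E) iJ; congr (_.-integrable _ _).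
  rewrite !RintegralZl// RintegralD// Rintegral_line_opp// Rintegral_line_shift//.
  rewrite Rintegral_pdf//.
  have -> : Rintegral lam setT (\1_J : R -> R) = v.
    have mJ : measurable (J : set (measurableTypeR R)) by exact: measurable_itv.
    transitivity (fine (lam J)); last by rewrite lebesgue_measure_itv/= lte_fin v0 -EFinB/= subr0.
    rewrite /Rintegral integral_indic//; congr (fine (lam _)).
    by apply/seteqP; split => // x [].
  by rewrite /kappa (gtr0_norm v0) /E; field.
move=> w0; have [lt0|gt0|] := ltgtP 0 w; [exact: pos| |by move=> /esym/eqP; rewrite (negPf w0)].
have lN s : lker (- s) = lker s by rewrite /lker normrN.
have <- : kappa (- w) = kappa w by rewrite /kappa normrN.
rewrite -pos ?oppr_gt0// -Rintegral_line_opp.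
  by apply: eq_Rintegral => s _; rewrite -(lN (- w - s)) opprD !opprK lN.
have [ml _ _] := wker_lker.
apply: measurable_funM => //; apply: measurableT_comp ml _; exact: measurable_funB.
Qed.

End exponential_kernels.

(** * Averages over rays and over the plane *)

Section plane_operators.
Variable R : realType.
Local Notation lam := (@lebesgue_measure R).
Local Notation line := (measurableTypeR R).
Local Notation plane := (line * line)%type.

Definition padd (z w : plane) : plane := (z : R * R) + (w : R * R).

Lemma measurable_padd (d : measure_display) (T : measurableType d) (f g : T -> plane) :
  measurable_fun setT f -> measurable_fun setT g ->
  measurable_fun setT (fun x => padd (f x) (g x)).
Proof. exact: measurable_plane_add. Qed.

Lemma paddA (x y z : plane) : padd x (padd y z) = padd (padd x y) z.
Proof. exact: (@addrA (R * R)%type). Qed.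

Lemma paddAC (x y z : plane) : padd (padd x y) z = padd (padd x z) y.
Proof. exact: (@addrAC (R * R)%type). Qed.

Lemma paddNK (x y : plane) : padd (padd x y) (- (y : R * R)) = x.
Proof. exact: (@addrK (R * R)%type). Qed.

(** The measure [leb2] under a name of its own, to which the sigma-finite structure required by
    Fubini is attached. *)
Definition pmu : set plane -> \bar R := product_measure1 lam lam.
HB.instance Definition _ := Measure.on pmu.

Lemma pmu_sigma_finite : sigma_finite setT pmu.
Proof.
have /sigma_finiteP[F [TF ndF Foo]] := sigma_finiteT lam.
exists (fun n => F n `*` F n).
  rewrite -setXTT TF predeqE => -[x y]; split.
    move=> [/= [n _ Fnx] [k _ Fky]]; exists (maxn n k) => //; split.
    - by move: x Fnx; exact/subsetPset/ndF/leq_maxl.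
    - by move: y Fky; exact/subsetPset/ndF/leq_maxr.
  by move=> [n _ []/= ? ?]; split; exists n.
move=> k; have [? ?] := Foo k.
split; first exact: measurableX.
by rewrite /pmu product_measure1E// lte_mul_pinfty// ge0_fin_numE.
Qed.
HB.instance Definition _ := Measure_isSigmaFinite.Build _ _ _ pmu pmu_sigma_finite.

Local Notation H := (L2fun pmu).

Lemma pmu_invariant (w : plane) (A : set plane) : measurable A ->
  pmu ((fun z => padd z w) @^-1` A) = pmu A.
Proof. exact: leb2_shift. Qed.

Definition pcorr : H -> H -> plane -> R := corr (@measurable_padd) pmu_invariant.

Lemma pcorr_le f g w : `|pcorr f g w| <= ip f f + ip g g.
Proof. exact: corr_le. Qed.

Lemma measurable_pcorr f g : measurable_fun setT (pcorr f g).
Proof. exact: measurable_corr. Qed.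

Lemma pcorrN f g (w : R * R) : pcorr f g (- w) = pcorr g f w.
Proof. exact: (corrN (popp := fun y : plane => - (y : R * R)) paddNK). Qed.

Definition pavg (d : measure_display) (Om : measurableType d)
    (m : {sigma_finite_measure set Om -> \bar R}) (K : avg_kernel plane m) : H -> H :=
  avg (@measurable_padd) pmu_invariant K.

Lemma pavgE (d : measure_display) (Om : measurableType d)
    (m : {sigma_finite_measure set Om -> \bar R}) (K : avg_kernel plane m) (f : H) z :
  pavg K f z = Rintegral m setT (fun s => wt K s * f ((z : R * R) + (dir K s : R * R))).
Proof. by []. Qed.

Lemma ip_pavg (d : measure_display) (Om : measurableType d)
    (m : {sigma_finite_measure set Om -> \bar R}) (K : avg_kernel plane m) f g :
  ip (pavg K f) g = Rintegral m setT (fun s => wt K s * pcorr f g (dir K s)).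
Proof. exact: ip_avg. Qed.

Lemma pcorr_pavg (d : measure_display) (Om : measurableType d)
    (m : {sigma_finite_measure set Om -> \bar R}) (K : avg_kernel plane m) f g (w : R * R) :
  pcorr (pavg K f) g w =
  Rintegral m setT (fun s => wt K s * pcorr f g ((dir K s : R * R) + w)).
Proof. exact: (corr_avg paddA paddAC). Qed.

Lemma measurable_ray (e : R * R) :
  measurable_fun (T := line) (U := plane) setT (fun s : R => (s * e.1, s * e.2)).
Proof.
have h : measurable_fun [set: R] (fun s : R => (s * e.1, s * e.2)).
  by apply: measurable_fun_pair; exact: measurable_funM.
exact: h.
Qed.

Definition ray_kernel (e : R * R) (k : R -> R) (wk : wker k) : avg_kernel plane lam :=
  let: And3 mk k0 ik := wk in 
  @AvgKernel R _ plane _ line lam k (fun s : R => (s * e.1, s * e.2)) mk k0 ik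
    (measurable_ray e).

Definition rayop e k (wk : wker k) : H -> H := pavg (ray_kernel e wk).

Lemma ip_rayop e k (wk : wker k) f g :
  ip (rayop e wk f) g =
  Rintegral lam setT (fun s => k s * pcorr f g (s * e.1, s * e.2)).
Proof. by rewrite ip_pavg; case: wk. Qed.

Lemma pcorr_rayop e k (wk : wker k) f g (w : R * R) :
  pcorr (rayop e wk f) g w =
  Rintegral lam setT (fun s => k s * pcorr f g (s * e.1 + w.1, s * e.2 + w.2)).
Proof. by rewrite pcorr_pavg; case: wk. Qed.

Lemma measurable_pcorr_ray f g e (c : R * R) :
  measurable_fun setT (fun s : R => pcorr f g (s * e.1 + c.1, s * e.2 + c.2)).
Proof.
have h : measurable_fun [set: R] (fun s : R => (s * e.1 + c.1, s * e.2 + c.2)).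
  by apply: measurable_fun_pair; apply: measurable_funD => //; exact: measurable_funM.
exact: (measurableT_comp (measurable_pcorr f g) h).
Qed.

Lemma rayop_adj e k (wk : wker k) f g :
  ip (rayop e wk f) g = ip f (rayop e (wker_opp wk) g).
Proof.
have [mk _ _] := wk.
rewrite (ipC f) !ip_rayop -Rintegral_line_opp.
  apply: eq_Rintegral => s _; congr (_ * _).
  by rewrite !mulNr; exact: (pcorrN f g (s * e.1, s * e.2)).
apply: measurable_funM => //; have := measurable_pcorr_ray f g e 0.
by under eq_fun do rewrite !addr0.
Qed.

Lemma rayop_comp e k k' kk (wk : wker k) (wk' : wker k') (wkk : wker kk) f g :
  (forall w, w != 0 -> Rintegral lam setT (fun s => k (w - s) * k' s) = kk w) ->
  ip (rayop e wk (rayop e wk' f)) g = ip (rayop e wkk f) g.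
Proof.
move=> kkE; rewrite !ip_rayop.
under eq_Rintegral do rewrite pcorr_rayop.
rewrite -(Rintegral_convolution wk wk' wkk _ _ kkE (C := ip f f + ip g g)
   (r := fun w => pcorr f g (w * e.1, w * e.2))).
- apply: eq_Rintegral => s _; congr (_ * _); apply: eq_Rintegral => t _ /=.
  by rewrite !mulrDl.
- by have := measurable_pcorr_ray f g e 0; under eq_fun do rewrite !addr0.
- by move=> x; exact: pcorr_le.
Qed.

Let integrable_pcorr2 e e' k k' (wk : wker k) (wk' : wker k') f g :
  pmu.-integrable setT (EFin \o (fun p : plane =>
    k p.1 * k' p.2 * pcorr f g (p.2 * e'.1 + p.1 * e.1, p.2 * e'.2 + p.1 * e.2))).
Proof.
apply: (integrable_mul_bounded (integrable_tensor wk wk') (C := ip f f + ip g g)); last first.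
  by move=> p; exact: pcorr_le.
have h : measurable_fun [set: plane]
    (fun p : plane => (p.2 * e'.1 + p.1 * e.1, p.2 * e'.2 + p.1 * e.2) : plane).
  by apply: measurable_fun_pair; apply: measurable_funD; apply: measurable_funM => //;
    first [exact: measurable_fst|exact: measurable_snd].
exact: (measurableT_comp (measurable_pcorr f g) h).
Qed.

Let integrable_pcorr1 e k (wk : wker k) f g (c : R * R) :
  lam.-integrable setT (EFin \o (fun s =>
    k s * pcorr f g (s * e.1 + c.1, s * e.2 + c.2))).
Proof.
have [_ _ ik] := wk.
apply: (integrable_mul_bounded ik (measurable_pcorr_ray f g e c)) => s.
exact: pcorr_le.
Qed.

Lemma ip_rayop2 e e' k k' (wk : wker k) (wk' : wker k') f g :
  ip (rayop e wk (rayop e' wk' f)) g = Rintegral pmu setT (fun p : plane =>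
    k p.1 * k' p.2 * pcorr f g (p.2 * e'.1 + p.1 * e.1, p.2 * e'.2 + p.1 * e.2)).
Proof.
rewrite -(Rintegral12_prod (integrable_pcorr2 e e' wk wk' f g)) ip_rayop.
apply: eq_Rintegral => s _; rewrite pcorr_rayop -RintegralZl//=.
  by apply: eq_Rintegral => t _; rewrite mulrA.
exact: (integrable_pcorr1 e' wk' f g (s * e.1, s * e.2)).
Qed.

Lemma rayop_comm e e' k k' (wk : wker k) (wk' : wker k') f g :
  ip (rayop e wk (rayop e' wk' f)) g = ip (rayop e' wk' (rayop e wk f)) g.
Proof.
rewrite ip_rayop2 -(Rintegral21_prod (integrable_pcorr2 e e' wk wk' f g)) ip_rayop.
apply: eq_Rintegral => s _; rewrite pcorr_rayop -RintegralZl//=.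
  by apply: eq_Rintegral => t _; rewrite mulrA [k' s * _]mulrC !(addrC (s * _)).
exact: (integrable_pcorr1 e wk f g (s * e'.1, s * e'.2)).
Qed.

Lemma measurable_tensor (k k' : R -> R) : measurable_fun setT k -> measurable_fun setT k' ->
  measurable_fun [set: plane] (fun p : plane => k p.1 * k' p.2).
Proof.
move=> mk mk'; apply: measurable_funM.
- exact: measurableT_comp mk measurable_fst.
- exact: measurableT_comp mk' measurable_snd.
Qed.

Definition tensor_kernel k k' (wk : wker k) (wk' : wker k') : avg_kernel plane pmu :=
  let: And3 mk k0 ik := wk in let: And3 mk' k0' ik' := wk' in
  @AvgKernel _ _ plane _ plane pmu (fun p : plane => k p.1 * k' p.2) (fun p => p)
    (measurable_tensor mk mk') (fun p => mulr_ge0 (k0 p.1) (k0' p.2))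
    (integrable_tensor wk wk') (@measurable_id _ _ setT).

Definition tensorop k k' (wk : wker k) (wk' : wker k') : H -> H :=
  pavg (tensor_kernel wk wk').

Lemma tensoropE k k' (wk : wker k) (wk' : wker k') (f : H) (z : R * R) :
  tensorop wk wk' f z =
  Rintegral pmu setT (fun p : plane => k p.1 * k' p.2 * f (z + (p : R * R))).
Proof. by rewrite pavgE; case: wk; case: wk'. Qed.

(** Convolution with [phi] is one integral over the plane; Fubini turns it into a product of
    averages along the two axes. *)
Lemma ip_tensorop k k' (wk : wker k) (wk' : wker k') f g :
  ip (tensorop wk wk' f) g = ip (rayop (1, 0) wk (rayop (0, 1) wk' f)) g.
Proof.
rewrite ip_rayop2 ip_pavg.
have -> : wt (tensor_kernel wk wk') = (fun p : plane => k p.1 * k' p.2).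
  by case: wk; case: wk'.
have -> : dir (tensor_kernel wk wk') = (fun p => p) by case: wk; case: wk'.
apply: eq_Rintegral => -[x y] _ /=.
by rewrite !mulr0 !mulr1 addr0 add0r.
Qed.

End plane_operators.

(** * Functions with vanishing integrals over quadrants *)

Section quadrants.
Variable R : realType.
Local Notation lam := (@lebesgue_measure R).
Local Notation line := (measurableTypeR R).
Local Notation plane := (line * line)%type.
Local Notation pmu := (@pmu R).

Definition quadrant (z : R * R) : set plane := `[z.1, +oo[%classic `*` `[z.2, +oo[%classic.

Lemma quadrantP z (w : R * R) : quadrant z w <-> (z.1 <= w.1) /\ (z.2 <= w.2).
Proof. by rewrite /quadrant /= !in_itv/= !andbT. Qed.

Lemma measurable_quadrant z : measurable (quadrant z).
Proof. by apply: measurableX; exact: measurable_itv. Qed.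

Lemma quadrantI z w : quadrant z `&` quadrant w =
  quadrant (Num.max z.1 w.1, Num.max z.2 w.2).
Proof.
apply/seteqP; split => v.
  by move=> [/quadrantP[h1 h2] /quadrantP[h3 h4]]; apply/quadrantP; rewrite /= !ge_max h1 h2 h3 h4.
by move=> /quadrantP[]; rewrite /= !ge_max => /andP[h1 h2] /andP[h3 h4]; split; apply/quadrantP.
Qed.

Definition quadrants : set (set plane) := [set quadrant z | z in [set: R * R]].

(** Preimages of half-lines under the coordinates are countable unions of quadrants, so the
    coordinates, and with them the identity map, are measurable for the sigma-algebra generated by
    quadrants. *)
Lemma measurable_plane_quadrants (A : set plane) : measurable A -> <<s quadrants >> A.
Proof.
pose T' := g_sigma_algebraType quadrants.
have q z : measurable (quadrant z : set T') by apply: sub_sigma_algebra; exists z.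
have cover (x y : R) : exists n : nat, - n%:R <= x /\ - n%:R <= y.
  exists (Num.truncn (`|x| + `|y|)).+1.
  have h := ltW (truncnS_gt (`|x| + `|y|)).
  have hx := ler_norm (- x); have hy := ler_norm (- y).
  move: hx hy; rewrite !normrN; have := normr_ge0 x; have := normr_ge0 y.
  by split; lra.
have mfst : measurable_fun [set: T'] (fst : T' -> R).
  apply: (@measurability _ _ _ _ _ _ _ (RGenCInfty.measurableE R)) => _ [_ [x ->] <-]; rewrite setTI.
  rewrite (_ : _ @^-1` _ = \bigcup_n quadrant (x, - n%:R)); first exact: bigcupT_measurable.
  apply/seteqP; split => -[u v] /=.
    rewrite in_itv/= andbT => xu; have [n [_ nv]] := cover u v.
    by exists n => //; apply/quadrantP.
  by move=> [n _ /quadrantP[/= h _]]; rewrite in_itv/= h.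
have msnd : measurable_fun [set: T'] (snd : T' -> R).
  apply: (@measurability _ _ _ _ _ _ _ (RGenCInfty.measurableE R)) => _ [_ [x ->] <-]; rewrite setTI.
  rewrite (_ : _ @^-1` _ = \bigcup_n quadrant (- n%:R, x)); first exact: bigcupT_measurable.
  apply/seteqP; split => -[u v] /=.
    rewrite in_itv/= andbT => xu; have [n [nv _]] := cover u v.
    by exists n => //; apply/quadrantP.
  by move=> [n _ /quadrantP[/= _ h]]; rewrite in_itv/= h.
have mid : measurable_fun [set: T'] (fun p : T' => (p.1, p.2) : plane).
  by apply: measurable_fun_pair; [exact: mfst|exact: msnd].
move=> mA; have := mid measurableT A mA; rewrite setTI.
by rewrite (_ : _ @^-1` A = A)//; apply/seteqP; split => -[].
Qed.

Lemma setI_closed_quadrants : setI_closed quadrants.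
Proof. by move=> _ _ [z _ <-] [w _ <-]; rewrite quadrantI; eexists. Qed.

(** The sets of zero integral form a Dynkin class, and quadrants are stable under intersection. The
    whole plane is not a quadrant, whence the separate hypothesis on it. *)
Lemma integral_quadrants_eq0 (F : plane -> R) : pmu.-integrable setT (EFin \o F) ->
  (forall z, \int[pmu]_(w in quadrant z) (F w)%:E = 0)%E ->
  (\int[pmu]_w (F w)%:E = 0)%E ->
  forall A, measurable A -> (\int[pmu]_(w in A) (F w)%:E = 0)%E.
Proof.
move=> iF F0 FT A mA.
pose D : set (set plane) := [set B | measurable B /\ (\int[pmu]_(w in B) (F w)%:E = 0)%E].
have iB (B : set plane) : measurable B -> pmu.-integrable B (EFin \o F).
  by move=> mB; apply: integrableS iF.
have dD : dynkin D.
  split.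
  - by split.
  - move=> B [mB B0]; split; first exact: measurableC.
    have : (\int[pmu]_(w in B `|` ~` B) (F w)%:E = 0)%E by rewrite setUv.
    rewrite integral_setU_EFin//; last 3 first.
    + exact: measurableC.
    + by rewrite setUv; have /integrableP[/measurable_EFinP] := iF.
    + exact/disj_setPCl.
    by rewrite B0 add0e.
  - move=> B tB DB; have mB n : measurable (B n) by have [] := DB n.
    split; first exact: bigcupT_measurable.
    rewrite (integral_bigcup tB mB); last exact/iB/bigcupT_measurable.
    by apply: eseries0 => n _ _; have [] := DB n.
have : <<d quadrants >> A.
  rewrite (setI_closed_g_dynkin_g_sigma_algebra setI_closed_quadrants).
  exact: measurable_plane_quadrants.
move=> /(_ D); rewrite /smallest/=; case=> //; split=> //.
by move=> _ [z _ <-]; split; [exact: measurable_quadrant|exact: F0].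
Qed.

(** [F] is integrable on quadrants but possibly not on the plane, since it will contain growing
    exponentials. Its restrictions to the quadrants [q n], which exhaust the plane, are integrable,
    and their integrals over quadrants are integrals of [F] over intersections of quadrants. *)
Lemma quadrant_integrals_ae0 (F : plane -> R) :
  measurable_fun setT F ->
  (forall z, pmu.-integrable (quadrant z) (EFin \o F)) ->
  (forall z, \int[pmu]_(w in quadrant z) (F w)%:E = 0)%E ->
  {ae pmu, forall w, F w = 0}.
Proof.
move=> mF iF F0.
pose q n := quadrant (- n%:R, - n%:R).
have mq n : measurable (q n) by exact: measurable_quadrant.
have aen n : {ae pmu, forall w, q n w -> F w = 0}.
  have iq : pmu.-integrable setT (EFin \o (F \_ (q n))).
    by rewrite -restrict_EFin -integrable_mkcond//; exact: iF.
  have IB (B : set plane) : (\int[pmu]_(w in B) ((F \_ (q n)) w)%:E =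
      \int[pmu]_(w in B `&` q n) (F w)%:E)%E.
    by rewrite integral_mkcondr; apply: eq_integral => w _; rewrite !patchE; case: ifP.
  have h := integral_quadrants_eq0 iq.
  have {}h : forall A, measurable A -> (\int[pmu]_(w in A) ((F \_ (q n)) w)%:E = 0)%E.
    by apply: h => [z|]; rewrite IB ?setTI ?quadrantI; exact: F0.
  have := @integral_ae_eq _ _ _ pmu setT measurableT (cst 0%E) (EFin \o (F \_ (q n))) iq.
  move=> /(_ (measurable_cst _)) => H.
  have := H (fun B _ mB => eq_trans (h B mB) (esym (integral0 pmu B))).
  apply: (@filterS _ _ (ae_filter_ringOfSetsType pmu)) => w /(_ I) + qw.
  by rewrite /= patchE mem_set// => -[].
have : {ae pmu, forall w, forall n, q n w -> F w = 0} by apply/ae_foralln.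
apply: (@filterS _ _ (ae_filter_ringOfSetsType pmu)) => w h.
apply: (h (Num.truncn (`|w.1| + `|w.2|)).+1).
have := ltW (truncnS_gt (`|w.1| + `|w.2|)).
have hx := ler_norm (- w.1); have hy := ler_norm (- w.2).
move: hx hy; rewrite !normrN; have := normr_ge0 w.1; have := normr_ge0 w.2.
by move=> *; apply/quadrantP => /=; split; lra.
Qed.

End quadrants.

(** * The resolvents of the second derivatives: roots, contraction, injectivity *)

Section resolvent_operators.
Variable R : realType.
Local Notation lam := (@lebesgue_measure R).
Local Notation line := (measurableTypeR R).
Local Notation plane := (line * line)%type.
Local Notation pmu := (@pmu R).
Local Notation H := (L2fun pmu).

Lemma sqint_tensor (k k' : R -> R) : measurable_fun setT k -> measurable_fun setT k' ->
  wker (fun s => k s ^+ 2) -> wker (fun s => k' s ^+ 2) ->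
  sqint pmu (fun p : plane => k p.1 * k' p.2).
Proof.
move=> mk mk' wk wk'; split; first exact: measurable_tensor.
by under eq_fun do rewrite exprMn; exact: (integrable_tensor wk wk').
Qed.

(** The open square of side [e] below and to the left of [z] has positive measure, so it meets every
    set of full measure. *)
Lemma ae_dense_left (P : R * R -> Prop) (z : R * R) (e : R) :
  {ae pmu, forall w, P w} -> 0 < e ->
  exists2 w : R * R, P w & z.1 - e < w.1 < z.1 /\ z.2 - e < w.2 < z.2.
Proof.
move=> [N [mN N0 PN]] e0; apply: contrapT => noP.
pose B : set plane := `]z.1 - e, z.1[%classic `*` `]z.2 - e, z.2[%classic.
have mB : measurable B by apply: measurableX; exact: measurable_itv.
have BN : B `<=` N.
  move=> w [/=]; rewrite !in_itv/= => w1 w2; apply: PN => /= Pw.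
  by apply: noP; exists w.
have : (pmu B <= pmu N)%E by apply: le_measure => //; rewrite inE.
rewrite N0 /pmu product_measure1E; [|exact: measurable_itv|exact: measurable_itv].
rewrite /= !lebesgue_measure_itv/= !lte_fin !ltrBlDr !ltrDl e0 -!EFinB -EFinM lee_fin.
by rewrite leNgt => /negP; apply; rewrite !opprB !(addrC _ (_ - _)) !subrK mulr_gt0.
Qed.

Section with_rate.
Variable alpha : R.
Hypothesis alpha0 : 0 < alpha.
Local Notation pdf := (exponential_pdf alpha).
Local Notation wl := (wker_lker alpha0).
Local Notation wp := (wker_pdf alpha0).

Definition resolv (e : R * R) : H -> H := rayop e wl.
Definition proot (e : R * R) : H -> H := rayop e wp.

Lemma resolv_adj e : selfadj (@ip _ _ _ pmu) (resolv e).
Proof.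
move=> f g; rewrite /resolv rayop_adj ipC (ipC f) !ip_rayop.
by apply: eq_Rintegral => s _; rewrite /lker normrN.
Qed.

Lemma resolv_proot e f g : ip (resolv e f) g = ip (proot e f) (proot e g).
Proof.
rewrite [RHS]ipC /proot rayop_adj [RHS]ipC; apply/esym/rayop_comp => w _.
exact: convolution_pdf.
Qed.

(** The correlation of [f] with itself is even, and the even part of the one-sided density is
    [lker]. In symbols, [1 / (1 - i p/alpha)] has real part equal to its squared modulus. *)
Lemma proot_diag e f : ip (proot e f) f = ip (resolv e f) f.
Proof.
pose r s := pcorr f f (s * e.1, s * e.2).
have rN s : r (- s) = r s.
  by rewrite /r !mulNr; exact: (pcorrN f f (s * e.1, s * e.2)).
have mr : measurable_fun setT r.
  by have := measurable_pcorr_ray f f e 0; under eq_fun do rewrite !addr0.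
have [mp _ ip0] := wp; have [mpN _ ipN] := wker_opp wp; have [ml _ il] := wl.
have rb s : `|r s| <= ip f f + ip f f by exact: pcorr_le.
have ipr := integrable_mul_bounded ip0 mr rb.
have ipNr := integrable_mul_bounded ipN mr rb.
have ilr := integrable_mul_bounded il mr rb.
rewrite /proot /resolv !ip_rayop -/r.
have hN : Rintegral lam setT (fun s => pdf (- s) * r s) = Rintegral lam setT (fun s => pdf s * r s).
  rewrite -[RHS]Rintegral_line_opp; last exact: measurable_funM.
  by apply: eq_Rintegral => s _; rewrite rN.
have hS : Rintegral lam setT (fun s => pdf s * r s) + Rintegral lam setT (fun s => pdf (- s) * r s)
    = 2 * Rintegral lam setT (fun s => lker alpha s * r s).
  rewrite -RintegralZl// -RintegralD//.
  apply: Rintegral_ae_eq.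
  - by apply: measurable_funD; exact: measurable_funM.
  - by apply: measurable_funM => //; exact: measurable_funM.
  apply: (@filterS _ _ (ae_filter_ringOfSetsType lam)) (@ae_neq0 R) => s s0.
  rewrite -mulrDl mulrA; congr (_ * _); rewrite !pdfE /lker oppr_ge0.
  case: (ltgtP 0 s) s0 => // s0 _.
  - by rewrite (gtr0_norm s0); field.
  - by rewrite (ltr0_norm s0); field.
by rewrite hN in hS; lra.
Qed.

(** By [proot_diag] and [U = P^* P], the square [|f - P f|^2] expands to [<f, f> - <U f, f>]. *)
Lemma resolv_le e f : ip (resolv e f) f <= ip f f.
Proof.
have := ip_ge0 (f - proot e f).
rewrite (ip_sub_sqr (@ipC _ _ _ pmu) (@ipDl _ _ _ pmu) (@ipZl _ _ _ pmu)).
by rewrite proot_diag -resolv_proot; lra.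
Qed.

Lemma resolv_comm e e' f g : ip (resolv e (resolv e' f)) g = ip (resolv e' (resolv e f)) g.
Proof. exact: rayop_comm. Qed.

Lemma proot_resolv_comm e e' f g :
  ip (proot e (resolv e' f)) g = ip (resolv e' (proot e f)) g.
Proof. exact: rayop_comm. Qed.

Lemma resolv2_kappa e f g :
  ip (resolv e (resolv e f)) g = ip (rayop e (wker_kappa alpha0) f) g.
Proof.
apply: rayop_comp => w w0; exact: convolution_lker.
Qed.

Lemma wker_sqr_pdf : wker (fun s => pdf s ^+ 2).
Proof.
have [mp p0 _] := wp.
apply: (wker_le _ _ (wkerZ (ltW alpha0) wp)) => [|s]; first exact: measurable_funX.
rewrite sqr_ge0 expr2 ler_wpM2r//= pdfE; case: ifP => s0; last exact: ltW.
rewrite ler_piMr ?(ltW alpha0)// -expR0 ler_expR mulNr oppr_le0.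
by rewrite mulr_ge0// ltW.
Qed.

(** Up to a positive factor, the product of the two one-sided averages at [z] is the integral over
    the quadrant at [z] of [F = exp(-alpha (w_1 + w_2)) f]. So almost all, then all, quadrant
    integrals of [F] vanish, and [F] is null. *)
Lemma quadrant_ae0 (f : H) : {ae pmu, forall z, tensorop wp wp f z = 0} ->
  {ae pmu, forall z, f z = 0}.
Proof.
move=> T0; have [mf _] := L2funP f; have [mp _ _] := wp.
pose F (w : R * R) : R := expR (- alpha * w.1) * expR (- alpha * w.2) * f w.
have me : measurable_fun setT (fun s : R => expR (- alpha * s)).
  by apply: measurableT_comp => //; exact: measurable_funM.
have mF : measurable_fun [set: plane] F.
  apply: measurable_funM => //; exact: (measurable_tensor me me).
pose kz (z w : R * R) : R := pdf (w.1 - z.1) * pdf (w.2 - z.2) * f w.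
have mpz c : measurable_fun setT (fun s : R => pdf (s - c)).
  exact: measurableT_comp mp (measurable_line_shift (- c)).
have mkz z : measurable_fun [set: plane] (kz z).
  by apply: measurable_funM => //; exact: (measurable_tensor (mpz z.1) (mpz z.2)).
have ikz z : pmu.-integrable setT (EFin \o kz z).
  have h : sqint pmu (fun p : plane => pdf (p.1 - z.1) * pdf (p.2 - z.2)).
    apply: (sqint_tensor (mpz z.1) (mpz z.2)).
    - exact: (wker_shift (- z.1) wker_sqr_pdf).
    - exact: (wker_shift (- z.2) wker_sqr_pdf).
  exact: sqint_mul_integrable h (L2funP f).
pose c z : R := (alpha ^+ 2)^-1 * expR (- alpha * z.1) * expR (- alpha * z.2).
have Fkz z : F \_ (quadrant z) = (fun w => c z * kz z w).
  apply/funext => -[w1 w2]; rewrite patchE /kz !pdfE /= !subr_ge0.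
  case: ifPn => [/set_mem/quadrantP[/= h1 h2]|/negP h].
    rewrite h1 h2 /c /F /=.
    have -> : - alpha * w1 = - alpha * (w1 - z.1) + - alpha * z.1 by ring.
    have -> : - alpha * w2 = - alpha * (w2 - z.2) + - alpha * z.2 by ring.
    by rewrite !expRD; field; rewrite gt_eqF.
  case: ifPn => h1; last by rewrite !mul0r mulr0.
  case: ifPn => h2; last by rewrite mulr0 mul0r mulr0.
  by exfalso; apply: h; rewrite inE; apply/quadrantP.
have iF z : pmu.-integrable setT (EFin \o (F \_ (quadrant z))).
  rewrite Fkz; have := integrableZl measurableT (c z) (ikz z).
  by congr (_.-integrable _ _).
pose I z := Rintegral pmu setT (F \_ (quadrant z)).
have Iae : {ae pmu, forall z, I z = 0}.
  apply: (@filterS _ _ (ae_filter_ringOfSetsType pmu)) T0 => z Tz.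
  rewrite /I Fkz RintegralZl//.
  suff -> : Rintegral pmu setT (kz z) = 0 by rewrite mulr0.
  rewrite -Tz tensoropE.
  have := Rintegral_preserved (measurable_plane_shift z) (@leb2_shift _ z) (mkz z) => /= <-.
  by apply: eq_Rintegral => -[w1 w2] _; rewrite /kz /= !addrK (addrC z).
(* From almost every corner to every corner: approach [z] by good corners from below and from the
   left. Quadrants are closed, so their indicators then converge at every point, and dominated
   convergence applies. *)
have I0 z : I z = 0.
  have /choice[zn hzn] (n : nat) : exists w : R * R, I w = 0 /\
      (z.1 - n.+1%:R^-1 < w.1 < z.1 /\ z.2 - n.+1%:R^-1 < w.2 < z.2).
    have n0 : 0 < n.+1%:R^-1 :> R by rewrite invr_gt0.
    by have [w h1 h2] := ae_dense_left z Iae n0; exists w.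
  have n1 (n : nat) : n.+1%:R^-1 <= 1 :> R by rewrite invf_le1// ler1n.
  have cv (w : R * R) : (fun n => ((F \_ (quadrant (zn n))) w)%:E) @ \oo -->
      ((F \_ (quadrant z)) w)%:E.
    apply: cvg_near_cst; have [qw|qw] := pselect (quadrant z w).
      apply: nearW => n; rewrite !patchE !mem_set//.
      have [_ [/andP[_ h1] /andP[_ h2]]] := hzn n; move/quadrantP : qw => [h3 h4].
      by apply/quadrantP; split; apply: ltW; apply: lt_le_trans; eassumption.
    have [d d0 dP] : exists2 d, 0 < d & w.1 + d <= z.1 \/ w.2 + d <= z.2.
      have [h1|h1] := ltP w.1 z.1.
        by exists (z.1 - w.1); [rewrite subr_gt0|left; rewrite addrC subrK].
      have [h2|h2] := ltP w.2 z.2; last by exfalso; apply: qw; apply/quadrantP.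
      by exists (z.2 - w.2); [rewrite subr_gt0|right; rewrite addrC subrK].
    near=> n; rewrite [LHS]/= ![in LHS]patchE [in RHS]patchE (memNset qw) memNset//.
    have nd : n.+1%:R^-1 < d by near: n; exact: (near_infty_natSinv_lt (PosNum d0)).
    have [_ [/andP[h1 _] /andP[h2 _]]] := hzn n.
    move=> /quadrantP[h3 h4]; move: dP nd h1 h2 h3 h4; move: n.+1%:R^-1 => e.
    by case; lra.
  have mq z' : measurable_fun [set: plane] (fun w => ((F \_ (quadrant z')) w)%:E).
    by have /integrableP[] := iF z'.
  have ig : pmu.-integrable setT (fun w => `|((F \_ (quadrant (z.1 - 1, z.2 - 1))) w)%:E|)%E.
    exact: integrable_abse (iF _).
  have dom : {ae pmu, forall w (n : nat), [set: plane] w ->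
      (`|((F \_ (quadrant (zn n))) w)%:E| <= `|((F \_ (quadrant (z.1 - 1, z.2 - 1))) w)%:E|)%E}.
    apply: aeW => w n _; rewrite !patchE; case: ifPn => [/set_mem/quadrantP[h1 h2]|_]; last first.
      by have -> : (point : R)%:E = 0%E by []; rewrite abse0 abse_ge0.
    rewrite mem_set//; apply/quadrantP => /=.
    have [_ [/andP[h3 _] /andP[h4 _]]] := hzn n; have := n1 n.
    by move: n.+1%:R^-1 h3 h4 => e h3 h4 he; split; lra.
  have [_ _] := dominated_convergence measurableT (fun n => mq (zn n)) (mq z)
    (aeW pmu (fun w _ => cv w)) ig dom.
  have -> : (fun n => (\int[pmu]_w ((F \_ (quadrant (zn n))) w)%:E)%E) = cst 0%E.
    apply/funext => n; have [h _] := hzn n.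
    by move: h; rewrite /I /Rintegral => h;
      rewrite -(fineK (integrable_fin_num measurableT (iF (zn n)))) h.
  move=> /(cvg_unique (@ereal_hausdorff R)) => /(_ _ (cvg_cst _)) h.
  by rewrite /I /Rintegral h.
suff : {ae pmu, forall w, F w = 0}.
  apply: (@filterS _ _ (ae_filter_ringOfSetsType pmu)) => w /eqP.
  by rewrite /F mulf_eq0 mulf_eq0 !(gt_eqF (expR_gt0 _)) /= => /eqP.
apply: quadrant_integrals_ae0 => //.
- move=> z; rewrite integrable_mkcond; last exact: measurable_quadrant.
  by rewrite restrict_EFin.
- move=> z; rewrite integral_mkcond; under eq_integral do rewrite restrict_EFin.
  have := I0 z; rewrite /I /Rintegral => h.
  by rewrite -(fineK (integrable_fin_num measurableT (iF z))) h.
Unshelve. all: by end_near. Qed.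

(** The quadratic form of [U V] is the squared norm of the two one-sided roots applied to [f];
    weakly this is the average that [quadrant_ae0] inverts. *)
Lemma resolv2_inj f : ip (resolv (1, 0) (resolv (0, 1) f)) f = 0 -> ip f f = 0.
Proof.
rewrite resolv_proot proot_resolv_comm resolv_proot => h0.
have null g : ip (tensorop wp wp f) g = 0.
  rewrite ip_tensorop rayop_comm.
  exact: (ip_null (@ipC _ _ _ pmu) (@ipDl _ _ _ pmu) (@ipZl _ _ _ pmu) (@ip_ge0 _ _ _ pmu) g h0).
have f0 := quadrant_ae0 (ip_eq0 (null (tensorop wp wp f))).
have [mf _] := L2funP f.
rewrite /ip (_ : Rintegral _ _ _ = Rintegral pmu setT (cst 0)); first by rewrite /Rintegral integral0.
apply: Rintegral_ae_eq => //; first exact: measurable_funM.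
by apply: (@filterS _ _ (ae_filter_ringOfSetsType pmu)) f0 => z ->; rewrite mulr0.
Qed.

End with_rate.
End resolvent_operators.

(** * Differential calculus on the line and the plane, Green's identity *)

Section calculus1.
Variable R : realType.

Lemma is_derive_line (f : R * R -> R) (z v : R * R) (df : R) :
  is_derive (0 : R) 1 (fun h : R => f (h *: v + z)) df -> is_derive z v f df.
Proof.
move=> [dd dE].
have E : (fun h : R => h^-1 *: (((fun h : R => f (h *: v + z)) \o shift 0) (h *: 1) - f (0 *: v + z)))
    = (fun h : R => h^-1 *: ((f \o shift z) (h *: v) - f z)).
  by apply/funext => h; rewrite /= scale0r add0r addr0 /GRing.scale/= mulr1.
move: dd dE; rewrite /derivable /derive E => dd dE.
by split.
Qed.

Lemma derivable_slice1 (f : R * R -> R) x y : derivable f (x, y) (1, 0) ->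
  is_derive (x : R) 1 (fun t => f (t, y)) ('D_(1, 0) f (x, y)).
Proof.
have E : (fun h : R => h^-1 *: ((f \o shift (x, y)) (h *: (1, 0)) - f (x, y))) =
    (fun h : R => h^-1 *: (((fun t => f (t, y)) \o shift x) (h *: 1) - f (x, y))).
  apply/funext => h; congr (_ *: (f _ - _)).
  by rewrite /= /GRing.add/= /add_pair/= /GRing.scale/= mulr0 add0r.
by move=> dd; split; rewrite /derivable /derive -E.
Qed.

Lemma derivable_slice2 (f : R * R -> R) x y : derivable f (x, y) (0, 1) ->
  is_derive (y : R) 1 (fun t => f (x, t)) ('D_(0, 1) f (x, y)).
Proof.
have E : (fun h : R => h^-1 *: ((f \o shift (x, y)) (h *: (0, 1)) - f (x, y))) =
    (fun h : R => h^-1 *: (((fun t => f (x, t)) \o shift y) (h *: 1) - f (x, y))).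
  apply/funext => h; congr (_ *: (f _ - _)).
  by rewrite /= /GRing.add/= /add_pair/= /GRing.scale/= mulr0 add0r.
by move=> dd; split; rewrite /derivable /derive -E.
Qed.

Lemma is_derive1_continuous (f f' : R -> R) :
  (forall x : R, is_derive x 1 f (f' x)) -> continuous f.
Proof.
by move=> df x; apply: differentiable_continuous; apply/derivable1_diffP; have [] := df x.
Qed.

Lemma is_derive_glue (f g f' g' : R -> R) : f 0 = g 0 -> f' 0 = g' 0 ->
  (forall x : R, is_derive x 1 f (f' x)) -> (forall x : R, is_derive x 1 g (g' x)) ->
  forall x : R, is_derive x 1 (fun s => if 0 <= s then f s else g s)
    (if 0 <= x then f' x else g' x).
Proof.
move=> fg0 fg0' df dg x.
have [x0|x0|<-] := ltgtP 0 x.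
- apply: near_eq_is_derive (df x); near=> y.
  by rewrite ifT//; apply: ltW; near: y; exact: lt_nbhsr.
- apply: near_eq_is_derive (dg x); near=> y.
  by rewrite ifF//; apply/negbTE; rewrite -ltNge; near: y; exact: lt_nbhsl.
- set h := fun s : R => _.
  have hq : (fun t : R => t^-1 *: ((h \o shift (0 : R)) (t *: 1) - h 0)) @ 0^' --> f' 0.
    apply: (@cvg_at_right_left_dnbhs _ R^o).
    + have [dd dE] := df 0; have cf : (fun t : R => t^-1 *: ((f \o shift (0 : R)) (t *: 1) - f 0)) @ 0^' --> f' 0.
        by rewrite -dE; exact: dd.
      apply: cvg_trans (cvg_dnbhs_at_right cf).
      apply: near_eq_cvg; near=> t; rewrite /h /= addr0 lexx /GRing.scale/= mulr1 ifT//.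
    + have [dd dE] := dg 0; have cf : (fun t : R => t^-1 *: ((g \o shift (0 : R)) (t *: 1) - g 0)) @ 0^' --> f' 0.
        by rewrite fg0' -dE; exact: dd.
      apply: cvg_trans (cvg_dnbhs_at_left cf).
      apply: near_eq_cvg; near=> t; rewrite /h /= addr0 lexx /GRing.scale/= mulr1 fg0 ifF//.
      by apply/negbTE; rewrite -ltNge.
  split; first by apply/cvg_ex; exists (f' 0).
  exact/cvg_lim.
Unshelve. all: by end_near. Qed.

Lemma continuous_glue (f g : R -> R) : f 0 = g 0 -> continuous f -> continuous g ->
  continuous (fun s : R => if 0 <= s then f s else g s).
Proof.
move=> fg0 cf cg.
have -> : (fun s : R => if 0 <= s then f s else g s) =
    (fun s => f (Num.max s 0) + g (Num.min s 0) - f 0).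
  apply/funext => s; case: (leP 0 s) => s0; first by rewrite -fg0 addrK.
  by rewrite (addrC (f 0)) addrK.
have cmax : continuous (fun s : R => Num.max s 0).
  by move=> s; apply: continuous_max; [exact: cvg_id|exact: cvg_cst].
have cmin : continuous (fun s : R => Num.min s 0).
  by move=> s; apply: continuous_min; [exact: cvg_id|exact: cvg_cst].
move=> s; apply: cvgB; last exact: cvg_cst.
by apply: cvgD; [exact: (continuous_comp (cmax s) (cf _))|exact: (continuous_comp (cmin s) (cg _))].
Qed.

Definition C2fun (a a1 a2 : R -> R) := [/\ forall x : R, is_derive x 1 a (a1 x),
  forall x : R, is_derive x 1 a1 (a2 x) & continuous a2].

Lemma C2fun_mul a a1 a2 b b1 b2 : C2fun a a1 a2 -> C2fun b b1 b2 ->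
  C2fun (fun x => a x * b x) (fun x => a1 x * b x + a x * b1 x)
    (fun x => a2 x * b x + 2 * (a1 x * b1 x) + a x * b2 x).
Proof.
move=> [da da1 ca2] [db db1 cb2].
have ca := is_derive1_continuous da; have ca1 := is_derive1_continuous da1.
have cb := is_derive1_continuous db; have cb1 := is_derive1_continuous db1.
split.
- move=> x; have := is_deriveM (da x) (db x) => h.
  by apply: is_derive_eq h _; rewrite /GRing.scale/=; ring.
- move=> x; have := is_deriveD (is_deriveM (da1 x) (db x)) (is_deriveM (da x) (db1 x)) => h.
  by apply: is_derive_eq h _; rewrite /GRing.scale/=; ring.
- move=> x; apply: cvgD; last by apply: cvgM; [exact: ca|exact: cb2].
  apply: cvgD; first by apply: cvgM; [exact: ca2|exact: cb].
  by apply: cvgM; [exact: cvg_cst|apply: cvgM; [exact: ca1|exact: cb1]].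
Qed.

Lemma C2fun_affine (a a1 a2 : R -> R) (c k : R) : C2fun a a1 a2 ->
  C2fun (fun x => a (c * x + k)) (fun x => c * a1 (c * x + k))
    (fun x => c ^+ 2 * a2 (c * x + k)).
Proof.
move=> [da da1 ca2].
have dl (x : R) : is_derive x 1 (fun x => c * x + k) c.
  have := is_deriveD (is_deriveZ c (is_derive_id x 1)) (is_derive_cst k x 1) => h.
  by apply: is_derive_eq h _; rewrite /GRing.scale/= mulr1 addr0.
split.
- move=> x; have := @is_derive1_comp _ a (fun y => c * y + k) x _ _ (da (c * x + k)) (dl x) => h.
  by apply: is_derive_eq h _; rewrite mulrC.
- move=> x; have := is_deriveZ c (@is_derive1_comp _ a1 (fun y => c * y + k) x _ _ (da1 (c * x + k)) (dl x)) => h.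
  by apply: is_derive_eq h _; rewrite /GRing.scale/=; ring.
- move=> x; apply: cvgM; first exact: cvg_cst.
  exact: (continuous_comp (is_derive1_continuous dl (x := x)) (ca2 _)).
Qed.

End calculus1.

Section plane_calculus.
Variable R : realType.
Local Notation line := (measurableTypeR R).
Local Notation plane := (line * line)%type.
Local Notation leb2 := (@leb2 R).

Definition C2plane (f : R * R -> R) := [/\ forall x v, derivable f x v,
  forall v x w, derivable ('D_v f) x w & forall v w, continuous ('D_w ('D_v f))].

Lemma test_fun_C2 chi : test_fun chi -> C2plane chi.
Proof. by move=> [? [? [? _]]]. Qed.

Lemma continuous_prod (f : R * R -> R) z : continuous_at z f <->
  (forall e, 0 < e -> exists2 d, 0 < d & forall w : R * R,
    `|w.1 - z.1| < d -> `|w.2 - z.2| < d -> `|f w - f z| < e).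
Proof.
split.
- move=> /cvgrPdist_lt h e e0; have /nbhs_ballP[d /= d0 hd] := h e e0.
  exists d => // w w1 w2; rewrite distrC; apply: hd.
  by split; rewrite /ball/= distrC.
- move=> h; apply/cvgrPdist_lt => e e0; have [d d0 hd] := h e e0.
  apply: filterS (nbhsx_ballx z d d0) => w [w1 w2]; rewrite distrC; apply: hd.
  + by move: w1; rewrite /ball/= distrC.
  + by move: w2; rewrite /ball/= distrC.
Qed.

Lemma mvt_bound (g g' : R -> R) (a b M : R) :
  (forall x : R, is_derive x 1 g (g' x)) ->
  (forall x, `|x - a| <= `|b - a| -> `|g' x| <= M) -> `|g b - g a| <= M * `|b - a|.
Proof.
move=> dg gM.
have cg := is_derive1_continuous dg.
have [ab|ba|->] := ltgtP a b; last by rewrite !subrr normr0 mulr0.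
- have [c] := MVT ab (fun x _ => dg x) (continuous_subspaceT cg).
  rewrite in_itv/= => /andP[ac cb] ->; rewrite normrM ler_wpM2r//; apply: gM.
  by rewrite !gtr0_norm ?subr_gt0//; lra.
- have [c] := MVT ba (fun x _ => dg x) (continuous_subspaceT cg).
  rewrite in_itv/= => /andP[bc ca] h; rewrite distrC h normrM distrC ler_wpM2r//.
  by apply: gM; rewrite !ltr0_norm ?subr_lt0//; lra.
Qed.

(** A test function is only given with directional derivatives, those of second order being
    continuous. Continuity of the function and of its first derivatives is recovered here by the
    mean value theorem along the axes; [M] bounds both partial derivatives near the point. *)
Lemma continuous_of_partial (f : R * R -> R) :
  (forall z, derivable f z (1, 0)) -> (forall z, derivable f z (0, 1)) ->
  continuous ('D_(1, 0) f) -> continuous ('D_(0, 1) f) -> continuous f.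
Proof.
move=> d1 d2 c1 c2 [x y]; apply/continuous_prod => e e0.
have /continuous_prod/(_ 1 ltr01)[r1 r10 h1] := c1 (x, y).
have /continuous_prod/(_ 1 ltr01)[r2 r20 h2] := c2 (x, y).
pose M := `|'D_(1, 0) f (x, y)| + `|'D_(0, 1) f (x, y)| + 1.
have M0 : 0 < M by rewrite /M; have := normr_ge0 ('D_(1, 0) f (x, y)); have := normr_ge0 ('D_(0, 1) f (x, y)); lra.
pose d := Num.min (Num.min r1 r2) (e / (2 * M)).
have d0 : 0 < d by rewrite !lt_min r10 r20/= divr_gt0// mulr_gt0.
have dr1 : d <= r1 by rewrite /d !ge_min lexx.
have dr2 : d <= r2 by rewrite /d !ge_min lexx orbT.
have de : d * (2 * M) <= e by rewrite -ler_pdivlMr ?mulr_gt0// /d ge_min lexx orbT.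
exists d => // -[u v] /= ud vd.
have b1 : `|f (u, v) - f (x, v)| <= M * `|u - x|.
  apply: (mvt_bound (g := fun t => f (t, v)) (g' := fun t => 'D_(1, 0) f (t, v))).
    by move=> t; exact: derivable_slice1.
  move=> t tx; have /= := h1 (t, v) (le_lt_trans tx (lt_le_trans ud dr1)) (lt_le_trans vd dr1).
  have := ler_normD ('D_(1, 0) f (t, v) - 'D_(1, 0) f (x, y)) ('D_(1, 0) f (x, y)).
  by rewrite subrK /M; have := normr_ge0 ('D_(0, 1) f (x, y)); lra.
have b2 : `|f (x, v) - f (x, y)| <= M * `|v - y|.
  apply: (mvt_bound (g := fun t => f (x, t)) (g' := fun t => 'D_(0, 1) f (x, t))).
    by move=> t; exact: derivable_slice2.
  move=> t ty; have /= := h2 (x, t) _ (le_lt_trans ty (lt_le_trans vd dr2)).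
  rewrite subrr normr0 => /(_ r20).
  have := ler_normD ('D_(0, 1) f (x, t) - 'D_(0, 1) f (x, y)) ('D_(0, 1) f (x, y)).
  by rewrite subrK /M; have := normr_ge0 ('D_(1, 0) f (x, y)); lra.
have -> : f (u, v) - f (x, y) = (f (u, v) - f (x, v)) + (f (x, v) - f (x, y)) by ring.
apply: (le_lt_trans (ler_normD _ _)).
by have := ler_wpM2l (ltW M0) (ltW ud); have := ler_wpM2l (ltW M0) (ltW vd);
  have := ltr_pM2l M0 `|u - x| d; rewrite ud; nra.
Qed.

Lemma C2plane_continuous_D f v : C2plane f -> continuous ('D_v f).
Proof.
by move=> [d1 d2 c]; apply: continuous_of_partial => // z; exact: d2.
Qed.

Lemma C2plane_continuous f : C2plane f -> continuous f.
Proof.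
by move=> cf; have [d1 d2 c] := cf; apply: continuous_of_partial => //; exact: C2plane_continuous_D.
Qed.

Lemma C2plane_lap f : C2plane f -> continuous (lap f).
Proof.
by move=> [d1 d2 c] z; apply: cvgD; exact: c.
Qed.

(** Measurability refers to the product sigma-algebra, so [f] is written as the limit of functions
    that are constant on the squares of a grid of mesh [1/(n+1)]. *)
Lemma continuous_plane_measurable (f : R * R -> R) : continuous f ->
  measurable_fun [set: plane] f.
Proof.
move=> cf.
pose st (n : nat) (x : R) : R := (Num.floor (n.+1%:R * x))%:~R / n.+1%:R.
pose fn n (z : R * R) := f (st n z.1, st n z.2).
have mfn n : measurable_fun [set: plane] (fn n).
  move=> _ B mB; rewrite setTI.
  pose Q (i j : int) : set plane :=
    [set x | Num.floor (n.+1%:R * x) = i] `*` [set x | Num.floor (n.+1%:R * x) = j].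
  have mfl (i : int) : measurable ([set x : R | Num.floor (n.+1%:R * x) = i] : set line).
    rewrite (_ : [set _ | _] = `[i%:~R / n.+1%:R, (i + 1)%:~R / n.+1%:R[%classic); last first.
      apply/seteqP; split => x /=; rewrite in_itv/= ler_pdivrMr// ltr_pdivlMr// [x * _]mulrC.
        by move=> <-; rewrite floor_le_tmp floorD1_gt.
      by move=> h; exact: floor_def.
    exact: measurable_itv.
  rewrite (_ : _ @^-1` B = \bigcup_(p in [set p : int * int |
     B (f (p.1%:~R / n.+1%:R, p.2%:~R / n.+1%:R))]) Q p.1 p.2).
    rewrite bigcup_mkcond; apply: countable_bigcupT_measurable => [|p].
      exact: countableP.
    by case: ifP => // _; apply: measurableX; exact: mfl.
  apply/seteqP; split => [[x y] /= h|[x y] [[i j] /= h] [/= hi hj]].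
    by exists (Num.floor (n.+1%:R * x), Num.floor (n.+1%:R * y)).
  by rewrite /fn /st /= hi hj.
apply: (measurable_fun_cvg mfn) => -[x y] _.
have stE n u : `|st n u - u| <= n.+1%:R^-1.
  have n0 : 0 < n.+1%:R :> R by [].
  have h1 := floor_le_tmp (n.+1%:R * u); have h2 := floorD1_gt (n.+1%:R * u).
  have -> : st n u - u = ((Num.floor (n.+1%:R * u))%:~R - n.+1%:R * u) / n.+1%:R.
    by rewrite /st mulrBl [n.+1%:R * u]mulrC mulfK ?pnatr_eq0.
  rewrite normrM [X in _ * X]gtr0_norm ?invr_gt0// ler_piMl ?invr_ge0//.
  by move: h2; rewrite intrD => h2; rewrite ler_norml; lra.
apply/cvgrPdist_lt => e e0; have /continuous_prod/(_ e e0)[d d0 hd] := cf (x, y).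
near=> n; rewrite distrC; apply: hd => /=; apply: (le_lt_trans (stE _ _));
  near: n; exact: (near_infty_natSinv_lt (PosNum d0)).
Unshelve. all: by end_near. Qed.

Lemma compactly_supported_integrable (f : R * R -> R) (r : R) : continuous f ->
  (forall z : R * R, r < `|z.1| \/ r < `|z.2| -> f z = 0) ->
  leb2.-integrable setT (EFin \o f).
Proof.
move=> cf f0; have mf := continuous_plane_measurable cf.
pose K : set (R * R) := `[- r, r]%classic `*` `[- r, r]%classic.
have cK : compact K by apply: compact_setX; exact: segment_compact.
have /compact_bounded[M [_ hM]] := continuous_compact (continuous_subspaceT cf) cK.
pose C := `|M| + 1.
have fC z : `|f z| <= C * (\1_(`[- r, r]%classic) z.1 * \1_(`[- r, r]%classic) z.2).
  have [h|h] := pselect (K z).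
    have [h1 h2] := h; rewrite !indicE (mem_set h1) (mem_set h2).
    rewrite !mulr1; apply: (hM C _ (f z)); last by exists z.
    by rewrite /C; have := ler_norm M; lra.
  rewrite f0 ?normr0 ?mulr_ge0 ?addr_ge0//.
  apply: contrapT => /not_orP[/negP + /negP]; rewrite -!leNgt => h1 h2; apply: h.
  by split; rewrite /= in_itv/= -ler_norml.
have wI : wker (\1_(`[- r, r]%classic) : R -> R).
  split; first by apply: measurable_indic; exact: measurable_itv.
  - by move=> s; rewrite indicE.
  - exact: integrable_indic_itv.
have := integrableZl measurableT C (integrable_tensor wI wI) => iC.
apply: (le_integrable measurableT _ _ iC); first exact/measurable_EFinP.
move=> z _ /=; rewrite lee_fin [leRHS]ger0_norm ?fC//.
by rewrite mulr_ge0 ?mulr_ge0 ?indicE// addr_ge0.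
Qed.

Lemma is_derive_near0 (c : R -> R) (x dc : R) : (\forall y \near x, c y = 0) ->
  is_derive x 1 c dc -> dc = 0.
Proof.
move=> c0 dcx.
have h : is_derive x 1 c 0.
  by apply: near_eq_is_derive (is_derive_cst (0 : R) x 1); apply: filterS c0 => y ->.
by rewrite -(@derive_val _ _ _ _ _ _ _ dcx) (@derive_val _ _ _ _ _ _ _ h).
Qed.

Lemma near_norm_gt (r x : R) : r < `|x| -> \forall y \near x, r < `|y|.
Proof.
move=> rx; have e0 : 0 < `|x| - r by rewrite subr_gt0.
apply: filterS (nbhsx_ballx x _ e0) => y; rewrite /ball/= => h.
by have := ler_normD (x - y) y; rewrite subrK; lra.
Qed.

(** The integrand is the derivative of the Wronskian [u c' - u' c], which vanishes outside the
    support of [c]. *)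
Lemma green1 (u u1 u2 c c1 c2 : R -> R) (r : R) : C2fun u u1 u2 -> C2fun c c1 c2 ->
  (forall x, r < `|x| -> c x = 0) ->
  Rintegral (@lebesgue_measure R) setT (fun x => u x * c2 x - u2 x * c x) = 0.
Proof.
move=> [du du1 cu2] [dc dc1 cc2] c0.
have cu := is_derive1_continuous du; have cu1 := is_derive1_continuous du1.
have cc := is_derive1_continuous dc; have cc1 := is_derive1_continuous dc1.
have c10 x : r < `|x| -> c1 x = 0.
  move=> rx; apply: is_derive_near0 (dc x).
  by apply: filterS (near_norm_gt rx) => y; exact: c0.
have c20 x : r < `|x| -> c2 x = 0.
  move=> rx; apply: is_derive_near0 (dc1 x).
  by apply: filterS (near_norm_gt rx) => y; exact: c10.
pose M := `|r| + 1; have M0 : 0 < M by rewrite /M; have := normr_ge0 r; lra.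
have rM : r < M by rewrite /M; have := ler_norm r; lra.
pose F x := u x * c1 x - u1 x * c x.
pose h x := u x * c2 x - u2 x * c x.
have dF (x : R) : is_derive x 1 F (h x).
  have := is_deriveB (is_deriveM (du x) (dc1 x)) (is_deriveM (du1 x) (dc x)) => H.
  by apply: is_derive_eq H _; rewrite /h /GRing.scale/=; ring.
have ch : continuous h.
  move=> x; apply: cvgB; apply: cvgM; [exact: cu|exact: cc2|exact: cu2|exact: cc].
have cF := is_derive1_continuous dF.
have -> : (fun x => u x * c2 x - u2 x * c x) = h \_ `[- M, M].
  apply/funext => x; rewrite patchE; case: ifPn => // /negP xM.
  have rx : r < `|x|.
    rewrite ltNge; apply/negP => xr; apply: xM; rewrite inE/= in_itv/= -ler_norml.
    by rewrite (le_trans xr)// ltW.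
  by rewrite c20// c0// !mulr0 subr0.
rewrite -Rintegral_mkcond /Rintegral.
rewrite (@continuous_FTC2 _ h F)//.
- rewrite -EFinB/= /F !c0 ?c10 ?mulr0 ?subrr// ?normrN gtr0_norm//.
- by rewrite gtrN.
- exact: continuous_subspaceT.
- split; first by move=> x _; have [] := dF x.
  + exact/cvg_at_right_filter/cF.
  + exact/cvg_at_left_filter/cF.
- by move=> x _; rewrite derive1E; exact: derive_val.
Qed.

Lemma continuous_slice1 (g : R * R -> R) (y : R) : continuous g ->
  continuous (fun x : R => g (x, y)).
Proof.
move=> cg x; apply/cvgrPdist_lt => e e0.
have /continuous_prod/(_ e e0)[d d0 hd] := cg (x, y).
apply: filterS (nbhsx_ballx x d d0) => t xt; rewrite distrC.
by apply: hd; rewrite /= ?subrr ?normr0// distrC; exact: xt.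
Qed.

Lemma continuous_slice2 (g : R * R -> R) (x : R) : continuous g ->
  continuous (fun y : R => g (x, y)).
Proof.
move=> cg y; apply/cvgrPdist_lt => e e0.
have /continuous_prod/(_ e e0)[d d0 hd] := cg (x, y).
apply: filterS (nbhsx_ballx y d d0) => t yt; rewrite distrC.
by apply: hd; rewrite /= ?subrr ?normr0// distrC; exact: yt.
Qed.

Lemma near_outside (r : R) (z : R * R) : r < `|z.1| \/ r < `|z.2| ->
  \forall w \near z, r < `|w.1| \/ r < `|w.2|.
Proof.
move=> [h|h].
- have e0 : 0 < `|z.1| - r by rewrite subr_gt0.
  apply: filterS (nbhsx_ballx z _ e0) => w [w1 _]; left.
  by have := ler_normD (z.1 - w.1) w.1; rewrite subrK; move: w1; rewrite /ball/=; lra.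
- have e0 : 0 < `|z.2| - r by rewrite subr_gt0.
  apply: filterS (nbhsx_ballx z _ e0) => w [_ w1]; right.
  by have := ler_normD (z.2 - w.2) w.2; rewrite subrK; move: w1; rewrite /ball/=; lra.
Qed.

Lemma derive_outside (r : R) (f : R * R -> R) v :
  (forall z : R * R, r < `|z.1| \/ r < `|z.2| -> f z = 0) ->
  forall z : R * R, r < `|z.1| \/ r < `|z.2| -> 'D_v f z = 0.
Proof.
move=> f0 z hz; rewrite (@near_eq_derive _ _ _ f (cst 0)) ?derive_cst//.
by apply: filterS (near_outside hz) => w; exact: f0.
Qed.

Lemma green f chi : C2plane f -> test_fun chi ->
  Rintegral leb2 setT (fun x => f x * lap chi x) =
  Rintegral leb2 setT (fun x => lap f x * chi x).
Proof.
move=> Cf tchi; have Cc := test_fun_C2 tchi.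
have [_ [_ [_ [r hr]]]] := tchi.
have [f1 f2 fc] := Cf; have [c1 c2 cc] := Cc.
have hr1 v (z : R * R) : r < `|z.1| \/ r < `|z.2| -> 'D_v chi z = 0.
  exact: derive_outside.
have hr2 v w (z : R * R) : r < `|z.1| \/ r < `|z.2| -> 'D_w ('D_v chi) z = 0.
  by apply: derive_outside; exact: hr1.
have cf0 := C2plane_continuous Cf; have cc0 := C2plane_continuous Cc.
have cmul (a b : R * R -> R) : continuous a -> continuous b -> continuous (fun z => a z * b z).
  by move=> ca cb z; apply: cvgM; [exact: ca|exact: cb].
have i1 v : leb2.-integrable setT (EFin \o (fun z => f z * 'D_v ('D_v chi) z)).
  apply: (compactly_supported_integrable (r := r)); first exact: cmul.
  by move=> z hz; rewrite hr2// mulr0.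
have i2 v : leb2.-integrable setT (EFin \o (fun z => 'D_v ('D_v f) z * chi z)).
  apply: (compactly_supported_integrable (r := r)); first exact: cmul.
  by move=> z hz; rewrite hr// mulr0.
have i3 v : leb2.-integrable setT (EFin \o (fun z => f z * 'D_v ('D_v chi) z - 'D_v ('D_v f) z * chi z)).
  by have := integrableB measurableT (i1 v) (i2 v); congr (_.-integrable _ _).
have e1 : Rintegral leb2 setT (fun z => f z * 'D_(1, 0) ('D_(1, 0) chi) z - 'D_(1, 0) ('D_(1, 0) f) z * chi z) = 0.
  rewrite -(Rintegral21_prod (i3 (1, 0))).
  rewrite (_ : (fun y => _) = cst 0); first by rewrite /Rintegral integral0.
  apply/funext => y; apply: (green1 (r := r) (u1 := fun x => 'D_(1, 0) f (x, y))
    (c1 := fun x => 'D_(1, 0) chi (x, y))).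
  - split; [by move=> x; exact: derivable_slice1|by move=> x; exact: derivable_slice1|].
    exact: (@continuous_slice1 ('D_(1, 0) ('D_(1, 0) f)) y (fc _ _)).
  - split; [by move=> x; exact: derivable_slice1|by move=> x; exact: derivable_slice1|].
    exact: (@continuous_slice1 ('D_(1, 0) ('D_(1, 0) chi)) y (cc _ _)).
  - by move=> x rx; apply: hr; left.
have e2 : Rintegral leb2 setT (fun z => f z * 'D_(0, 1) ('D_(0, 1) chi) z - 'D_(0, 1) ('D_(0, 1) f) z * chi z) = 0.
  rewrite -(Rintegral12_prod (i3 (0, 1))).
  rewrite (_ : (fun y => _) = cst 0); first by rewrite /Rintegral integral0.
  apply/funext => y; apply: (green1 (r := r) (u1 := fun x => 'D_(0, 1) f (y, x))
    (c1 := fun x => 'D_(0, 1) chi (y, x))).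
  - split; [by move=> x; exact: derivable_slice2|by move=> x; exact: derivable_slice2|].
    exact: (@continuous_slice2 ('D_(0, 1) ('D_(0, 1) f)) y (fc _ _)).
  - split; [by move=> x; exact: derivable_slice2|by move=> x; exact: derivable_slice2|].
    exact: (@continuous_slice2 ('D_(0, 1) ('D_(0, 1) chi)) y (cc _ _)).
  - by move=> x rx; apply: hr; right.
have -> : (fun x => f x * lap chi x) = (fun x => f x * 'D_(1, 0) ('D_(1, 0) chi) x + f x * 'D_(0, 1) ('D_(0, 1) chi) x).
  by apply/funext => x; rewrite -mulrDr.
have -> : (fun x => lap f x * chi x) = (fun x => 'D_(1, 0) ('D_(1, 0) f) x * chi x + 'D_(0, 1) ('D_(0, 1) f) x * chi x).
  by apply/funext => x; rewrite -mulrDl.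
have := RintegralB measurableT (i1 (1, 0)) (i2 (1, 0)); rewrite e1 => /esym/subr0_eq E1.
have := RintegralB measurableT (i1 (0, 1)) (i2 (0, 1)); rewrite e2 => /esym/subr0_eq E2.
have D1 := RintegralD measurableT (i1 (1, 0)) (i1 (0, 1)).
have D2 := RintegralD measurableT (i2 (1, 0)) (i2 (0, 1)).
apply: (eq_trans D1); apply: (eq_trans _ (esym D2)).
exact: (congr2 +%R E1 E2).
Qed.

End plane_calculus.

Section tensor_functions.
Variable R : realType.
Local Notation line := (measurableTypeR R).
Local Notation plane := (line * line)%type.
Local Notation leb2 := (@leb2 R).

Definition tens (a b : R -> R) (z : R * R) : R := a z.1 * b z.2.

Lemma is_derive_tens (a a1 b b1 : R -> R) (z v : R * R) :
  (forall x : R, is_derive x 1 a (a1 x)) -> (forall x : R, is_derive x 1 b (b1 x)) ->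
  is_derive z v (tens a b) (v.1 * tens a1 b z + v.2 * tens a b1 z).
Proof.
move=> da db; apply: is_derive_line.
have dl c k : is_derive (0 : R) 1 (fun h : R => h * c + k) c.
  have := is_deriveD (is_deriveM (is_derive_id (0 : R) 1) (is_derive_cst c (0 : R) 1)) (is_derive_cst k (0 : R) 1) => h.
  by apply: is_derive_eq h _; rewrite /GRing.scale/=; ring.
have hA := @is_derive1_comp _ a (fun h : R => h * v.1 + z.1) 0 _ _ (da _) (dl v.1 z.1).
have hB := @is_derive1_comp _ b (fun h : R => h * v.2 + z.2) 0 _ _ (db _) (dl v.2 z.2).
have := is_deriveM hA hB => h.
apply: is_derive_eq h _.
by rewrite /tens /GRing.scale/= !mul0r !add0r; ring.
Qed.

Lemma derive_tens (a a1 b b1 : R -> R) (v : R * R) :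
  (forall x : R, is_derive x 1 a (a1 x)) -> (forall x : R, is_derive x 1 b (b1 x)) ->
  'D_v (tens a b) = (fun z => v.1 * tens a1 b z + v.2 * tens a b1 z).
Proof.
move=> da db; apply/funext => z.
by rewrite (@derive_val _ _ _ _ _ _ _ (is_derive_tens z v da db)).
Qed.

Lemma is_derive2_tens a a1 a2 b b1 b2 (v w z : R * R) : C2fun a a1 a2 -> C2fun b b1 b2 ->
  is_derive z w ('D_v (tens a b))
    (v.1 * (w.1 * tens a2 b z + w.2 * tens a1 b1 z) +
     v.2 * (w.1 * tens a1 b1 z + w.2 * tens a b2 z)).
Proof.
move=> [da da1 _] [db db1 _]; rewrite (derive_tens v da db).
exact: (is_deriveD (is_deriveZ v.1 (is_derive_tens z w da1 db))
                   (is_deriveZ v.2 (is_derive_tens z w da db1))).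
Qed.

Lemma continuous_tens a b : continuous a -> continuous b -> continuous (tens a b).
Proof.
move=> ca cb z; apply: cvgM.
- by apply: (@continuous_comp _ _ _ fst a z); [exact: cvg_fst|exact: ca].
- by apply: (@continuous_comp _ _ _ snd b z); [exact: cvg_snd|exact: cb].
Qed.

Lemma C2plane_tens a a1 a2 b b1 b2 : C2fun a a1 a2 -> C2fun b b1 b2 -> C2plane (tens a b).
Proof.
move=> Ca Cb; have [da da1 ca2] := Ca; have [db db1 cb2] := Cb.
have ca := is_derive1_continuous da; have ca1 := is_derive1_continuous da1.
have cb := is_derive1_continuous db; have cb1 := is_derive1_continuous db1.
split.
- by move=> z v; have [] := is_derive_tens z v da db.
- by move=> v z w; have [] := is_derive2_tens v w z Ca Cb.
- move=> v w; rewrite (_ : 'D_w _ = fun z => v.1 * (w.1 * tens a2 b z + w.2 * tens a1 b1 z) +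
     v.2 * (w.1 * tens a1 b1 z + w.2 * tens a b2 z)); last first.
    by apply/funext => z; rewrite (@derive_val _ _ _ _ _ _ _ (is_derive2_tens v w z Ca Cb)).
  move=> z; apply: cvgD; (apply: cvgM; first exact: cvg_cst);
    apply: cvgD; (apply: cvgM; first exact: cvg_cst); exact: continuous_tens.
Qed.

Lemma lap_tens a a1 a2 b b1 b2 z : C2fun a a1 a2 -> C2fun b b1 b2 ->
  lap (tens a b) z = tens a2 b z + tens a b2 z.
Proof.
move=> Ca Cb; rewrite /lap.
rewrite (@derive_val _ _ _ _ _ _ _ (is_derive2_tens (e1 R) (e1 R) z Ca Cb)).
rewrite (@derive_val _ _ _ _ _ _ _ (is_derive2_tens (e2 R) (e2 R) z Ca Cb)).
by rewrite /=; ring.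
Qed.

Lemma test_fun_tens a a1 a2 b b1 b2 (r : R) : C2fun a a1 a2 -> C2fun b b1 b2 ->
  (forall x, r < `|x| -> a x = 0) -> (forall x, r < `|x| -> b x = 0) ->
  test_fun (tens a b).
Proof.
move=> Ca Cb a0 b0; have [h1 h2 h3] := C2plane_tens Ca Cb.
split=> //; split=> //; split=> //; exists r => z [h|h]; rewrite /tens.
- by rewrite a0// mul0r.
- by rewrite b0// mulr0.
Qed.

End tensor_functions.

(** * The C^2 kernel and a C^2 cut-off *)

Section smooth_kernel.
Variables (R : realType) (alpha : R).
Hypothesis alpha0 : 0 < alpha.

Let kp (s : R) := alpha / 4 * (1 + alpha * s) * expR (- alpha * s).
Let kp1 (s : R) := - (alpha ^+ 3 / 4) * s * expR (- alpha * s).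
Let kp2 (s : R) := alpha ^+ 3 / 4 * (alpha * s - 1) * expR (- alpha * s).

Let is_derive_exp (s : R) : is_derive s 1 (fun s : R => expR (- alpha * s)) (- alpha * expR (- alpha * s)).
Proof.
have dl : is_derive s 1 (fun s : R => - alpha * s) (- alpha).
  have := is_deriveZ (- alpha) (is_derive_id s 1) => h.
  by apply: is_derive_eq h _; rewrite /GRing.scale/= mulr1.
have := @is_derive1_comp _ expR (fun s : R => - alpha * s) s _ _ (is_derive_expR _) dl => h.
by apply: is_derive_eq h _; rewrite mulrC.
Qed.

Let C2fun_kp : C2fun kp kp1 kp2.
Proof.
have dlin (c k s : R) : is_derive s 1 (fun s : R => c + k * s) k.
  have := is_deriveD (is_derive_cst c s 1) (is_deriveZ k (is_derive_id s 1)) => h.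
  by apply: is_derive_eq h _; rewrite /GRing.scale/= mulr1 add0r.
have dle (c k s : R) : is_derive s 1 (fun s : R => (c + k * s) * expR (- alpha * s))
    ((k - alpha * c - alpha * k * s) * expR (- alpha * s)).
  have := is_deriveM (dlin c k s) (is_derive_exp s) => h.
  by apply: is_derive_eq h _; rewrite /GRing.scale/=; ring.
have E0 : kp = (fun s : R => (alpha / 4 + alpha ^+ 2 / 4 * s) * expR (- alpha * s)).
  by apply/funext => s; rewrite /kp; field.
have E1 : kp1 = (fun s : R => (0 + - (alpha ^+ 3 / 4) * s) * expR (- alpha * s)).
  by apply/funext => s; rewrite /kp1; field.
have E2 : kp2 = (fun s : R => (- (alpha ^+ 3 / 4) + alpha ^+ 4 / 4 * s) * expR (- alpha * s)).
  by apply/funext => s; rewrite /kp2; field.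
split.
- by move=> s; rewrite E0; apply: is_derive_eq (dle _ _ s) _; rewrite /kp1; field.
- by move=> s; rewrite E1; apply: is_derive_eq (dle _ _ s) _; rewrite /kp2; field.
- by rewrite E2; exact: is_derive1_continuous (dle _ _).
Qed.

Definition kappa1 (s : R) := - (alpha ^+ 3 / 4) * s * expR (- alpha * `|s|).
Definition kappa2 (s : R) := alpha ^+ 3 / 4 * (alpha * `|s| - 1) * expR (- alpha * `|s|).

(** In operators, [D^2 U^2 = alpha^2 (U^2 - U)]: the source of the first- and second-order terms of
    [N]. *)
Lemma kappa2E s : kappa2 s = alpha ^+ 2 * (kappa alpha s - lker alpha s).
Proof. by rewrite /kappa2 /kappa /lker; field. Qed.

Lemma C2fun_kappa : C2fun (kappa alpha) kappa1 kappa2.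
Proof.
have [d0 d1 c2] := C2fun_kp; have [n0 n1 cn] := C2fun_affine (-1) 0 C2fun_kp.
have E0 : kappa alpha = (fun s => if 0 <= s then kp s else kp (-1 * s + 0)).
  apply/funext => s; rewrite /kappa /kp addr0 mulN1r; case: (leP 0 s) => s0.
    by rewrite ger0_norm.
  by rewrite ltr0_norm.
have E1 : kappa1 = (fun s => if 0 <= s then kp1 s else -1 * kp1 (-1 * s + 0)).
  apply/funext => s; rewrite /kappa1 /kp1 addr0 !mulN1r; case: (leP 0 s) => s0.
    by rewrite ger0_norm.
  by rewrite ltr0_norm//; ring.
have E2 : kappa2 = (fun s => if 0 <= s then kp2 s else (-1) ^+ 2 * kp2 (-1 * s + 0)).
  apply/funext => s; rewrite /kappa2 /kp2 addr0 !mulN1r sqrrN expr1n mul1r; case: (leP 0 s) => s0.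
    by rewrite ger0_norm.
  by rewrite ltr0_norm.
split.
- move=> s; rewrite E0 E1; apply: is_derive_glue => //.
  + by rewrite mulr0 addr0.
  + by rewrite mulr0 addr0 /kp1 mulr0 mul0r mulr0.
- move=> s; rewrite E1 E2; apply: is_derive_glue => //.
  + by rewrite mulr0 addr0 /kp1 mulr0 mul0r mulr0.
  + by rewrite mulr0 addr0 sqrrN expr1n mul1r.
- rewrite E2; apply: continuous_glue => //.
  by rewrite mulr0 addr0 sqrrN expr1n mul1r.
Qed.

End smooth_kernel.

Section cutoff.
Variable R : realType.

(** The cube is the lowest integer power of the positive part that is C^2. *)
Let rho (u : R) := if 0 <= u then u ^+ 3 else 0.
Let rho1 (u : R) := if 0 <= u then 3 * u ^+ 2 else 0.
Let rho2 (u : R) := if 0 <= u then 6 * u else 0.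

Let C2fun_rho : C2fun rho rho1 rho2.
Proof.
split.
- apply: (@is_derive_glue R (fun u => u ^+ 3) (fun _ => 0) (fun u => 3 * u ^+ 2) (fun _ => 0)).
  + by rewrite expr0n.
  + by rewrite expr0n mulr0.
  + move=> x; have := is_deriveX 3 (is_derive_id x 1) => h.
    by apply: is_derive_eq h _; rewrite /GRing.scale/= mulr1.
- apply: (@is_derive_glue R (fun u => 3 * u ^+ 2) (fun _ => 0) (fun u => 6 * u) (fun _ => 0)).
  + by rewrite expr0n mulr0.
  + by rewrite mulr0.
  + move=> x; have := is_deriveZ (3 : R) (is_deriveX 2 (is_derive_id x 1)) => h.
    by apply: is_derive_eq h _; rewrite /GRing.scale/=; ring.
- apply: (continuous_glue (g := fun _ => 0)); first by rewrite mulr0.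
    by move=> x; apply: cvgM; [exact: cvg_cst|exact: cvg_id].
  by move=> x; exact: cvg_cst.
Qed.

Definition cutoff (x : R) := rho (1 - x ^+ 2).
Definition cutoff1 (x : R) := - 2 * x * rho1 (1 - x ^+ 2).
Definition cutoff2 (x : R) := - 2 * rho1 (1 - x ^+ 2) + 4 * x ^+ 2 * rho2 (1 - x ^+ 2).

Lemma C2fun_cutoff : C2fun cutoff cutoff1 cutoff2.
Proof.
have [d0 d1 c2] := C2fun_rho.
have dq (x : R) : is_derive x 1 (fun x : R => 1 - x ^+ 2) (- 2 * x).
  have := is_deriveB (is_derive_cst (1 : R) x 1) (is_deriveX 2 (is_derive_id x 1)) => h.
  by apply: is_derive_eq h _; rewrite /GRing.scale/=; ring.
have c1 := is_derive1_continuous d1; have cq := is_derive1_continuous dq.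
split.
- move=> x; have := @is_derive1_comp _ rho (fun x : R => 1 - x ^+ 2) x _ _ (d0 _) (dq x) => h.
  by apply: is_derive_eq h _; rewrite mulrC.
- move=> x; have h1 := @is_derive1_comp _ rho1 (fun x : R => 1 - x ^+ 2) x _ _ (d1 _) (dq x).
  have dm : is_derive x 1 (fun x : R => - 2 * x) (- 2).
    have := is_deriveZ (- 2 : R) (is_derive_id x 1) => h.
    by apply: is_derive_eq h _; rewrite /GRing.scale/= mulr1.
  have := is_deriveM dm h1 => h.
  by apply: is_derive_eq h _; rewrite /cutoff2 /GRing.scale/=; ring.
- move=> x; apply: cvgD.
    apply: cvgM; first exact: cvg_cst.
    exact: (continuous_comp (cq x) (c1 _)).
  apply: cvgM; last exact: (continuous_comp (cq x) (c2 _)).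
  by apply: cvgM; [exact: cvg_cst|exact: exprn_continuous].
Qed.

Lemma cutoff0 : cutoff 0 = 1.
Proof. by rewrite /cutoff expr0n subr0 /rho ler01 expr1n. Qed.

Let sqr_gt1 (x : R) : 1 < `|x| -> (0 <= 1 - x ^+ 2) = false.
Proof.
move=> x1; apply/negbTE; rewrite -ltNge subr_lt0 -real_normK ?num_real//.
by have := normr_ge0 x; nra.
Qed.

Lemma cutoff_out x : 1 < `|x| -> cutoff x = 0.
Proof. by move=> x1; rewrite /cutoff /rho sqr_gt1. Qed.

(** On [[-1, 1]], with [u = 1 - x^2] in [[0, 1]], the derivatives are [- 6 x u^2] and
    [- 6 u^2 + 24 x^2 u]; hence 6 and [30 = 6 + 24]. *)
Lemma cutoff_bound x : [/\ `|cutoff x| <= 1, `|cutoff1 x| <= 6 & `|cutoff2 x| <= 30].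
Proof.
have [x1|x1] := leP `|x| 1; last first.
  by rewrite /cutoff /cutoff1 /cutoff2 /rho /rho1 /rho2 sqr_gt1// !mulr0 addr0 !normr0.
have x2 : x ^+ 2 <= 1 by rewrite -real_normK ?num_real// expr_le1.
have x20 := sqr_ge0 x.
have u0 : 0 <= 1 - x ^+ 2 by lra.
rewrite /cutoff /cutoff1 /cutoff2 /rho /rho1 /rho2 u0.
move: x1; rewrite ler_norml => /andP[x1 x1'].
set u := 1 - x ^+ 2 in u0 *; have u1 : u <= 1 by rewrite /u; lra.
have u2 : u ^+ 2 <= 1 by rewrite expr_le1.
have u20 := sqr_ge0 u.
split.
- by rewrite ger0_norm ?exprn_ge0// expr_le1.
- by rewrite ler_norml; nra.
- by rewrite ler_norml; nra.
Qed.

End cutoff.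

Section dominated.
Context {d : measure_display} {T : measurableType d} {R : realType}.
Variable mu : {measure set T -> \bar R}.

Lemma sqint_le (h w : T -> R) : measurable_fun setT h -> sqint mu w ->
  (forall z, `|h z| <= w z) -> sqint mu h.
Proof.
move=> mh [mw w2] hw; split=> //.
apply: (le_integrable measurableT _ _ w2) => //.
  by apply/measurable_EFinP; exact: measurable_funX.
move=> z _ /=; rewrite lee_fin !ger0_norm ?sqr_ge0// -[h z ^+ 2]real_normK ?num_real//.
by rewrite ler_pXn2r ?nnegrE//; exact: le_trans (hw z).
Qed.

Lemma L2_dominated_cvg (f : T -> R) (h_ : nat -> T -> R) (h w : T -> R) : sqint mu f ->
  (forall n, measurable_fun setT (h_ n)) -> sqint mu w ->
  (forall n z, `|h_ n z| <= w z) -> (forall z, h_ n z @[n --> \oo] --> h z) ->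
  (Rintegral mu setT (fun z => f z * h_ n z)) @[n --> \oo] -->
    Rintegral mu setT (fun z => f z * h z).
Proof.
move=> sf mh sw hw hc.
have sn n : sqint mu (h_ n) by exact: sqint_le sw (hw n).
have mhl : measurable_fun setT h.
  by apply: (measurable_fun_cvg mh) => z _; exact: hc.
have sh : sqint mu h.
  apply: (sqint_le mhl sw) => z; have hn : `|h_ n z| @[n --> \oo] --> `|h z| by apply: cvg_norm; exact: hc.
  rewrite -(cvg_lim _ hn)//; apply: limr_le; first by apply/cvg_ex; exists `|h z|.
  by near=> n; exact: hw.
have ip2 := sqint_mul_integrable sf sw.
have hcv := @dominated_cvg _ _ _ mu setT measurableT
  (fun n z => (f z * h_ n z)%:E) (fun z => (f z * h z)%:E) (fun z => `|(f z * w z)%:E|%E).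
apply: fine_cvg; rewrite fineK; last exact: integrable_fin_num (sqint_mul_integrable sf sh).
apply: hcv.
- by move=> n; apply/measurable_EFinP; exact: measurable_funM sf.1 (mh n).
- by move=> z _; apply: cvg_EFin; [by near=> n|apply: cvgM; [exact: cvg_cst|exact: hc]].
- by [].
- exact: integrable_abse.
- move=> n z _; rewrite /= lee_fin !normrM ler_wpM2l//; apply: le_trans (hw n z) _.
  exact: ler_norm.
Unshelve. all: by end_near. Qed.

End dominated.

(** * The weak Laplacian tested against the smooth kernel *)

Section resolvent_of_laplacian.
Variables (R : realType) (alpha : R).
Hypothesis alpha0 : 0 < alpha.
Local Notation line := (measurableTypeR R).
Local Notation plane := (line * line)%type.
Local Notation pmu := (@pmu R).
Local Notation H := (L2fun pmu).
Local Notation U := (resolv alpha0 (1, 0)).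
Local Notation V := (resolv alpha0 (0, 1)).
Local Notation wk := (wker_kappa alpha0).
Local Notation wl := (wker_lker alpha0).

(** The rate is halved so that one exponential profile, times [M], dominates [lker], [kappa] and
    both derivatives of [kappa] together with their polynomial factors. *)
Let E (s : R) := expR (- (alpha / 2) * `|s|).
Let M := alpha + alpha ^+ 2 + alpha ^+ 3.

Let E0 s : 0 <= E s. Proof. exact: expR_ge0. Qed.

Let exp_le_E s : expR (- alpha * `|s|) <= E s.
Proof.
rewrite /E ler_expR; have := normr_ge0 s; have := alpha0 => h0 h1.
by have : 0 <= alpha * `|s| by [exact: mulr_ge0 (ltW h0) h1]; lra.
Qed.

Let kernel_bounds s : [/\ `|lker alpha s| <= M * E s, `|kappa alpha s| <= M * E s,
  `|kappa1 alpha s| <= M * E s & `|kappa2 alpha s| <= M * E s].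
Proof.
have aL := exp_abs_lin_le s alpha0; have e1 := exp_le_E s; have e0 := E0 s.
have x0 := expR_ge0 (- alpha * `|s|); have s0 : 0 <= alpha * `|s| by rewrite mulr_ge0// ltW.
rewrite -/(E s) in aL.
have q1 := exprn_gt0 2 alpha0; have q2 := exprn_gt0 3 alpha0.
have M1 : 0 <= M - alpha by rewrite /M; lra.
have M2 : 0 <= M - alpha ^+ 2 by rewrite /M; have := alpha0; lra.
have M3 : 0 <= M - alpha ^+ 3 by rewrite /M; have := alpha0; lra.
have m1 := mulr_ge0 M1 e0; have m2 := mulr_ge0 M2 e0; have m3 := mulr_ge0 M3 e0.
have aE := mulr_ge0 (ltW alpha0) e0.
have g1 : alpha * expR (- alpha * `|s|) <= alpha * E s by rewrite ler_pM2l.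
have P k : 0 < k -> k * ((1 + alpha * `|s|) * expR (- alpha * `|s|)) <= k * (2 * E s).
  by move=> k0; rewrite ler_pM2l.
have as0 := mulr_ge0 s0 x0.
split.
- rewrite ger0_norm; last by rewrite /lker mulr_ge0// ltW// divr_gt0.
  by rewrite /lker; nra.
- rewrite ger0_norm; last first.
    by rewrite /kappa mulr_ge0// mulr_ge0 ?ltW ?divr_gt0//; lra.
  by have := P _ alpha0; rewrite /kappa; lra.
- rewrite /kappa1 2!normrM normrN (gtr0_norm (divr_gt0 q2 (ltr0n _ 4))) (ger0_norm x0).
  have := P _ q1; have -> : alpha ^+ 3 / 4 * `|s| * expR (- alpha * `|s|) =
    alpha ^+ 2 / 4 * (alpha * `|s| * expR (- alpha * `|s|)) by field.
  have := mulr_ge0 (ltW q1) x0; have := mulr_ge0 (ltW q1) e0; have := mulr_ge0 (ltW q1) as0; lra.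
- rewrite /kappa2 2!normrM (gtr0_norm (divr_gt0 q2 (ltr0n _ 4))) (ger0_norm x0).
  have h : `|alpha * `|s| - 1| <= 1 + alpha * `|s| by rewrite ler_norml; lra.
  have h2 : `|alpha * `|s| - 1| * expR (- alpha * `|s|) <= 2 * E s.
    by apply: le_trans aL; rewrite ler_wpM2r.
  have : alpha ^+ 3 * (`|alpha * `|s| - 1| * expR (- alpha * `|s|)) <= alpha ^+ 3 * (2 * E s).
    by rewrite ler_pM2l.
  have := mulr_ge0 (ltW q2) e0; lra.
Qed.

(** The factor 1 keeps the shape of arguments produced by [C2fun_affine]. *)
Let Ez (c s : R) := E (1 * s + c).

Let sqint_Ez c c' : sqint pmu (tens (Ez c) (Ez c')).
Proof.
have mE x : measurable_fun setT (Ez x).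
  have -> : Ez x = (fun s : R => E (s + x)) by apply/funext => s; rewrite /Ez mul1r.
  have [mk _ _] := wker_shift x (@wker_exp_abs R (alpha / 2) (divr_gt0 alpha0 (ltr0n _ 2))).
  exact: mk.
have wE x : wker (fun s => Ez x s ^+ 2).
  have -> : (fun s => Ez x s ^+ 2) = (fun s : R => expR (- alpha * `|s + x|)).
    apply/funext => s; rewrite /Ez mul1r /E -expRM_natl; congr expR.
    by rewrite mulr_natl; field.
  exact: (wker_shift x (wker_exp_abs alpha0)).
exact: sqint_tensor (mE c) (mE c') (wE c) (wE c').
Qed.

(** The shifted kernel truncated at scale [n + 1]; [an2] is its second derivative, as the product
    rule delivers it. *)
Let an n c (s : R) := kappa alpha (1 * s + c) * cutoff (n.+1%:R^-1 * s + 0).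
Let an2 n c (s : R) := 1 ^+ 2 * kappa2 alpha (1 * s + c) * cutoff (n.+1%:R^-1 * s + 0)
  + 2 * (1 * kappa1 alpha (1 * s + c) * (n.+1%:R^-1 * cutoff1 (n.+1%:R^-1 * s + 0)))
  + kappa alpha (1 * s + c) * (n.+1%:R^-1 ^+ 2 * cutoff2 (n.+1%:R^-1 * s + 0)).

Let an_C2 n c : exists a1, C2fun (an n c) a1 (an2 n c).
Proof.
eexists; exact: C2fun_mul (C2fun_affine 1 c (C2fun_kappa alpha))
  (C2fun_affine n.+1%:R^-1 0 (C2fun_cutoff R)).
Qed.

Let an_support n c s : n.+1%:R < `|s| -> an n c s = 0.
Proof.
move=> h; rewrite /an cutoff_out ?mulr0// addr0 normrM ger0_norm ?invr_ge0//.
by rewrite ltr_pdivlMl// mulr1.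
Qed.

Let invn_le1 n : 0 <= (n.+1%:R^-1 : R) <= 1.
Proof. by rewrite invr_ge0 ler0n/= invf_le1// ler1n. Qed.

Let an_le n c s : `|an n c s| <= M * Ez c s.
Proof.
have [_ h _ _] := kernel_bounds (1 * s + c).
have [k _ _] := cutoff_bound (n.+1%:R^-1 * s + 0).
by rewrite /an normrM; apply: le_trans h; rewrite ler_piMr.
Qed.

(** [43 = 1 + 2 * 6 + 30], from the three terms of the product rule and the bounds on the
    cut-off. *)
Let an2_le n c s : `|an2 n c s| <= 43 * (M * Ez c s).
Proof.
have [_ h h1 h2] := kernel_bounds (1 * s + c).
have [k k1 k2] := cutoff_bound (n.+1%:R^-1 * s + 0).
have /andP[i0 i1] := invn_le1 n.
rewrite /an2 -/(Ez c s) in h h1 h2 *; move: (M * Ez c s) h h1 h2 => m h h1 h2.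
have m0 : 0 <= m by exact: le_trans h.
have p1 x y B : `|x| <= m -> `|y| <= B -> `|x * y| <= m * B.
  by move=> hx hy; rewrite normrM ler_pM.
have q1 : `|n.+1%:R^-1 * cutoff1 (n.+1%:R^-1 * s + 0)| <= 6.
  by rewrite normrM ger0_norm//; apply: le_trans k1; rewrite ler_piMl.
have q2 : `|n.+1%:R^-1 ^+ 2 * cutoff2 (n.+1%:R^-1 * s + 0)| <= 30.
  rewrite normrM ger0_norm ?sqr_ge0//; apply: le_trans k2; rewrite ler_piMl//.
  by rewrite expr_le1.
rewrite expr1n [1 * kappa2 _ _]mul1r [1 * kappa1 _ _]mul1r.
have r1 := p1 _ _ _ h2 k; have r2 := p1 _ _ _ h1 q1; have r3 := p1 _ _ _ h q2.
have tri (x y z : R) : `|x| <= m * 1 -> `|y| <= m * 6 -> `|z| <= m * 30 -> `|x + 2 * y + z| <= 43 * m.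
  by rewrite !ler_norml => /andP[? ?] /andP[? ?] /andP[? ?]; lra.
exact: tri.
Qed.

Let scale_cvg0 s : (n.+1%:R^-1 * s + 0 : R) @[n --> \oo] --> (0 : R).
Proof.
have h : (n.+1%:R^-1 * s + 0 : R) @[n --> \oo] --> (0 * s + 0 : R).
  by apply: cvgD; [apply: cvgM; [exact: cvg_harmonic|exact: cvg_cst]|exact: cvg_cst].
by move: h; rewrite mul0r add0r.
Qed.

Let cutoff_cvg (f : R -> R) s : continuous f -> f (n.+1%:R^-1 * s + 0) @[n --> \oo] --> f 0.
Proof.
move=> cf; apply: (@cvg_comp _ _ _ (fun n => n.+1%:R^-1 * s + 0) f \oo (nbhs (0 : R))).
  exact: scale_cvg0.
exact: cf.
Qed.

Let an_cvg c s : an n c s @[n --> \oo] --> kappa alpha (1 * s + c).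
Proof.
have [d0 d1 _] := C2fun_cutoff R.
have -> : kappa alpha (1 * s + c) = kappa alpha (1 * s + c) * cutoff 0 by rewrite cutoff0 mulr1.
apply: cvgM; first exact: cvg_cst.
exact: cutoff_cvg (is_derive1_continuous d0).
Qed.

Let an2_cvg c s : an2 n c s @[n --> \oo] --> kappa2 alpha (1 * s + c).
Proof.
have [d0 d1 c2] := C2fun_cutoff R.
have -> : kappa2 alpha (1 * s + c) = 1 ^+ 2 * kappa2 alpha (1 * s + c) * cutoff 0
  + 2 * (1 * kappa1 alpha (1 * s + c) * (0 * cutoff1 0))
  + kappa alpha (1 * s + c) * (0 ^+ 2 * cutoff2 0).
  by rewrite cutoff0; ring.
have i0 : n.+1%:R^-1 @[n --> \oo] --> (0 : R) by exact: cvg_harmonic.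
apply: cvgD; first apply: cvgD.
- apply: cvgM; first exact: cvg_cst.
  exact: cutoff_cvg (is_derive1_continuous d0).
- apply: cvgM; first exact: cvg_cst.
  apply: cvgM; first exact: cvg_cst.
  apply: cvgM; first exact: i0.
  exact: cutoff_cvg (is_derive1_continuous d1).
- apply: cvgM; first exact: cvg_cst.
  apply: cvgM; last exact: cutoff_cvg.
  by apply: cvgM; exact: i0.
Qed.

Let tens_le (f g F G : R -> R) z : (forall s, `|f s| <= F s) -> (forall s, `|g s| <= G s) ->
  `|tens f g z| <= tens F G z.
Proof. by move=> h h'; rewrite /tens normrM ler_pM. Qed.

Let tens_cvg (f g : nat -> R -> R) (F G : R -> R) z :
  (forall s, f n s @[n --> \oo] --> F s) -> (forall s, g n s @[n --> \oo] --> G s) ->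
  tens (f n) (g n) z @[n --> \oo] --> tens F G z.
Proof. by move=> h h'; apply: cvgM. Qed.

Let kern (k k' : R -> R) (z y : R * R) : R :=
  tens (fun s => k (1 * s + - z.1)) (fun s => k' (1 * s + - z.2)) y.

(** The kernel centred at [z] is C^2 but not compactly supported, so the weak Laplacian is tested
    against its truncations and the limit is taken by dominated convergence. The constant 86 is
    twice 43, one for each second derivative. *)
Let weak_lap_kernel (psi g : H) (z : R * R) : weak_lap psi g ->
  Rintegral pmu setT (fun y => psi y * (kern (kappa2 alpha) (kappa alpha) z y
                                      + kern (kappa alpha) (kappa2 alpha) z y)) =
  Rintegral pmu setT (fun y => g y * kern (kappa alpha) (kappa alpha) z y).
Proof.
move=> wl_pg.
pose A n := an n (- z.1); pose B n := an n (- z.2).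
pose A2 n := an2 n (- z.1); pose B2 n := an2 n (- z.2).
have sW := sqint_Ez (- z.1) (- z.2).
have M0 : 0 <= M by have := exprn_gt0 2 alpha0; have := exprn_gt0 3 alpha0; have := alpha0; rewrite /M; lra.
have cA n c : continuous (an n c).
  by have [a1 [h _ _]] := an_C2 n c; exact: is_derive1_continuous h.
have cA2 n c : continuous (an2 n c) by have [a1 [_ _ h]] := an_C2 n c.
have TW n : test_fun (tens (A n) (B n)).
  have [a1 Ca] := an_C2 n (- z.1); have [b1 Cb] := an_C2 n (- z.2).
  exact: (test_fun_tens Ca Cb (@an_support n _) (@an_support n _)).
have lE n y : lap (tens (A n) (B n)) y = tens (A2 n) (B n) y + tens (A n) (B2 n) y.
  have [a1 Ca] := an_C2 n (- z.1); have [b1 Cb] := an_C2 n (- z.2).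
  exact: lap_tens Ca Cb.
have c1 := @L2_dominated_cvg _ _ _ pmu psi
  (fun n y => tens (A2 n) (B n) y + tens (A n) (B2 n) y)
  (fun y => kern (kappa2 alpha) (kappa alpha) z y + kern (kappa alpha) (kappa2 alpha) z y)
  (fun y => 86 * M ^+ 2 * tens (Ez (- z.1)) (Ez (- z.2)) y) (L2funP psi).
have c2 := @L2_dominated_cvg _ _ _ pmu g (fun n y => tens (A n) (B n) y)
  (fun y => kern (kappa alpha) (kappa alpha) z y)
  (fun y => M ^+ 2 * tens (Ez (- z.1)) (Ez (- z.2)) y) (L2funP g).
have {}c1 := c1 _ (sqintZ _ sW) _ _; have {}c2 := c2 _ (sqintZ _ sW) _ _.
have {}c1 : Rintegral pmu setT (fun y => psi y * (tens (A2 n) (B n) y + tens (A n) (B2 n) y)) @[n --> \oo]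
   --> Rintegral pmu setT (fun y => psi y * (kern (kappa2 alpha) (kappa alpha) z y
                                      + kern (kappa alpha) (kappa2 alpha) z y)).
  apply: c1.
  - move=> n; apply: continuous_plane_measurable => y.
    by apply: cvgD; apply: continuous_tens; (exact: cA2 || exact: cA).
  - move=> n y; apply: le_trans (ler_normD _ _) _.
    have h1 := @tens_le _ _ _ _ y (@an2_le n (- z.1)) (@an_le n (- z.2)).
    have h2 := @tens_le _ _ _ _ y (@an_le n (- z.1)) (@an2_le n (- z.2)).
    apply: le_trans (lerD h1 h2) _; rewrite /tens le_eqVlt; apply/orP; left; apply/eqP; ring.
  - by move=> y; apply: cvgD; apply: tens_cvg => s; [exact: an2_cvg|exact: an_cvg|exact: an_cvg|exact: an2_cvg].
have {}c2 : Rintegral pmu setT (fun y => g y * (tens (A n) (B n) y)) @[n --> \oo]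
   --> Rintegral pmu setT (fun y => g y * kern (kappa alpha) (kappa alpha) z y).
  apply: c2.
  - by move=> n; apply: continuous_plane_measurable; apply: continuous_tens; exact: cA.
  - move=> n y; have h1 := @tens_le _ _ _ _ y (@an_le n (- z.1)) (@an_le n (- z.2)).
    apply: le_trans h1 _; rewrite /tens le_eqVlt; apply/orP; left; apply/eqP; ring.
  - by move=> y; apply: tens_cvg => s; exact: an_cvg.
have e : (fun n => Rintegral pmu setT (fun y => psi y * (tens (A2 n) (B n) y + tens (A n) (B2 n) y)))
   = (fun n => Rintegral pmu setT (fun y => g y * (tens (A n) (B n) y))).
  apply/funext => n; have h := wl_pg _ (TW n); apply: etrans h.
  by apply: eq_Rintegral => y _; rewrite lE.
rewrite e in c1.
by rewrite -(cvg_lim _ c1)// -(cvg_lim _ c2).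
Qed.

Let tensorop_kern k k' (w : wker k) (w' : wker k') (f : H) (z : R * R) :
  tensorop w w' f z = Rintegral pmu setT (fun y => f y * kern k k' z y).
Proof.
have [mk _ _] := w; have [mk' _ _] := w'; have [mf _] := L2funP f.
rewrite tensoropE.
have m : measurable_fun [set: plane] (fun y : plane => f y * kern k k' z y).
  apply: measurable_funM => //.
  have m1 c (h : R -> R) : measurable_fun setT h -> measurable_fun setT (fun s : R => h (1 * s + c)).
    move=> mh; under eq_fun do rewrite mul1r.
    exact: measurableT_comp mh (measurable_line_shift c).
  exact: measurable_tensor (m1 _ _ mk) (m1 _ _ mk').
rewrite -(Rintegral_preserved (measurable_plane_shift z) (leb2_shift z) m).
apply: eq_Rintegral => p _; rewrite [z + p]addrC mulrC /kern /tens /=.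
by rewrite !mul1r !addrK.
Qed.

Let sqint_kern (k k' : R -> R) (z : R * R) : measurable_fun setT k -> measurable_fun setT k' ->
  (forall s, `|k s| <= M * E s) -> (forall s, `|k' s| <= M * E s) -> sqint pmu (kern k k' z).
Proof.
move=> mk mk' kE kE'.
apply: (sqint_le _ (sqintZ (M ^+ 2) (sqint_Ez (- z.1) (- z.2)))).
  have m1 c (h : R -> R) : measurable_fun setT h -> measurable_fun setT (fun s : R => h (1 * s + c)).
    move=> mh; under eq_fun do rewrite mul1r.
    exact: measurableT_comp mh (measurable_line_shift c).
  exact: measurable_tensor (m1 _ _ mk) (m1 _ _ mk').
move=> y; have h := @tens_le _ _ (fun s => M * Ez (- z.1) s) (fun s => M * Ez (- z.2) s) y
  (fun s => kE (1 * s + - z.1)) (fun s => kE' (1 * s + - z.2)).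
apply: le_trans h _; rewrite /tens le_eqVlt; apply/orP; left; apply/eqP; ring.
Qed.

Let weak_lap_tensorop (psi g : H) z : weak_lap psi g ->
  tensorop wk wk g z = alpha ^+ 2 * (2 * tensorop wk wk psi z - tensorop wl wk psi z
                                     - tensorop wk wl psi z).
Proof.
move=> h; have := weak_lap_kernel z h; rewrite !tensorop_kern => <-.
have [mk _ _] := wk; have [ml _ _] := wl.
have bk s : `|kappa alpha s| <= M * E s by have [] := kernel_bounds s.
have bl s : `|lker alpha s| <= M * E s by have [] := kernel_bounds s.
pose t11 : H := toL2 (sqint_kern z mk mk bk bk).
pose t01 : H := toL2 (sqint_kern z ml mk bl bk).
pose t10 : H := toL2 (sqint_kern z mk ml bk bl).
have := ipC psi (alpha ^+ 2 *: (2 *: t11 + (- 1) *: t01 + (- 1) *: t10)).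
rewrite ipZl !ipDl !ipZl !(ipC _ psi) => e.
have -> : 2 * ip psi t11 - ip psi t01 - ip psi t10 = 2 * ip psi t11 + -1 * ip psi t01 + -1 * ip psi t10 by ring.
rewrite -e; apply: eq_Rintegral => y _.
congr (_ * _).
have -> : (alpha ^+ 2 *: (2 *: t11 + (- 1) *: t01 + (- 1) *: t10) : H) y =
  alpha ^+ 2 * (2 * kern (kappa alpha) (kappa alpha) z y
    + (- 1) * kern (lker alpha) (kappa alpha) z y
    + (- 1) * kern (kappa alpha) (lker alpha) z y) by [].
by rewrite /kern /tens !kappa2E; ring.
Qed.

(** In symbols [p^2 + q^2 = alpha^2 (1/u + 1/v - 2)], and the factor [u^2 v^2] clears the
    denominators. *)
Lemma weak_lap_resolv (psi g y : H) : weak_lap psi g ->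
  ip g (mon U V 2 2 y) = alpha ^+ 2 * (2 * ip psi (mon U V 2 2 y)
    - ip psi (mon U V 1 2 y) - ip psi (mon U V 2 1 y)).
Proof.
move=> wlp.
have UA := resolv_adj alpha0 (1, 0); have VA := resolv_adj alpha0 (0, 1).
have adj i j (f : H) : ip f (mon U V i j y) = ip (mon U V i j f) y.
  exact: esym (mon_adj UA VA (resolv_comm alpha0 (1, 0) (0, 1)) i j f y).
have kk (f : H) : ip (tensorop wk wk f) y = ip f (mon U V 2 2 y).
  rewrite ip_tensorop -resolv2_kappa UA UA -resolv2_kappa adj /mon /=.
  by rewrite -UA -UA.
have lk (f : H) : ip (tensorop wl wk f) y = ip f (mon U V 1 2 y).
  by rewrite ip_tensorop -/(resolv alpha0 (1, 0) _) UA -resolv2_kappa adj -UA.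
have kl (f : H) : ip (tensorop wk wl f) y = ip f (mon U V 2 1 y).
  by rewrite ip_tensorop -resolv2_kappa adj.
rewrite -!kk -lk -kl.
have -> : alpha ^+ 2 * (2 * ip (tensorop wk wk psi) y - ip (tensorop wl wk psi) y -
     ip (tensorop wk wl psi) y) = ip (alpha ^+ 2 *: (2 *: tensorop wk wk psi
       + (- 1) *: tensorop wl wk psi + (- 1) *: tensorop wk wl psi)) y.
  rewrite ipZl !ipDl !ipZl.
  generalize (ip (tensorop wk wk psi) y) (ip (tensorop wl wk psi) y) (ip (tensorop wk wl psi) y).
  by move=> x1 x2 x3; ring.
apply: eq_Rintegral => z _; congr (_ * _); rewrite (weak_lap_tensorop z wlp).
have -> : (alpha ^+ 2 *: (2 *: tensorop wk wk psi + (- 1) *: tensorop wl wk psi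
    + (- 1) *: tensorop wk wl psi) : H) z = alpha ^+ 2 * (2 * tensorop wk wk psi z
    + (- 1) * tensorop wl wk psi z + (- 1) * tensorop wk wl psi z) by [].
generalize (tensorop wk wk psi z) (tensorop wl wk psi z) (tensorop wk wl psi z).
by move=> x1 x2 x3; ring.
Qed.

Lemma conv_phi_ker (f : H) z : conv (phi_ker alpha) f z = tensorop wl wl f z.
Proof.
rewrite tensorop_kern; apply: eq_Rintegral => y _.
rewrite /phi_ker /kern /tens /lker /= !mul1r (distrC z.1) (distrC z.2).
by field.
Qed.

Lemma ip_conv (f y : H) : ip (tensorop wl wl f) y = ip f (mon U V 1 1 y).
Proof.
rewrite ip_tensorop -/(resolv alpha0 (0, 1) _) -/(resolv alpha0 (1, 0) _).
by rewrite resolv_comm (resolv_adj alpha0) (resolv_adj alpha0).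
Qed.

End resolvent_of_laplacian.

(** * The operator as a closed relation, and stability *)

Section weak_formulation.
Variables (R : realType) (d c b alpha lam : R).
Hypotheses (d0 : 0 < d) (alpha0 : 0 < alpha).
Local Notation line := (measurableTypeR R).
Local Notation plane := (line * line)%type.
Local Notation pmu := (@pmu R).
Local Notation H := (L2fun pmu).
Local Notation U := (resolv alpha0 (1, 0)).
Local Notation V := (resolv alpha0 (0, 1)).
Local Notation wl := (wker_lker alpha0).
Local Notation phi := (phi_ker alpha).

Let K : H -> H := tensorop wl wl.

Let mon_self i j (f y : H) : ip (mon U V i j f) y = ip f (mon U V i j y).
Proof.
exact: (mon_adj (resolv_adj alpha0 (1, 0)) (resolv_adj alpha0 (0, 1)) (resolv_comm alpha0 (1, 0) (0, 1))).
Qed.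

Let mon_comp i j k l (f y : H) :
  ip f (mon U V i j (mon U V k l y)) = ip f (mon U V (i + k) (j + l) y).
Proof.
exact: (mon_mon (@ipC _ _ _ pmu) (resolv_adj alpha0 (1, 0)) (resolv_adj alpha0 (0, 1))
  (resolv_comm alpha0 (1, 0) (0, 1))).
Qed.

Let K_adj (f g : H) : ip (K f) g = ip f (K g).
Proof. by rewrite /K ip_conv [RHS]ipC ip_conv [RHS]ipC mon_self. Qed.

Lemma test_fun_sqint (chi : R * R -> R) : test_fun chi -> sqint pmu chi.
Proof.
move=> tchi; have [_ [_ [_ [r hr]]]] := tchi.
have cc := C2plane_continuous (test_fun_C2 tchi).
split; first exact: continuous_plane_measurable.
apply: (@compactly_supported_integrable R (fun z => chi z ^+ 2) r).
  by move=> z; apply: cvgM; exact: cc.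
by move=> z hz; rewrite hr// expr0n.
Qed.

Lemma lap_test_fun_sqint (chi : R * R -> R) : test_fun chi -> sqint pmu (lap chi).
Proof.
move=> tchi; have [_ [_ [_ [r hr]]]] := tchi.
have cc := C2plane_lap (test_fun_C2 tchi).
split; first exact: continuous_plane_measurable.
apply: (@compactly_supported_integrable R (fun z => lap chi z ^+ 2) r).
  by move=> z; apply: cvgM; exact: cc.
move=> z hz; rewrite /lap.
by rewrite !(derive_outside _ (derive_outside _ hr) hz) addr0 expr0n.
Qed.

Let L2_sqint (f : R * R -> R) : L2 f -> sqint pmu f. Proof. by []. Qed.

Let tst chi (t : test_fun chi) : H := toL2 (test_fun_sqint t).
Let ltst chi (t : test_fun chi) : H := toL2 (lap_test_fun_sqint t).
(** [L - lam] applied to a test function. *)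
Let B chi (t : test_fun chi) : H :=
  (- d) *: ltst t + (c ^+ 2) *: K (tst t) + (- (b + lam)) *: tst t.

Let comb3 p q r (x y w : H) z : (p *: x + q *: y + r *: w) z = p * x z + q * y z + r * w z.
Proof. by []. Qed.

Let comb2 p (x y : H) z : (p *: x + y) z = p * x z + y z.
Proof. by []. Qed.

Let ipE := (@ipDl _ _ _ pmu, @ipZl _ _ _ pmu).

Let B_ip chi (t : test_fun chi) f : ip f (B t) =
  - d * ip f (ltst t) + c ^+ 2 * ip f (K (tst t)) - (b + lam) * ip f (tst t).
Proof. by rewrite ipC /B !ipE (ipC (ltst t)) (ipC (K _)) (ipC (tst t)); ring. Qed.

(* The equation (L - lam) psi = f tested against test functions. *)
Definition weak_sol (psi f : H) :=
  forall chi (t : test_fun chi), ip psi (B t) = ip f (tst t).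

(** The Laplacian of [psi] as dictated by [(L - lam) psi = f], solved for it using [d > 0]. *)
Let lapl (psi f : H) : H := d^-1 *: ((c ^+ 2) *: K psi + (- (b + lam)) *: psi + (-1) *: f).

Let lapl_ip psi f y :
  ip f y = - d * ip (lapl psi f) y + c ^+ 2 * ip (K psi) y - (b + lam) * ip psi y.
Proof.
rewrite !ipE mulNr mulrA divff ?lt0r_neq0// mul1r; ring.
Qed.

Let weak_sol_lap psi f : weak_sol psi f -> weak_lap psi (lapl psi f).
Proof.
move=> w chi t; have := w _ t; rewrite B_ip (lapl_ip psi f) -K_adj => e.
have {}e : d * ip psi (ltst t) = d * ip (lapl psi f) (tst t) by lra.
by have := mulfI (lt0r_neq0 d0) e.
Qed.

(** Membership in [H2] only asks for a weak Laplacian in L^2, and the equation itself supplies one.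
    So [weak_sol] is the graph of [L - lam], in a form that is visibly closed: each condition pairs
    [psi] and [f] with fixed vectors. *)
Lemma weak_sol_Lop (psi f : H) :
  Lop_eq d c b phi psi (fun z => f z + lam * psi z) <-> weak_sol psi f.
Proof.
split.
- move=> [_ [g [lg [wlg e]]]] chi t.
  pose gH : H := toL2 (L2_sqint lg).
  have -> : ip f (tst t) = ip ((- d) *: gH + (c ^+ 2) *: K psi + (- (b + lam)) *: psi) (tst t).
    apply: ip_ae_eq; apply: (@filterS _ _ (ae_filter_ringOfSetsType pmu)) e => z.
    rewrite conv_phi_ker comb3 => h; apply: (addIr (lam * psi z)); rewrite h.
    have -> : gH z = g z by [].
    by rewrite /K; ring.
  rewrite B_ip !ipE K_adj mulNr mulNr mulNr; congr (- (d * _) + _ - _).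
  exact: wlg.
- move=> w; have wg := weak_sol_lap w; split.
    by split; [exact: (L2funP psi)|exists (lapl psi f); split=> //; exact: (L2funP (lapl psi f))].
  exists (lapl psi f); split; first exact: (L2funP (lapl psi f)).
  split=> //; apply: aeW => z; rewrite conv_phi_ker.
  have -> : lapl psi f z = d^-1 * (c ^+ 2 * K psi z + (- (b + lam)) * psi z + (-1) * f z) by [].
  by rewrite /K; field; exact: lt0r_neq0.
Qed.

Lemma weak_sol_lin a x y x' y' : weak_sol x y -> weak_sol x' y' ->
  weak_sol (a *: x + x') (a *: y + y').
Proof. by move=> h h' chi t; rewrite !ipE h h'. Qed.

Lemma weak_sol_congr x y y' : ip (y - y') (y - y') = 0 -> weak_sol x y -> weak_sol x y'.
Proof.
move=> e h chi t; rewrite h.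
have := @ip_null _ _ _ (@ipC _ _ _ pmu) (@ipDl _ _ _ pmu) (@ipZl _ _ _ pmu)
  (@ip_ge0 _ _ _ pmu) (y - y') (tst t) e.
by rewrite -scaleN1r !ipE; lra.
Qed.

(** [f + lam *: psi] stands for [L psi], so the claim is [L >= 0]; [step] is the weak form of
    [U^2 V^2 L = U V N]. *)
Lemma weak_sol_form_ge0 x t : 0 < t -> 0 < x -> x <= d * alpha ^+ 2 -> c ^+ 2 = x * t ^+ 3 ->
  b = 3 * x * t - 2 * x -> forall psi f, weak_sol psi f -> - lam * ip psi psi <= ip f psi.
Proof.
move=> t0 x0 xX cE bE psi f w; have wg := weak_sol_lap w.
suff : 0 <= ip (f + lam *: psi) psi by rewrite !ipE; lra.
have step (y : H) : ip (f + lam *: psi) (mon U V 2 2 y) =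
    d * alpha ^+ 2 * (ip psi (mon U V 2 1 y) + ip psi (mon U V 1 2 y) - 2 * ip psi (mon U V 2 2 y))
    + x * t ^+ 3 * ip psi (mon U V 3 3 y) - (3 * x * t - 2 * x) * ip psi (mon U V 2 2 y).
  have e : ip psi (mon U V 1 1 (mon U V 2 2 y)) = ip psi (mon U V 3 3 y) := mon_comp 1 1 2 2 psi y.
  have e1 : ip (lapl psi f) (mon U V 2 2 y) = alpha ^+ 2 * (2 * ip psi (mon U V 2 2 y)
    - ip psi (mon U V 1 2 y) - ip psi (mon U V 2 1 y)) := weak_lap_resolv alpha0 y wg.
  have e2 : ip f (mon U V 2 2 y) = - d * ip (lapl psi f) (mon U V 2 2 y)
    + c ^+ 2 * ip (K psi) (mon U V 2 2 y) - (b + lam) * ip psi (mon U V 2 2 y) := lapl_ip psi f _.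
  have e3 : ip (K psi) (mon U V 2 2 y) = ip psi (mon U V 1 1 (mon U V 2 2 y)) := ip_conv alpha0 psi _.
  have e4 : ip (f + lam *: psi) (mon U V 2 2 y) =
    ip f (mon U V 2 2 y) + lam * ip psi (mon U V 2 2 y) by rewrite ipDl ipZl.
  move: e e1 e2 e3 e4; rewrite -cE -bE.
  generalize (ip psi (mon U V 3 3 y)) (ip psi (mon U V 2 2 y)) (ip psi (mon U V 1 2 y))
    (ip psi (mon U V 2 1 y)) (ip (f + lam *: psi) (mon U V 2 2 y)) (ip f (mon U V 2 2 y))
    (ip (K psi) (mon U V 2 2 y)) (ip psi (mon U V 1 1 (mon U V 2 2 y)))
    (ip (lapl psi f) (mon U V 2 2 y)).
  move=> m33 m22 m12 m21 q1 q2 q3 q4 q5 -> e1 -> -> ->.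
  rewrite e1; ring.
apply: (@spectral_form_ge0 R _ _ (@ipC _ _ _ pmu) (@ipDl _ _ _ pmu) (@ipZl _ _ _ pmu)
  (@ip_ge0 _ _ _ pmu) (@L2_complete _ _ _ pmu) U V (proot alpha0 (1, 0)) (proot alpha0 (0, 1))
  (resolv_adj alpha0 _) (resolv_adj alpha0 _) (resolv_comm alpha0 _ _)
  (resolv_proot alpha0 _) (resolv_proot alpha0 _)
  (proot_resolv_comm alpha0 _ _) (proot_resolv_comm alpha0 _ _)
  (proot_resolv_comm alpha0 _ _) (proot_resolv_comm alpha0 _ _)
  (resolv_le alpha0 _) (resolv_le alpha0 _) t t0 x (d * alpha ^+ 2) x0 xX
  (@resolv2_inj R alpha alpha0)) => y.
exact: (step y).
Qed.

(** The lower bound gives uniqueness and, by Cauchy-Schwarz, an inverse of norm at most [1/D];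
    together with closedness and symmetry it also gives surjectivity. *)
Lemma weak_sol_resolvent D : 0 < D ->
  (forall psi f, weak_sol psi f -> D * ip psi psi <= ip f psi) ->
  in_resolvent d c b phi lam.
Proof.
move=> D0 below; split; [|split].
- move=> h lh; pose hH : H := toL2 (L2_sqint lh).
  have [x [y [w e]]] : exists x y, weak_sol x y /\ ip (y - hH) (y - hH) = 0.
    apply: (@closed_relation_surjective R _ _ (@ipC _ _ _ pmu) (@ipDl _ _ _ pmu)
      (@ipZl _ _ _ pmu) (@ip_ge0 _ _ _ pmu) (@L2_complete _ _ _ pmu) weak_sol D D0).
    + by move=> chi t; rewrite -(scale0r (0 : H)) !ipZl !mul0r.
    + exact: weak_sol_lin.
    + move=> u v x y w ux vy chi t; apply/eqP/contraT => ne.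
      have e0 : 0 < `|ip x (B t) - ip y (tst t)| by rewrite normr_gt0 subr_eq0.
      have cw := @ip_cvg_weak _ _ _ (@ipC _ _ _ pmu) (@ipDl _ _ _ pmu) (@ipZl _ _ _ pmu)
        (@ip_ge0 _ _ _ pmu).
      have [N hN] := cw u x (B t) _ ux (divr_gt0 e0 (ltr0n _ 2)).
      have [N' hN'] := cw v y (tst t) _ vy (divr_gt0 e0 (ltr0n _ 2)).
      have := hN _ (leq_maxl N N'); have := hN' _ (leq_maxr N N').
      rewrite w; move: (ip (v _) _) (ip x _) (ip y _) {e0 ne hN hN'} => p q r h1 h2.
      have := ler_normD (q - p) (p - r); rewrite addrA subrK (distrC q p); lra.
    + exact: below.
    (* By Green's identity each test function lies in the relation with image [B t]. A vector
       orthogonal to the range is thus orthogonal to every [B t], which is the weak equation with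
       right-hand side 0. *)
    + move=> r hr; exists 0; split; last by rewrite -(scale0r (0 : H)) ipZl mul0r.
      move=> chi t; rewrite -(scale0r (0 : H)) ipZl mul0r; apply: (hr (tst t)) => chi' t'.
      have g : ip (tst t) (ltst t') = ip (ltst t) (tst t') := green (test_fun_C2 t) t'.
      have k : ip (tst t) (K (tst t')) = ip (tst t') (K (tst t)) by rewrite -K_adj ipC.
      by rewrite [RHS]ipC !B_ip g (ipC (ltst t)) k (ipC (tst t) (tst t')).
  by exists x; exact: ((weak_sol_Lop x hH).2 (weak_sol_congr e w)).
- move=> p1 p2 h lh w1 w2.
  have [[l1 _] _] := w1; have [[l2 _] _] := w2.
  pose P1 : H := toL2 (L2_sqint l1); pose P2 : H := toL2 (L2_sqint l2); pose hH : H := toL2 (L2_sqint lh).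
  have {}w1 : weak_sol P1 hH := (weak_sol_Lop P1 hH).1 w1.
  have {}w2 : weak_sol P2 hH := (weak_sol_Lop P2 hH).1 w2.
  have := below _ _ (weak_sol_lin (-1) w2 w1).
  rewrite [ip (_ *: hH + _) _]ipDl ipZl mulN1r addNr => le0.
  have e0 : ip (-1 *: P2 + P1) (-1 *: P2 + P1) = 0.
    apply/eqP; rewrite eq_le ip_ge0 andbT.
    by move: le0; rewrite pmulr_rle0.
  apply: (@filterS _ _ (ae_filter_ringOfSetsType pmu)) (ip_eq0 e0) => z.
  by rewrite comb2 mulN1r addrC => /eqP; rewrite subr_eq0 => /eqP.
- exists D^-1; split; first by rewrite invr_gt0.
  move=> p h lh w; have [[l1 _] _] := w.
  pose P1 : H := toL2 (L2_sqint l1); pose hH : H := toL2 (L2_sqint lh).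
  have {}w : weak_sol P1 hH := (weak_sol_Lop P1 hH).1 w.
  have le := below _ _ w.
  have cs := @ip_CS _ _ _ (@ipC _ _ _ pmu) (@ipDl _ _ _ pmu) (@ipZl _ _ _ pmu)
    (@ip_ge0 _ _ _ pmu) hH P1.
  have -> : L2norm p = Num.sqrt (ip P1 P1) by [].
  have -> : L2norm h = Num.sqrt (ip hH hH) by [].
  have pp0 := ip_ge0 P1; have hh0 := ip_ge0 hH.
  move: (ip P1 P1) (ip hH hH) (ip hH P1) le cs pp0 hh0 => pp hh hp le cs pp0 hh0.
  have key : pp <= D^-1 ^+ 2 * hh.
    rewrite exprVn -ler_pdivrMl ?invr_gt0 ?exprn_gt0// invrK.
    have [->|ppn] := eqVneq pp 0; first by rewrite mulr0.
    have pp1 : 0 < pp by rewrite lt_def ppn.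
    rewrite -(ler_pM2r pp1); apply: le_trans cs.
    have -> : D ^+ 2 * pp * pp = (D * pp) ^+ 2 by ring.
    rewrite ler_pXn2r ?nnegrE//; first exact: mulr_ge0 (ltW D0) pp0.
    exact: le_trans (mulr_ge0 (ltW D0) pp0) le.
  apply: le_trans (ler_wsqrtr key) _.
  by rewrite sqrtrM ?sqr_ge0// sqrtr_sqr ger0_norm// invr_ge0 ltW.
Qed.

End weak_formulation.

Lemma stable_of_tangency (R : realType) (d c b alpha x t : R) : 0 < d -> 0 < alpha -> 0 < t ->
  0 < x -> x <= d * alpha ^+ 2 -> c ^+ 2 = x * t ^+ 3 -> b = 3 * x * t - 2 * x ->
  spectrally_stable d c b (phi_ker alpha).
Proof.
move=> d0 alpha0 t0 x0 xX cE bE lam; rewrite leNgt => nres; apply/negP => lam0; apply: nres.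
apply: (@weak_sol_resolvent R d c b alpha lam d0 alpha0 (- lam)); first by rewrite oppr_gt0.
exact: (weak_sol_form_ge0 d0 t0 x0 xX cE bE).
Qed.

(** * The one-dimensional resolvent identity on bounded C^2 functions *)

Section resolvent_identity.
Variables (R : realType) (alpha : R).
Hypothesis alpha0 : 0 < alpha.
Local Notation lam := (@lebesgue_measure R).
Local Notation pdf := (exponential_pdf alpha).

Let ipdf : lam.-integrable setT (EFin \o pdf).
Proof. by have [_ _] := wker_pdf alpha0. Qed.

Let pdf_mul (f : R -> R) (M : R) : continuous f -> (forall x, `|f x| <= M) ->
  lam.-integrable setT (EFin \o (fun s => pdf s * f s)).
Proof.
by move=> cf fM; apply: (integrable_mul_bounded ipdf _ fM); exact: continuous_measurable_fun.
Qed.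

Let is_derive_exp (s : R) :
  is_derive s 1 (fun s : R => expR (- alpha * s)) (- alpha * expR (- alpha * s)).
Proof.
have dl : is_derive s 1 (fun s : R => - alpha * s) (- alpha).
  have := is_deriveZ (- alpha) (is_derive_id s 1) => h.
  by apply: is_derive_eq h _; rewrite /GRing.scale/= mulr1.
have := @is_derive1_comp _ expR (fun s : R => - alpha * s) s _ _ (is_derive_expR _) dl => h.
by apply: is_derive_eq h _; rewrite mulrC.
Qed.

Lemma Rintegral_pdf_derive (f f' : R -> R) (M : R) : (forall x : R, is_derive x 1 f (f' x)) ->
  continuous f' -> (forall x, `|f x| <= M) -> (forall x, `|f' x| <= M) ->
  Rintegral lam setT (fun s => pdf s * f' s) =
  alpha * (Rintegral lam setT (fun s => pdf s * f s) - f 0).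
Proof.
move=> df cf' fM f'M; have cf := is_derive1_continuous df.
(* Integration by parts on the half-line through a fundamental theorem for nonnegative integrands:
   adding [N] makes [g] nonnegative. Since the density has mass one, [N] cancels against the
   boundary term at the end. *)
pose N := M + alpha * M.
have M0 : 0 <= M by exact: le_trans (fM 0).
pose g (s : R) : R := alpha * expR (- alpha * s) * (f' s - alpha * f s + N).
pose F (s : R) : R := alpha * expR (- alpha * s) * (f s - N / alpha).
have an0 := lt0r_neq0 alpha0.
have aM : forall s, `|alpha * f s| <= alpha * M.
  by move=> s; rewrite normrM gtr0_norm// ler_pM2l.
have g0 s : 0 <= g s.
  rewrite /g mulr_ge0// ?mulr_ge0 ?expR_ge0 ?(ltW alpha0)//.
  have := f'M s; have := aM s; rewrite !ler_norml /N => /andP[? ?] /andP[? ?]; lra.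
have dF (s : R) : is_derive s 1 F (g s).
  have hB : is_derive s 1 (fun s => f s - N / alpha) (f' s).
    have := is_deriveB (df s) (is_derive_cst (N / alpha) s 1) => h.
    by apply: is_derive_eq h _; rewrite subr0.
  have hA : is_derive s 1 (fun s : R => alpha * expR (- alpha * s)) (alpha * (- alpha * expR (- alpha * s))).
    exact: (is_deriveZ alpha (is_derive_exp s)).
  have := is_deriveM hA hB => h.
  by apply: is_derive_eq h _; rewrite /g /GRing.scale /=; field.
have cg : continuous g.
  move=> s; apply: cvgM.
    apply: cvgM; first exact: cvg_cst.
    exact: (is_derive1_continuous is_derive_exp).
  apply: cvgD; last exact: cvg_cst.
  by apply: cvgB; [exact: cf'|apply: cvgM; [exact: cvg_cst|exact: cf]].
have F0 : F s @[s --> +oo] --> (0 : R).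
  have K0 : 0 <= M + N / alpha.
    by rewrite addr_ge0// divr_ge0 ?(ltW alpha0)// /N addr_ge0// mulr_ge0// ltW.
  apply/cvgrPdist_le => e e0; near=> s.
  have s0 : 0 < s by near: s; exact: nbhs_pinfty_gt.
  have sK : (M + N / alpha) / e < s by near: s; apply: nbhs_pinfty_gt; exact: num_real.
  rewrite sub0r normrN /F normrM (@ger0_norm _ (alpha * _)) ?mulr_ge0 ?expR_ge0 ?(ltW alpha0)//.
  have h1 : `|f s - N / alpha| <= M + N / alpha.
    apply: le_trans (ler_normB _ _) _; rewrite lerD// ger0_norm// divr_ge0 ?(ltW alpha0)//.
    by rewrite /N addr_ge0// mulr_ge0// ltW.
  have h2 : alpha * expR (- alpha * s) * s <= 1.
    have : alpha * s <= expR (alpha * s).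
      by apply: le_trans (expR_ge1Dx _); rewrite lerDr.
    rewrite mulNr expRN => h.
    have -> : alpha / expR (alpha * s) * s = (alpha * s) / expR (alpha * s) by ring.
    by rewrite ler_pdivrMr ?expR_gt0// mul1r.
  have h3 : M + N / alpha <= e * s by move: sK; rewrite ltr_pdivrMr// [s * e]mulrC => /ltW.
  have x0 : 0 <= alpha * expR (- alpha * s) by rewrite mulr_ge0 ?expR_ge0 ?(ltW alpha0).
  have := ler_wpM2l x0 (le_trans h1 h3); have := ler_wpM2l (ltW e0) h2; lra.
have ftc := @ge0_continuous_FTC2y R g F 0 0 (fun x _ => g0 x) (continuous_subspaceT cg) F0
  (fun x _ => @ex_derive _ _ _ _ _ _ _ (dF x)).
have {}ftc : (\int[lam]_(x in `[0%R, +oo[) (g x)%:E)%E = (- F 0)%:E.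
  rewrite ftc ?sub0e// => [|x _].
    exact/cvg_at_right_filter/(is_derive1_continuous dF).
  by rewrite derive1E (@derive_val _ _ _ _ _ _ _ (dF x)).
have e1 : Rintegral lam setT (fun s => pdf s * (f' s - alpha * f s + N)) = - F 0.
  rewrite /Rintegral (_ : (\int[lam]_x _)%E = (- F 0)%:E)// -ftc [RHS]integral_mkcond.
  apply: eq_integral => s _; rewrite patchE pdfE mem_setE in_itv/= andbT.
  by case: ifP => // _; rewrite mul0r.
have i1 := pdf_mul cf' f'M; have i2 := pdf_mul cf fM.
have i3 := integrableZl measurableT (- alpha) i2.
have i4 := integrableZl measurableT N ipdf.
have e2 : Rintegral lam setT (fun s => pdf s * (f' s - alpha * f s + N)) =
    Rintegral lam setT (fun s => pdf s * f' s) - alpha * Rintegral lam setT (fun s => pdf s * f s) + N.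
  have -> : (fun s => pdf s * (f' s - alpha * f s + N)) =
      (fun s => (pdf s * f' s + (- alpha) * (pdf s * f s)) + N * pdf s).
    by apply/funext => s; ring.
  have j12 : lam.-integrable setT (EFin \o (fun s => pdf s * f' s + (- alpha) * (pdf s * f s))).
    by have := integrableD measurableT i1 i3; congr (_.-integrable _ _); apply/funext => s.
  rewrite (RintegralD measurableT j12); last by move: i4; congr (_.-integrable _ _); apply/funext.
  rewrite (RintegralD measurableT i1); last by move: i3; congr (_.-integrable _ _); apply/funext.
  by rewrite (RintegralZl _ measurableT i2) (RintegralZl _ measurableT ipdf) Rintegral_pdf// mulr1 mulNr.
have := etrans (esym e2) e1; rewrite /F mulr0 expR0 => h.
have aN : alpha * (N / alpha) = N by rewrite mulrC divfK.
rewrite mulr1 mulrBr aN opprB in h.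
have {}h := addIr N (etrans h (addrC _ _)).
by rewrite mulrBr -h [RHS]addrC subrK.
Unshelve. all: by end_near. Qed.

Definition lavg (f : R -> R) (x : R) := Rintegral lam setT (fun s => lker alpha s * f (x + s)).

Let ilker : lam.-integrable setT (EFin \o lker alpha).
Proof. by have [_ _] := wker_lker alpha0. Qed.

Let cshift (f : R -> R) c k : continuous f -> continuous (fun s : R => f (c * s + k)).
Proof.
move=> cf s; apply: (@continuous_comp _ _ _ (fun s : R => c * s + k) f); last exact: cf.
by apply: cvgD; [apply: cvgM; [exact: cvg_cst|exact: cvg_id]|exact: cvg_cst].
Qed.

Let lavgE (f : R -> R) (M x : R) : continuous f -> (forall s, `|f s| <= M) ->
  lavg f x = (Rintegral lam setT (fun s => pdf s * f (1 * s + x))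
            + Rintegral lam setT (fun s => pdf s * f (-1 * s + x))) / 2.
Proof.
move=> cf fM.
have j1 : lam.-integrable setT (EFin \o (fun s => pdf s * f (1 * s + x))).
  by apply: pdf_mul => //; exact: cshift.
have j2 : lam.-integrable setT (EFin \o (fun s => pdf s * f (-1 * s + x))).
  by apply: pdf_mul => //; exact: cshift.
have m2 : measurable_fun setT (fun s => pdf s * f (-1 * s + x)).
  by apply/measurable_EFinP; exact: measurable_int j2.
have j2' := integrable_line_opp j2.
rewrite -(Rintegral_line_opp m2) -(RintegralD measurableT j1 j2') mulrC.
have j := integrableD measurableT j1 j2'.
rewrite -RintegralZl//.
apply: Rintegral_ae_eq.
- apply: measurable_funM; first by apply/measurable_EFinP; exact: measurable_int ilker.
  apply: continuous_measurable_fun => s.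
  by have := @cshift f 1 x cf s; under [X in continuous_at _ X]eq_fun do rewrite mul1r addrC.
- apply: measurable_funM => //; apply: measurable_funD; apply/measurable_EFinP.
    exact: measurable_int j1.
  exact: measurable_int j2'.
- apply: (@filterS _ _ (ae_filter_ringOfSetsType lam)) (@ae_neq0 R) => s s0 /=.
  have -> : 1 * s + x = x + s by ring.
  have -> : -1 * - s + x = x + s by ring.
  rewrite !pdfE oppr_ge0 /lker.
  case: (ltgtP 0 s) => [sp|sn|e]; last by rewrite -e eqxx in s0.
    by rewrite gtr0_norm//; field.
  by rewrite ltr0_norm//; field.
Qed.

(* The kernel [lker alpha] is the Green function of [1 - alpha^-2 d^2/dx^2]. *)
Lemma lavg_derive2 (f f1 f2 : R -> R) (M x : R) : C2fun f f1 f2 -> (forall s, `|f s| <= M) ->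
  (forall s, `|f1 s| <= M) -> (forall s, `|f2 s| <= M) ->
  lavg f2 x = alpha ^+ 2 * (lavg f x - f x).
Proof.
move=> Cf b0 b1 b2; have [d0 d1 c2] := Cf.
have c0 := is_derive1_continuous d0; have c1 := is_derive1_continuous d1.
rewrite (lavgE _ c2 b2) (lavgE _ c0 b0).
(* Each half-line is integrated by parts twice. The boundary terms [c * f1 x] cancel in the mean of
   the two sides. *)
have half c : c = 1 \/ c = -1 ->
   Rintegral lam setT (fun s => pdf s * f2 (c * s + x)) =
   alpha * (alpha * (Rintegral lam setT (fun s => pdf s * f (c * s + x)) - f x) - c * f1 x).
  move=> cE; have [e0 e1 ce2] := C2fun_affine c x Cf.
  have cn : `|c| = 1 by case: cE => ->; rewrite ?normrN normr1.
  have c21 : c ^+ 2 = 1 by case: cE => ->; rewrite ?sqrrN expr1n.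
  have B1 s : `|c * f1 (c * s + x)| <= M by rewrite normrM cn mul1r.
  have B2 s : `|c ^+ 2 * f2 (c * s + x)| <= M by rewrite c21 mul1r.
  have q1 := Rintegral_pdf_derive e0 (is_derive1_continuous e1) (fun s => b0 (c * s + x)) B1.
  have q2 := Rintegral_pdf_derive e1 ce2 B1 B2.
  rewrite mulr0 add0r in q1; rewrite mulr0 add0r in q2.
  rewrite -q1 -q2; by apply: eq_Rintegral => s _; rewrite c21 mul1r.
rewrite (half 1 (or_introl erefl)) (half (-1) (or_intror erefl)); by field.
Qed.

Lemma integrable_lker_mul (f : R -> R) (M x : R) : continuous f -> (forall s, `|f s| <= M) ->
  lam.-integrable setT (EFin \o (fun s => lker alpha s * f (x + s))).
Proof.
move=> cf fM; apply: (integrable_mul_bounded ilker _ (fun s => fM (x + s))).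
apply: continuous_measurable_fun => s.
by have := @cshift f 1 x cf s; under [X in continuous_at _ X]eq_fun do rewrite mul1r addrC.
Qed.

Definition lmass := Rintegral lam setT (fun s => alpha / 2 * expR (- (alpha / 2) * `|s|)).

(** The weight may grow under a shift by at most [exp(alpha/2 |s|)]. Half of the decay of the kernel
    compensates this, and the other half is integrated into [lmass]. *)
Lemma lavg_le (f w : R -> R) (M C x : R) : continuous f -> (forall s, `|f s| <= M) ->
  (forall s, `|f s| <= C * w s) -> 0 <= C ->
  (forall s, w (x + s) <= expR (alpha / 2 * `|s|) * w x) ->
  `|lavg f x| <= C * lmass * w x.
Proof.
move=> cf fM fw C0 ww; have j := integrable_lker_mul x cf fM.
apply: le_trans (le_normr_Rintegral measurableT j) _.
have [_ _ ie] := wkerZ (ltW (divr_gt0 alpha0 (ltr0n _ 2))) (wker_exp_abs (divr_gt0 alpha0 (ltr0n R 2))).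
have -> : C * lmass * w x = Rintegral lam setT
    (fun s => C * w x * (alpha / 2 * expR (- (alpha / 2) * `|s|))).
  by rewrite RintegralZl// /lmass; ring.
apply: le_Rintegral => //.
- by have := integrable_norm j.
- by have := integrableZl measurableT (C * w x) ie; congr (_.-integrable _ _).
- move=> s _; rewrite normrM ger0_norm; last by rewrite /lker mulr_ge0 ?expR_ge0// ltW// divr_gt0.
  rewrite /lker.
  have h : `|f (x + s)| <= C * (expR (alpha / 2 * `|s|) * w x).
    by apply: le_trans (fw _) _; rewrite ler_wpM2l.
  apply: (@le_trans _ _ (alpha / 2 * expR (- alpha * `|s|) * (C * (expR (alpha / 2 * `|s|) * w x)))).
    by rewrite ler_wpM2l// mulr_ge0 ?expR_ge0// ltW// divr_gt0.
  have -> : expR (- (alpha / 2) * `|s|) = expR (- alpha * `|s|) * expR (alpha / 2 * `|s|).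
    by rewrite -expRD; congr expR; field.
  by rewrite le_eqVlt; apply/orP; left; apply/eqP; ring.
Qed.

End resolvent_identity.

(** * Slowly modulated waves and instability *)

Section waves.
Variables (R : realType) (alpha : R).
Hypothesis alpha0 : 0 < alpha.

(** The profile is proportional to [(1 + r) exp(-r)] at [r = e|x + s|], a decreasing function of
    [r], and the shift lowers [r] by at most [e|s| <= alpha/2 |s|]. This is the growth condition of
    [lavg_le]. *)
Lemma kappa_shift_le (e x s : R) : 0 < e -> e <= alpha / 2 ->
  kappa e (x + s) <= expR (alpha / 2 * `|s|) * kappa e x.
Proof.
move=> e0 ea; rewrite /kappa.
set r := e * `|x + s|; set q := e * `|x|.
have q0 : 0 <= q by rewrite mulr_ge0// ltW.
have r0 : 0 <= r by rewrite mulr_ge0// ltW.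
have rq : q - r <= alpha / 2 * `|s|.
  apply: (@le_trans _ _ (e * `|s|)); last by rewrite ler_wpM2r.
  by rewrite -mulrBr ler_pM2l//; have := ler_normB (x + s) s; rewrite addrK; lra.
have e40 : 0 <= e / 4 by rewrite divr_ge0// ltW.
have s0 : 0 <= alpha / 2 * `|s| by rewrite mulr_ge0// divr_ge0// ltW.
have EE : expR (q - r) <= expR (alpha / 2 * `|s|) by rewrite ler_expR.
have E1 : 1 <= expR (alpha / 2 * `|s|) by rewrite -[leLHS]expR0 ler_expR.
move: (expR (alpha / 2 * `|s|)) EE E1 => E EE E1.
rewrite !mulNr -/r -/q.
have x0 := expR_ge0 (- q).
suff key : (1 + r) * expR (- r) <= E * ((1 + q) * expR (- q)).
  by have := ler_wpM2l e40 key; lra.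
have [le|lt] := leP r q.
  have -> : expR (- r) = expR (q - r) * expR (- q) by rewrite -expRD; congr expR; ring.
  have -> : E * ((1 + q) * expR (- q)) = (1 + q) * (E * expR (- q)) by ring.
  rewrite ler_pM ?mulr_ge0 ?expR_ge0//; first by lra.
    by lra.
  by rewrite ler_wpM2r.
have h1 : 1 + r <= (1 + q) * expR (r - q).
  apply: (@le_trans _ _ ((1 + q) * (1 + (r - q)))); first by nra.
  by rewrite ler_wpM2l ?expR_ge1Dx//; lra.
have h2 : (1 + r) * expR (- r) <= (1 + q) * expR (- q).
  have -> : expR (- q) = expR (r - q) * expR (- r) by rewrite -expRD; congr expR; ring.
  by rewrite mulrA ler_wpM2r ?expR_ge0.
apply: le_trans h2 _; rewrite ler_peMl// mulr_ge0//; lra.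
Qed.

(** Each derivative of the modulation costs a factor [e], relative to the modulation itself: the
    origin of the O(e) errors. *)
Lemma kappa_bound (e x : R) : 0 < e -> [/\ 0 <= kappa e x, kappa e x <= e / 4,
  `|kappa1 e x| <= e * kappa e x & `|kappa2 e x| <= e ^+ 2 * kappa e x].
Proof.
move=> e0; have x0 := expR_ge0 (- e * `|x|).
have u0 : 0 <= e * `|x| by rewrite mulr_ge0// ltW.
have e40 : 0 < e / 4 by rewrite divr_gt0.
have q2 := exprn_gt0 2 e0; have q3 := exprn_gt0 3 e0.
split.
- by rewrite /kappa !mulr_ge0// ?(ltW e40)//; lra.
- rewrite /kappa -mulrA ler_piMr ?(ltW e40)// mulNr expRN ler_pdivrMr ?expR_gt0// mul1r.
  exact: expR_ge1Dx.
- rewrite /kappa1 2!normrM normrN (gtr0_norm (divr_gt0 q3 (ltr0n _ 4))) (ger0_norm x0) /kappa.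
  have -> : e ^+ 3 / 4 * `|x| * expR (- e * `|x|) = e * (e / 4 * (e * `|x|) * expR (- e * `|x|)) by ring.
  by rewrite ler_pM2l// ler_wpM2r// ler_pM2l//; lra.
- rewrite /kappa2 2!normrM (gtr0_norm (divr_gt0 q3 (ltr0n _ 4))) (ger0_norm x0) /kappa.
  have -> : e ^+ 3 / 4 * `|e * `|x| - 1| * expR (- e * `|x|) =
     e ^+ 2 * (e / 4 * `|e * `|x| - 1| * expR (- e * `|x|)) by ring.
  by rewrite ler_pM2l// ler_wpM2r// ler_pM2l// ler_norml; lra.
Qed.

(** The phases 0 and [pi / 2] give cosine and, up to sign, sine; [wave2] is the second
    derivative. *)
Definition wave (p th e x : R) := cos (p * x + th) * kappa e x.
Definition wave2 (p th e x : R) := p ^+ 2 * - cos (p * x + th) * kappa e x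
  + 2 * (p * - sin (p * x + th) * kappa1 e x) + cos (p * x + th) * kappa2 e x.

Lemma C2fun_wave p th e : exists f1, C2fun (wave p th e) f1 (wave2 p th e).
Proof.
have Cc : C2fun (@cos R) (fun x => - sin x) (fun x => - cos x).
  split; first exact: is_derive_cos.
    by move=> x; exact: is_deriveN.
  by move=> x; apply: cvgN; exact: continuous_cos.
by eexists; exact: (C2fun_mul (C2fun_affine p th Cc) (C2fun_kappa e)).
Qed.

Let cos_le1 (x : R) : `|cos x| <= 1. Proof. by rewrite ler_norml cos_geN1 cos_le1. Qed.
Let sin_le1 (x : R) : `|sin x| <= 1. Proof. by rewrite ler_norml sin_geN1 sin_le1. Qed.

Lemma wave_le p th e x : 0 < e -> `|wave p th e x| <= kappa e x.
Proof.
move=> e0; have [k0 _ _ _] := kappa_bound x e0.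
by rewrite /wave normrM (ger0_norm k0) ler_piMl.
Qed.

Let K (p : R) : R := 2 * `|p| + 1.

Let wave2_le p th e x : 0 < e -> e <= 1 ->
  `|wave2 p th e x + p ^+ 2 * wave p th e x| <= K p * e * kappa e x.
Proof.
move=> e0 e1; have [k0 _ k1 k2] := kappa_bound x e0.
have -> : wave2 p th e x + p ^+ 2 * wave p th e x =
  2 * (p * - sin (p * x + th) * kappa1 e x) + cos (p * x + th) * kappa2 e x.
  by rewrite /wave2 /wave; ring.
apply: le_trans (ler_normD _ _) _.
rewrite (normrM (2 : R)) (normrM (p * - sin (p * x + th)) (kappa1 e x)) (normrM p) normrN.
rewrite (normrM (cos (p * x + th))) (ger0_norm (ler0n R 2)).
have s1 := sin_le1 (p * x + th); have c1 := cos_le1 (p * x + th).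
have ek : 0 <= e * kappa e x by rewrite mulr_ge0// ltW.
have h1 : `|p| * `|sin (p * x + th)| * `|kappa1 e x| <= `|p| * (e * kappa e x).
  by rewrite -mulrA ler_wpM2l//; apply: le_trans k1; rewrite ler_piMl.
have h2 : `|cos (p * x + th)| * `|kappa2 e x| <= e * kappa e x.
  apply: (@le_trans _ _ `|kappa2 e x|); first by rewrite ler_piMl.
  by apply: le_trans k2 _; rewrite expr2 -mulrA ler_piMl.
rewrite /K; lra.
Qed.

(** Errors are bounded pointwise by the profile [kappa e], with a constant uniform in the phase, in
    [e] and in [x]; their L^2 norms are then compared with the norm of the profile without any
    further integral. *)
Lemma wave_est p : exists C : R, 0 <= C /\ forall th e x, 0 < e -> e <= 1 -> e <= alpha / 2 ->
  [/\ `|wave2 p th e x + p ^+ 2 * wave p th e x| <= C * e * kappa e x,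
      `|lavg alpha (wave p th e) x| <= C * kappa e x &
      `|lavg alpha (wave p th e) x - alpha ^+ 2 / (alpha ^+ 2 + p ^+ 2) * wave p th e x|
        <= C * e * kappa e x].
Proof.
have N0 : 0 <= lmass alpha.
  by apply: Rintegral_ge0 => s _; rewrite mulr_ge0 ?expR_ge0// divr_ge0// ltW.
have a2 := exprn_gt0 2 alpha0; have p2 := sqr_ge0 p.
have K0 : 0 <= K p by rewrite /K addr_ge0// mulr_ge0.
have s0 : 0 < alpha ^+ 2 + p ^+ 2 by lra.
have KN := mulr_ge0 K0 N0.
have Q0 : 0 <= K p * lmass alpha / (alpha ^+ 2 + p ^+ 2) by rewrite divr_ge0// ltW.
exists (K p + lmass alpha + K p * lmass alpha / (alpha ^+ 2 + p ^+ 2)); split; first by lra.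
move=> th e x e0 e1 ea; have [k0 k4 _ _] := kappa_bound x e0.
have ek : 0 <= e * kappa e x by rewrite mulr_ge0// ltW.
have [f1 Cf] := C2fun_wave p th e; have [d0 d1 c2] := Cf.
have c0 := is_derive1_continuous d0.
have b0 s : `|wave p th e s| <= e / 4.
  by have [_ h _ _] := kappa_bound s e0; exact: le_trans (wave_le p th s e0) h.
have w2 s := wave2_le p th s e0 e1.
have ww s : kappa e (x + s) <= expR (alpha / 2 * `|s|) * kappa e x by exact: kappa_shift_le.
have bl := lavg_le alpha0 c0 b0 (C := 1) (w := kappa e) (x := x).
have {}bl : `|lavg alpha (wave p th e) x| <= 1 * lmass alpha * kappa e x.
  by apply: bl => // s; rewrite mul1r; exact: wave_le.
pose r s := wave2 p th e s + p ^+ 2 * wave p th e s.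
have cr : continuous r.
  by move=> s; apply: cvgD; [exact: c2|apply: cvgM; [exact: cvg_cst|exact: c0]].
have br s : `|r s| <= K p * e * (e / 4).
  have [_ h _ _] := kappa_bound s e0; apply: le_trans (w2 s) _.
  by rewrite ler_wpM2l// mulr_ge0// ltW.
have lr : `|lavg alpha r x| <= K p * e * lmass alpha * kappa e x.
  by apply: (lavg_le alpha0 cr br w2) => //; rewrite mulr_ge0// ltW.
have [M [b1 b2]] : exists M, (forall s, `|f1 s| <= M) /\ (forall s, `|wave2 p th e s| <= M /\ `|wave p th e s| <= M).
  exists (`|p| * (e / 4) + e * (e / 4) + K p * e * (e / 4) + p ^+ 2 * (e / 4) + e / 4).
  have e4 : 0 <= e / 4 by rewrite divr_ge0// ltW.
  have t1 := mulr_ge0 (normr_ge0 p) e4; have t2 := mulr_ge0 (ltW e0) e4.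
  have t3 := mulr_ge0 (mulr_ge0 K0 (ltW e0)) e4; have t4 := mulr_ge0 p2 e4.
  split=> [s|s].
    have -> : f1 s = p * - sin (p * s + th) * kappa e s + cos (p * s + th) * kappa1 e s.
      have Cc : C2fun (@cos R) (fun x => - sin x) (fun x => - cos x).
        split; first exact: is_derive_cos.
          by move=> y; exact: is_deriveN.
        by move=> y; apply: cvgN; exact: continuous_cos.
      have [h _ _] := C2fun_mul (C2fun_affine p th Cc) (C2fun_kappa e).
      by rewrite -(@derive_val _ _ _ _ _ _ _ (d0 s)) (@derive_val _ _ _ _ _ _ _ (h s)).
    have [q0 q4 q1 _] := kappa_bound s e0.
    apply: le_trans (ler_normD _ _) _; rewrite (normrM (p * - sin (p * s + th))) (normrM p) normrN.
    rewrite (normrM (cos (p * s + th))) (ger0_norm q0).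
    have h1 : `|p| * `|sin (p * s + th)| * kappa e s <= `|p| * (e / 4).
      by rewrite -mulrA ler_wpM2l//; apply: le_trans q4; rewrite ler_piMl.
    have h2 : `|cos (p * s + th)| * `|kappa1 e s| <= e * (e / 4).
      apply: (@le_trans _ _ `|kappa1 e s|); first by rewrite ler_piMl.
      by apply: le_trans q1 _; rewrite ler_pM2l.
    lra.
  have hb := b0 s; have hr := br s.
  have hp : `|p ^+ 2 * wave p th e s| <= p ^+ 2 * (e / 4).
    by rewrite normrM (ger0_norm p2) ler_wpM2l.
  have : `|wave2 p th e s| <= `|r s| + `|p ^+ 2 * wave p th e s|.
    by apply: le_trans (ler_normB _ _); rewrite /r addrK.
  by split; lra.
have id := lavg_derive2 alpha0 x Cf (fun s => (b2 s).2) b1 (fun s => (b2 s).1).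
have jr : lavg alpha r x = lavg alpha (wave2 p th e) x + p ^+ 2 * lavg alpha (wave p th e) x.
  have j0 := integrable_lker_mul alpha0 x c0 b0.
  have j2 := integrable_lker_mul alpha0 x c2 (fun s => (b2 s).1).
  rewrite /lavg -RintegralZl// -RintegralD//; last first.
    by have := integrableZl measurableT (p ^+ 2) j0; congr (_.-integrable _ _).
  by apply: eq_Rintegral => s _; rewrite /r; ring.
(* With [w] the wave and [r = w'' + p^2 w = O(e)], the identity [U w'' = alpha^2 (U w - w)] gives
   [U r = (alpha^2 + p^2) U w - alpha^2 w]. *)
have eq : lavg alpha (wave p th e) x - alpha ^+ 2 / (alpha ^+ 2 + p ^+ 2) * wave p th e x =
    lavg alpha r x / (alpha ^+ 2 + p ^+ 2).
  rewrite jr id; field; exact: lt0r_neq0.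
split.
- apply: le_trans (w2 x) _; rewrite -!mulrA ler_wpM2r//; lra.
- apply: le_trans bl _; rewrite mul1r ler_wpM2r//; lra.
- rewrite eq normrM (@gtr0_norm _ (_^-1)) ?invr_gt0//.
  apply: (@le_trans _ _ (K p * lmass alpha / (alpha ^+ 2 + p ^+ 2) * (e * kappa e x))).
    have -> : K p * lmass alpha / (alpha ^+ 2 + p ^+ 2) * (e * kappa e x) =
      K p * e * lmass alpha * kappa e x / (alpha ^+ 2 + p ^+ 2) by ring.
    by rewrite ler_wpM2r// invr_ge0 ltW.
  rewrite -[leRHS]mulrA ler_wpM2r//; lra.
Qed.

End waves.

Section plane_waves.
Variables (R : realType) (alpha : R).
Hypothesis alpha0 : 0 < alpha.
Local Notation line := (measurableTypeR R).
Local Notation plane := (line * line)%type.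
Local Notation pmu := (@pmu R).
Local Notation lebesgue := (@lebesgue_measure R).
Local Notation H := (L2fun pmu).
Local Notation wl := (wker_lker alpha0).
Local Notation phi := (phi_ker alpha).

Let W (e : R) : R * R -> R := tens (kappa e) (kappa e).

Lemma sqint_kappa_tens e : 0 < e -> sqint pmu (W e).
Proof.
move=> e0; have wk := wker_kappa e0; have [mk _ _] := wk.
have w2 : wker (fun s => kappa e s ^+ 2).
  apply: (@wker_le _ _ (fun s => e / 4 * kappa e s)).
  - exact: measurable_funX.
  - move=> s; have [k0 k4 _ _] := kappa_bound s e0.
    by rewrite sqr_ge0 expr2 ler_wpM2r.
  - by apply: wkerZ => //; rewrite divr_ge0// ltW.
exact: (sqint_tensor mk mk w2 w2).
Qed.

Lemma pmu_setT_neq0 : pmu [set: plane] != 0%E.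
Proof.
pose I : set line := `[0, 1]%classic.
have mI : measurable I by exact: measurable_itv.
have h : pmu (I `*` I) = 1%E.
  have l1 : lebesgue (`[0, 1]%classic : set R) = 1%E.
    by rewrite lebesgue_measure_itv/= lte_fin ltr01 sube0.
  apply: etrans (product_measure1E _ _ mI mI) _.
  by apply: etrans (congr2 mule l1 l1) _; rewrite mule1.
apply/eqP => h0.
have : (pmu (I `*` I) <= pmu [set: plane])%E.
  by apply: le_measure => //; rewrite inE//; exact: measurableX.
by rewrite h h0 lee_fin ler10.
Qed.

Lemma kappa_tens_norm_gt0 e (e0 : 0 < e) :
  0 < ip (toL2 (sqint_kappa_tens e0) : H) (toL2 (sqint_kappa_tens e0)).
Proof.
rewrite lt_def ip_ge0 andbT; apply/eqP => /ip_eq0 [N [mN N0 hN]].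
have NT : N = setT.
  apply/seteqP; split=> // z _; apply: hN => /= h.
  have k s : 0 < kappa e s.
    by rewrite /kappa mulr_gt0 ?expR_gt0// mulr_gt0 ?divr_gt0// ltr_pwDl// mulr_ge0// ltW.
  by have := mulr_gt0 (k z.1) (k z.2); rewrite -/(tens _ _ z) -/(W e z) h ltxx.
by have := pmu_setT_neq0; rewrite -NT N0 eqxx.
Qed.

Lemma tensorop_tens (A B : R -> R) (M : R) (f : H) z : continuous A -> continuous B ->
  (forall s, `|A s| <= M) -> (forall s, `|B s| <= M) -> (forall y, f y = tens A B y) ->
  tensorop wl wl f z = lavg alpha A z.1 * lavg alpha B z.2.
Proof.
move=> cA cB bA bB fE.
pose F (p : R * R) : R := lker alpha p.1 * lker alpha p.2 * (A (z.1 + p.1) * B (z.2 + p.2)).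
have M0 : 0 <= M by exact: le_trans (bA 0).
have csh (g : R -> R) (c : R) : continuous g -> continuous (fun s : R => g (c + s)).
  move=> cg s; apply: (@continuous_comp _ _ _ (fun s : R => c + s) g); last exact: cg.
  by apply: cvgD; [exact: cvg_cst|exact: cvg_id].
have iF : pmu.-integrable setT (EFin \o F).
  apply: (@integrable_mul_bounded _ _ _ pmu _ _ (M * M) (integrable_tensor wl wl)).
    apply: (@measurable_tensor R (fun s => A (z.1 + s)) (fun s => B (z.2 + s)));
      by apply: continuous_measurable_fun; exact: csh.
  by move=> p; rewrite normrM ler_pM.
rewrite tensoropE.
apply: (@etrans _ _ (Rintegral pmu setT F)).
  by apply: eq_Rintegral => p _; rewrite fE.
apply: etrans (esym (Rintegral12_prod iF)) _.
have iA := integrable_lker_mul alpha0 z.1 cA bA.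
have iB := integrable_lker_mul alpha0 z.2 cB bB.
apply: (@etrans _ _ (Rintegral lebesgue setT (fun s => lavg alpha B z.2 * (lker alpha s * A (z.1 + s))))).
  apply: eq_Rintegral => x _.
  apply: (@etrans _ _ (Rintegral lebesgue setT
     (fun y => lker alpha x * A (z.1 + x) * (lker alpha y * B (z.2 + y))))).
    by apply: eq_Rintegral => y _; rewrite /F /=; ring.
  by rewrite RintegralZl// mulrC.
by rewrite RintegralZl// mulrC.
Qed.

(** If [lam] were in the resolvent set, the bound on the inverse would make each modulated wave
    small relative to the profile. No single wave needs a lower bound on its norm: the squares of
    all four phase choices add up to the square of the profile, which gives the contradiction. *)
Lemma unstable_of_symbol (d c b p q : R) : 0 < d ->
  d * (p ^+ 2 + q ^+ 2) + c ^+ 2 * (alpha ^+ 2 / (alpha ^+ 2 + p ^+ 2) *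
    (alpha ^+ 2 / (alpha ^+ 2 + q ^+ 2))) < b ->
  spectrally_unstable d c b phi.
Proof.
set u := alpha ^+ 2 / (alpha ^+ 2 + p ^+ 2); set v := alpha ^+ 2 / (alpha ^+ 2 + q ^+ 2).
move=> d0 neg; pose lam := d * (p ^+ 2 + q ^+ 2) + c ^+ 2 * (u * v) - b.
exists lam; split; first by rewrite /lam; lra.
move=> [_ [_ [C [C0 hC]]]].
have [Ma [Ma0 ea]] := wave_est alpha0 p; have [Mb [Mb0 eb]] := wave_est alpha0 q.
have u01 : `|u| <= 1.
  have := exprn_gt0 2 alpha0; have := sqr_ge0 p => p2 a2.
  rewrite /u ger0_norm ?divr_ge0 ?addr_ge0 ?sqr_ge0// ler_pdivrMr; last by lra.
  by lra.
(* The first term bounds the error of the Laplacian. The second bounds that of the convolution,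
   split as [(U A - u A) V B + u A (V B - v B)]. *)
pose C' := d * (Ma + Mb) + c ^+ 2 * (Ma * Mb + Mb).
have c2 := sqr_ge0 c.
have C'0 : 0 <= C'.
  exact: addr_ge0 (mulr_ge0 (ltW d0) (addr_ge0 Ma0 Mb0))
    (mulr_ge0 c2 (addr_ge0 (mulr_ge0 Ma0 Mb0) Mb0)).
(* The last bound yields [2 C C' e < 1], so that four contributions [(C C' e)^2] sum to less than 1;
   the others are the ranges in which [wave_est] holds. *)
pose e := Num.min (Num.min 1 (alpha / 2)) (2 * (C * C') + 1)^-1.
have CC : 0 <= C * C' by rewrite mulr_ge0 ?(ltW C0).
have e0 : 0 < e.
  by rewrite /e !lt_min ltr01 divr_gt0//= invr_gt0; lra.
have e1 : e <= 1 by rewrite /e !ge_min lexx.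
have ealpha : e <= alpha / 2 by rewrite /e !ge_min lexx orbT.
have eC : 2 * (C * C') * e < 1.
  apply: (@le_lt_trans _ _ (2 * (C * C') * (2 * (C * C') + 1)^-1)).
    have CC2 : 0 <= 2 * (C * C') by lra.
    by apply: (ler_wpM2l CC2); rewrite /e ge_min lexx orbT.
  by rewrite ltr_pdivrMr; lra.
pose WH : H := toL2 (sqint_kappa_tens e0).
have bound th th' : exists2 psi : H, (forall z, psi z = wave p th e z.1 * wave q th' e z.2) &
    ip psi psi <= (C * C' * e) ^+ 2 * ip WH WH.
  pose A := wave p th e; pose B := wave q th' e.
  have [A1 CA] := C2fun_wave p th e; have [B1 CB] := C2fun_wave q th' e.
  have [dA dA1 cA2] := CA; have [dB dB1 cB2] := CB.
  have cA := is_derive1_continuous dA; have cB := is_derive1_continuous dB.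
  have wA s : `|A s| <= kappa e s by exact: wave_le.
  have wB s : `|B s| <= kappa e s by exact: wave_le.
  have k0 s : 0 <= kappa e s by have [] := kappa_bound s e0.
  have W0 z : 0 <= W e z by rewrite mulr_ge0.
  have bA s : `|A s| <= e / 4 by have [_ h _ _] := kappa_bound s e0; exact: le_trans (wA s) h.
  have bB s : `|B s| <= e / 4 by have [_ h _ _] := kappa_bound s e0; exact: le_trans (wB s) h.
  have sp : sqint pmu (tens A B).
    apply: (sqint_le _ (sqint_kappa_tens e0)).
      by apply: continuous_plane_measurable; exact: continuous_tens.
    by move=> z; rewrite /tens normrM ler_pM.
  pose psi : H := toL2 sp.
  pose r (z : R * R) := (wave2 p th e z.1 + p ^+ 2 * A z.1) * B z.2
    + A z.1 * (wave2 q th' e z.2 + q ^+ 2 * B z.2).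
  have lapE z : lap (tens A B) z = r z - (p ^+ 2 + q ^+ 2) * psi z.
    have -> : psi z = A z.1 * B z.2 by [].
    by rewrite (lap_tens z CA CB) /r /tens /A /B; ring.
  have rb z : `|r z| <= (Ma + Mb) * e * W e z.
    have [h1 _ _] := ea th e z.1 e0 e1 ealpha; have [h2 _ _] := eb th' e z.2 e0 e1 ealpha.
    apply: le_trans (ler_normD _ _) _.
    rewrite (normrM (_ + _)) (normrM (A z.1)).
    have g1 := ler_pM (normr_ge0 _) (normr_ge0 _) h1 (wB z.2).
    have g2 := ler_pM (normr_ge0 _) (normr_ge0 _) (wA z.1) h2.
    by apply: le_trans (lerD g1 g2) _; rewrite /W /tens le_eqVlt; apply/orP; left; apply/eqP; ring.
  have cr : continuous r.
    have cz (f g : R -> R) : continuous f -> continuous g ->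
      continuous (fun z : R * R => f z.1 * g z.2) by exact: continuous_tens.
    move=> z; apply: cvgD.
      apply: (cz (fun s => wave2 p th e s + p ^+ 2 * A s) B) => // s.
      by apply: cvgD; [exact: cA2|apply: cvgM; [exact: cvg_cst|exact: cA]].
    apply: (cz A (fun s => wave2 q th' e s + q ^+ 2 * B s)) => // s.
    by apply: cvgD; [exact: cB2|apply: cvgM; [exact: cvg_cst|exact: cB]].
  have sr : sqint pmu r.
    apply: (sqint_le _ (sqintZ ((Ma + Mb) * e) (sqint_kappa_tens e0))) => //.
    exact: continuous_plane_measurable.
  pose rH : H := toL2 sr.
  pose lapH : H := (- (p ^+ 2 + q ^+ 2)) *: psi + rH.
  have lapHE z : lapH z = lap (tens A B) z.
    by rewrite lapE; have -> : lapH z = - (p ^+ 2 + q ^+ 2) * psi z + r z by []; ring.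
  have wlap : weak_lap psi lapH.
    move=> chi tchi; apply: etrans (green (C2plane_tens CA CB) tchi) _.
    by apply: eq_Rintegral => z _; rewrite lapHE.
  pose h : H := (- d) *: lapH + (c ^+ 2) *: tensorop wl wl psi + (- (b + lam)) *: psi.
  have hE z : h z = - d * lapH z + c ^+ 2 * tensorop wl wl psi z + (- (b + lam)) * psi z by [].
  have Lop : Lop_eq d c b phi psi (fun z => h z + lam * psi z).
    split; first by split; [exact: (L2funP psi)|exists lapH; split=> //; exact: (L2funP lapH)].
    exists lapH; split; first exact: (L2funP lapH).
    by split=> //; apply: aeW => z; rewrite conv_phi_ker hE; ring.
  have hb z : `|h z| <= C' * e * W e z.
    rewrite hE (@tensorop_tens A B (e / 4) psi z)// lapHE lapE.
    have [_ g1 g2] := ea th e z.1 e0 e1 ealpha; have [_ g3 g4] := eb th' e z.2 e0 e1 ealpha.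
    rewrite -/A -/B -/u -/v in g1 g2 g3 g4.
    have -> : - d * (r z - (p ^+ 2 + q ^+ 2) * psi z) +
      c ^+ 2 * (lavg alpha A z.1 * lavg alpha B z.2) + - (b + lam) * psi z =
      - d * r z + c ^+ 2 * ((lavg alpha A z.1 - u * A z.1) * lavg alpha B z.2 +
         u * A z.1 * (lavg alpha B z.2 - v * B z.2)).
      by have -> : psi z = A z.1 * B z.2 by []; rewrite /lam; ring.
    have q1 := rb z.
    have q2 := ler_pM (normr_ge0 _) (normr_ge0 _) g2 g3.
    have uA : `|u * A z.1| <= kappa e z.1.
      by rewrite normrM; apply: le_trans (wA z.1); rewrite ler_piMl.
    have q3 := ler_pM (normr_ge0 _) (normr_ge0 _) uA g4.
    apply: le_trans (ler_normD _ _) _.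
    rewrite (normrM (- d)) normrN (gtr0_norm d0) (normrM (c ^+ 2)) (ger0_norm c2).
    have q4 : `|(lavg alpha A z.1 - u * A z.1) * lavg alpha B z.2 +
         u * A z.1 * (lavg alpha B z.2 - v * B z.2)| <= (Ma * Mb + Mb) * e * W e z.
      apply: le_trans (ler_normD _ _) _; rewrite (normrM (_ - _)) (normrM (u * _)).
      by apply: le_trans (lerD q2 q3) _; rewrite /W /tens le_eqVlt; apply/orP; left; apply/eqP; ring.
    have q5 := ler_wpM2l c2 q4; have q6 := ler_wpM2l (ltW d0) q1.
    by apply: le_trans (lerD q6 q5) _; rewrite /C' le_eqVlt; apply/orP; left; apply/eqP; ring.
  have n1 : L2norm psi = Num.sqrt (ip psi psi) by [].
  have n2 : L2norm h = Num.sqrt (ip h h) by [].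
  have n3 := hC psi h (L2funP h) Lop; rewrite n1 n2 in n3.
  have n4 : ip h h <= (C' * e) ^+ 2 * ip WH WH.
    have -> : (C' * e) ^+ 2 * ip WH WH = ip ((C' * e) *: WH) ((C' * e) *: WH).
      by rewrite ipZl (ipC WH ((C' * e) *: WH)) ipZl mulrA expr2.
    apply: le_Rintegral => //; [exact: ip_integrable|exact: ip_integrable|].
    move=> z _; have := hb z; have -> : ((C' * e) *: WH) z = C' * e * W e z by [].
    by move=> hz; rewrite -!expr2 -[h z ^+ 2]real_normK ?num_real// ler_pXn2r ?nnegrE//;
      apply: le_trans hz.
  exists psi => //.
  have p0 := ip_ge0 psi; have h0 := ip_ge0 h.
  have n5 : ip psi psi <= C ^+ 2 * ip h h.
    rewrite -[ip psi psi]sqr_sqrtr// -[ip h h]sqr_sqrtr// -exprMn ler_pXn2r ?nnegrE ?sqrtr_ge0//.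
    by rewrite mulr_ge0 ?sqrtr_ge0// ltW.
  apply: le_trans n5 _; have := ler_wpM2l (sqr_ge0 C) n4.
  by rewrite !exprMn !mulrA.
have [f1 E1 b1] := bound 0 0; have [f2 E2 b2] := bound 0 (pi / 2).
have [f3 E3 b3] := bound (pi / 2) 0; have [f4 E4 b4] := bound (pi / 2) (pi / 2).
(* The identity [cos^2 + sin^2 = 1] in each of the two variables, multiplied out. *)
have sumE : ip WH WH = ip f1 f1 + ip f2 f2 + (ip f3 f3 + ip f4 f4).
  have i (f : H) : pmu.-integrable setT (fun x => (f x * f x)%:E) := ip_integrable f f.
  have s12 := RintegralD measurableT (i f1) (i f2).
  have s34 := RintegralD measurableT (i f3) (i f4).
  have j12 : pmu.-integrable setT (EFin \o (fun x => f1 x * f1 x + f2 x * f2 x)).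
    exact: (integrableD measurableT (i f1) (i f2)).
  have j34 : pmu.-integrable setT (EFin \o (fun x => f3 x * f3 x + f4 x * f4 x)).
    exact: (integrableD measurableT (i f3) (i f4)).
  have s := RintegralD measurableT j12 j34.
  have -> : ip f1 f1 + ip f2 f2 + (ip f3 f3 + ip f4 f4) =
    Rintegral pmu setT (fun x => f1 x * f1 x + f2 x * f2 x + (f3 x * f3 x + f4 x * f4 x)).
    by apply/esym; apply: etrans s _; exact: congr2 s12 s34.
  apply: eq_Rintegral => z _; rewrite !E1 !E2 !E3 !E4.
  have -> : WH z = kappa e z.1 * kappa e z.2 by [].
  rewrite /wave !addr0 !cosD !cos_pihalf !sin_pihalf !mulr0 !mulr1 !sub0r.
  move: (cos2Dsin2 (p * z.1)) (cos2Dsin2 (q * z.2)).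
  move: (cos (p * z.1)) (sin (p * z.1)) (cos (q * z.2)) (sin (q * z.2)) (kappa e z.1) (kappa e z.2).
  move=> x1 y1 x2 y2 k k' g g'.
  have -> : k * k' * (k * k') = (x1 ^+ 2 + y1 ^+ 2) * (x2 ^+ 2 + y2 ^+ 2) * (k * k' * (k * k')).
    by rewrite g g' !mul1r.
  ring.
have W0 := kappa_tens_norm_gt0 e0; rewrite -/WH in W0.
have : ip WH WH <= 4 * ((C * C' * e) ^+ 2 * ip WH WH) by rewrite {1}sumE; lra.
have -> : 4 * ((C * C' * e) ^+ 2 * ip WH WH) = (2 * (C * C') * e) ^+ 2 * ip WH WH by ring.
apply/negP; rewrite -ltNge -[ltRHS]mul1r ltr_pM2r//.
have E0 : 0 <= 2 * (C * C') * e by apply: mulr_ge0 (ltW e0); lra.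
by rewrite expr_lt1.
Qed.

End plane_waves.

(** * Thresholds on the diffusion coefficient *)

Lemma stable_at_tangency (R : realType) (d c b alpha x : R) : 0 < d -> 0 < alpha -> 0 < b ->
  0 < x -> x / alpha ^+ 2 <= d -> 27 * c ^+ 2 * x ^+ 2 = (b + 2 * x) ^+ 3 ->
  spectrally_stable d c b (phi_ker alpha).
Proof.
move=> d0 alpha0 b0 x0 xd tang; have xn := lt0r_neq0 x0.
(* Here [t] is solved from [b = 3 x t - 2 x]; the hypothesis on [x] then becomes the other tangency
   condition [c^2 = x t^3]. *)
apply: (@stable_of_tangency _ d c b alpha x ((b + 2 * x) / (3 * x))) => //.
- by rewrite divr_gt0; lra.
- by rewrite -ler_pdivrMr ?exprn_gt0.
- have -> : x * ((b + 2 * x) / (3 * x)) ^+ 3 = (b + 2 * x) ^+ 3 / (27 * x ^+ 2) by field.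
  by rewrite -tang; field.
- by field.
Qed.

Lemma symbolE (R : realType) (alpha P : R) : 0 < alpha -> 0 <= P ->
  (alpha * Num.sqrt P) ^+ 2 = alpha ^+ 2 * P /\
  alpha ^+ 2 / (alpha ^+ 2 + (alpha * Num.sqrt P) ^+ 2) = (1 + P)^-1.
Proof.
move=> alpha0 P0; have e : (alpha * Num.sqrt P) ^+ 2 = alpha ^+ 2 * P by rewrite exprMn sqr_sqrtr.
split=> //; rewrite e.
have P1 : 1 + P != 0 by apply: lt0r_neq0; lra.
have an := lt0r_neq0 alpha0.
have -> : alpha ^+ 2 + alpha ^+ 2 * P = alpha ^+ 2 * (1 + P) by ring.
by rewrite invfM mulrA divff ?mul1r// expf_neq0.
Qed.

(** The frequencies are those of the tangency point, [p = q] with [1 + P = t]. There the symbol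
    would vanish if [d alpha^2] were [x]; its actual value is [2 P (d alpha^2 - x) < 0]. *)
Lemma unstable_below_tangency (R : realType) (d c b alpha x : R) : 0 < d -> 0 < alpha ->
  0 < x < b -> d < x / alpha ^+ 2 -> 27 * c ^+ 2 * x ^+ 2 = (b + 2 * x) ^+ 3 ->
  spectrally_unstable d c b (phi_ker alpha).
Proof.
move=> d0 alpha0 /andP[x0 xb] dx tang; have xn := lt0r_neq0 x0.
pose P := (b - x) / (3 * x).
have P0 : 0 < P by rewrite divr_gt0; lra.
have [e1 e2] := symbolE alpha0 (ltW P0).
apply: (unstable_of_symbol alpha0 (p := alpha * Num.sqrt P) (q := alpha * Num.sqrt P)) => //.
rewrite e2 e1.
have X : d * alpha ^+ 2 < x by rewrite -ltr_pdivlMr ?exprn_gt0.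
have PE : 1 + P = (b + 2 * x) / (3 * x) by rewrite /P; field.
have t0 : b + 2 * x != 0 by apply: lt0r_neq0; lra.
have cE : c ^+ 2 = (b + 2 * x) ^+ 3 / (27 * x ^+ 2) by rewrite -tang; field.
have -> : c ^+ 2 * ((1 + P)^-1 * (1 + P)^-1) = x * (1 + P).
  by rewrite cE PE; field; rewrite xn t0.
have bE : b = 3 * x * P + x by rewrite /P; field.
have := mulr_gt0 P0 (ltr0n R 2); have : 0 < P * (x - d * alpha ^+ 2) by rewrite mulr_gt0// subr_gt0.
by rewrite bE; lra.
Qed.

Lemma unstable_of_small_reaction (R : realType) (d c b alpha : R) : 0 < d -> 0 < alpha ->
  c ^+ 2 < b -> spectrally_unstable d c b (phi_ker alpha).
Proof.
move=> d0 alpha0 cb; apply: (unstable_of_symbol alpha0 (p := 0) (q := 0)) => //.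
have a2 : alpha ^+ 2 != 0 by rewrite expf_neq0// lt0r_neq0.
by rewrite expr0n/= !addr0 mulr0 add0r divff// !mulr1.
Qed.

(** When [c^2 = b] the tangency moves to frequency zero, so the previous choice degenerates to
    [P = 0]. With [q = 0] and [X = d alpha^2] the symbol is [P (X - b / (1 + P))], negative as soon
    as [X (1 + P) < b]; this [P] makes [X (1 + P)] the midpoint of [X] and [b]. *)
Lemma unstable_double_root (R : realType) (d c b alpha : R) : 0 < d -> 0 < alpha ->
  c ^+ 2 = b -> d < b / alpha ^+ 2 -> spectrally_unstable d c b (phi_ker alpha).
Proof.
move=> d0 alpha0 cb db.
have X0 : 0 < d * alpha ^+ 2 by rewrite mulr_gt0 ?exprn_gt0.
have Xb : d * alpha ^+ 2 < b by rewrite -ltr_pdivlMr ?exprn_gt0.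
pose P := (b - d * alpha ^+ 2) / (2 * (d * alpha ^+ 2)).
have P0 : 0 < P by rewrite divr_gt0; lra.
have [e1 e2] := symbolE alpha0 (ltW P0).
apply: (unstable_of_symbol alpha0 (p := alpha * Num.sqrt P) (q := 0)) => //.
have a2 : alpha ^+ 2 != 0 by rewrite expf_neq0// lt0r_neq0.
rewrite e2 e1 expr0n/= !addr0 divff// mulr1 cb.
have XP : d * alpha ^+ 2 * (1 + P) < b.
  have -> : d * alpha ^+ 2 * (1 + P) = d * alpha ^+ 2 + (b - d * alpha ^+ 2) / 2.
    have Xn := lt0r_neq0 X0; rewrite /P; move: (d * alpha ^+ 2) Xn => X Xn.
    by field.
  by lra.
have P1 : 0 < 1 + P by lra.
suff : b / (1 + P) < b - d * alpha ^+ 2 * P by lra.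
rewrite ltr_pdivrMr//.
by have := mulr_gt0 P0 (_ : 0 < b - d * alpha ^+ 2 * (1 + P)); rewrite subr_gt0 => /(_ XP); lra.
Qed.

Theorem theorem3 (R : realType) (a b d alpha : R) :
  0 < a -> 0 < b -> 0 < d -> 0 < alpha -> b <= a ^+ 2 / 4 ->
  (b < a ^+ 2 / 4 ->
     (forall xs : R, 0 < xs < b -> fstar a b xs = 0 ->
        (xs / alpha ^+ 2 <= d -> spectrally_stable d (c1 a b) b (phi_ker alpha)) /\
        (d < xs / alpha ^+ 2 -> spectrally_unstable d (c1 a b) b (phi_ker alpha))) /\
     spectrally_unstable d (c2 a b) b (phi_ker alpha)) /\
  (a ^+ 2 / 4 = b ->
     (a ^+ 2 / (4 * alpha ^+ 2) <= d ->
        spectrally_stable d (c1 a b) b (phi_ker alpha) /\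
        spectrally_stable d (c2 a b) b (phi_ker alpha)) /\
     (d < a ^+ 2 / (4 * alpha ^+ 2) ->
        spectrally_unstable d (c1 a b) b (phi_ker alpha) /\
        spectrally_unstable d (c2 a b) b (phi_ker alpha))).
Proof.
move=> a0 b0 d0 alpha0 _; split.
- move=> ab; split.
    move=> xs xsb /eqP; rewrite subr_eq0 => /eqP tang; have /andP[xs0 _] := xsb.
    split=> h; first exact: stable_at_tangency tang.
    exact: unstable_below_tangency tang.
  apply: unstable_of_small_reaction => //; rewrite /c2.
  have s0 : 0 < Num.sqrt (a ^+ 2 / 4 - b) by rewrite sqrtr_gt0 subr_gt0.
  have s2 : Num.sqrt (a ^+ 2 / 4 - b) ^+ 2 = a ^+ 2 / 4 - b by rewrite sqr_sqrtr ?subr_ge0 ?ltW.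
  move: (Num.sqrt _) s0 s2 => s s0 s2.
  have sa : s < a / 2.
    rewrite -(@ltr_pXn2r _ 2)// ?nnegrE ?(ltW s0) ?divr_ge0 ?(ltW a0)// s2.
    have e : (a / 2) ^+ 2 = a ^+ 2 / 4 by field.
    by rewrite e; lra.
  (* Since [b = a^2/4 - s^2], the difference [b - c_2^2] equals [2 s (a/2 - s)]. *)
  have : 0 < s * (a / 2 - s) by rewrite mulr_gt0// subr_gt0.
  have -> : (a / 2 - s) ^+ 2 = a ^+ 2 / 4 - a * s + s ^+ 2 by field.
  have s3 : s * s = a ^+ 2 / 4 - b by rewrite -s2 expr2.
  by rewrite s2; lra.
- move=> ab; rewrite /c1 /c2 ab subrr sqrtr0 addr0 subr0.
  have cb : (a / 2) ^+ 2 = b by rewrite -ab; field.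
  have -> : a ^+ 2 / (4 * alpha ^+ 2) = b / alpha ^+ 2.
    by rewrite -ab; field; exact: lt0r_neq0.
  split=> h.
    have st : spectrally_stable d (a / 2) b (phi_ker alpha).
      by apply: (stable_at_tangency (x := b)) => //; rewrite cb; ring.
    by split.
  have un : spectrally_unstable d (a / 2) b (phi_ker alpha) by exact: unstable_double_root.
  by split.
Qed.
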